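(* Let $1<p<\infty$, $1/p+1/q=1$, and let $T_p(a)+H_p(b)\in\mathcal L^{p,q}$. Then the Fourier transform $\mathcal F$, $h\mapsto(\hat h_n)_{n\in\mathbb Z_+}$, restricts to an isomorphism from $\ker(\mathbf T_q(a)+\mathbf H_q(b))\subset H^q$ onto $\ker(T_p(a)+H_p(b))\subset l^p$.
   Context: $l^p=l^p(\mathbb Z_+)$ is the space of $p$-summable complex sequences indexed by nonnegative integers, viewed inside $l^p(\mathbb Z)$. For $a\in L^\infty(\mathbb T)$ with Fourier coefficients $\hat a_k$, the Laurent operator $L(a)$ acts on finitely supported sequences by $(L(a)x)_k=\sum_m\hat a_{k-m}x_m$; $a$ is a multiplier on $l^p(\mathbb Z)$, written $a\in M^p$, if $L(a)$ extends to a bounded operator on $l^p(\mathbb Z)$. For $a\in M^p$, the Toeplitz and Hankel operators on $l^p$ are $T_p(a):(\xi_j)\mapsto(\sum_{k\ge0}\hat a_{j-k}\xi_k)_{j\ge0}$ and $H_p(a):(\xi_j)\mapsto(\sum_{k\ge0}\hat a_{j+k+1}\xi_k)_{j\ge0}$. For $a,b\in L^\infty(\mathbb T)$, $\mathbf T_s(a)+\mathbf H_s(b)$ denotes the classical Toeplitz plus Hankel operator on the Hardy space $H^s(\mathbb T)$, $\mathbf T_s(a)f=P(af)$, $\mathbf H_s(b)f=P(bQJf)$, with $P$ the Riesz projection, $Q=I-P$, $(Jf)(t)=t^{-1}f(t^{-1})$. $\mathcal L^{p,q}$ denotes the class of operators $T_p(a)+H_p(b)$ such that: $a,b\in M^p$;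 $T_p(a)+H_p(b)$ is Fredholm on $l^p$; $\mathbf T_q(a)+\mathbf H_q(b)$ is Fredholm on $H^q$; and these two operators have the same Fredholm index. *)

(* Defs.v *)
From mathcomp Require Import all_boot all_order all_algebra.
From mathcomp Require Import all_classical all_reals all_analysis.
From mathcomp Require Import complex.
Import Order.TTheory GRing.Theory Num.Theory.
Import numFieldNormedType.Exports.

Set Implicit Arguments.
Unset Strict Implicit.
Unset Printing Implicit Defensive.

Local Open Scope classical_set_scope.
Local Open Scope ring_scope.

Section TplusH.
Variable R : realType.
Local Notation C := R[i].
Local Notation mu := (@lebesgue_measure R).

Definition cabs (z : C) : R := Normc.normc z.

Definition cexpi (t : R) : C := Complex (cos t) (sin t).

(** the unit circle T is parametrised by theta in [0, 2 pi], t = e^{i theta};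
    a function on T is a function  R -> C  of which only the values on
    [0, 2 pi] matter *)
Definition Tdom : set R := [set x : R | 0 <= x <= 2 * pi].

Definition cmeasurable (f : R -> C) : Prop :=
  measurable_fun Tdom (fun x => complex.Re (f x)) /\
  measurable_fun Tdom (fun x => complex.Im (f x)).

Definition ae_zero (f : R -> C) : Prop :=
  {ae mu, forall x, Tdom x -> f x = 0}.

Definition Ls (s : R) (f : R -> C) : Prop :=
  cmeasurable f /\
  (\int[mu]_(x in Tdom) ((cabs (f x)) `^ s)%:E < +oo)%E.

Definition Linf (f : R -> C) : Prop :=
  cmeasurable f /\ exists M : R, {ae mu, forall x, Tdom x -> cabs (f x) <= M}.

Definition fc (f : R -> C) (n : int) : C :=
  let g := fun x => f x * cexpi (- (n%:~R * x)) in
  Complex ((2 * pi)^-1 * Rintegral mu Tdom (fun x => complex.Re (g x)))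
          ((2 * pi)^-1 * Rintegral mu Tdom (fun x => complex.Im (g x))).

Definition Hs (s : R) (f : R -> C) : Prop :=
  Ls s f /\ forall n : int, n < 0 -> fc f n = 0.

(** Riesz projection P on L^s(T): P g is the L^s function whose Fourier
    coefficients are those of g for n >= 0 and 0 for n < 0 (it exists by
    M. Riesz's theorem for 1 < s < oo, and is unique up to a.e. equality). *)
Definition Rproj (s : R) (g : R -> C) : R -> C :=
  xget (fun _ => 0)
    [set h | Ls s h /\ forall n : int, fc h n = if 0 <= n then fc g n else 0].

Definition Qproj (s : R) (g : R -> C) : R -> C := fun x => g x - Rproj s g x.

(** (J f)(t) = t^{-1} f(t^{-1});  t = e^{i x}, t^{-1} = e^{i (2 pi - x)} *)
Definition Jflip (f : R -> C) : R -> C := fun x => cexpi (- x) * f (2 * pi - x).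

Definition TH_Hardy (s : R) (a b : R -> C) (f : R -> C) : R -> C :=
  fun x => Rproj s (fun y => a y * f y) x
         + Rproj s (fun y => b y * Qproj s (Jflip f) y) x.

Definition lp (p : R) (xi : nat -> C) : Prop :=
  (\esum_(k in [set: nat]) ((cabs (xi k)) `^ p)%:E < +oo)%E.

(** Laurent operator L(a) applied to a sequence x : Z -> C supported in [-N, N] *)
Definition LaurentN (a : R -> C) (N : nat) (x : int -> C) (j : int) : C :=
  \sum_(i < (N + N).+1) fc a (j - (i%:Z - N%:Z)) * x (i%:Z - N%:Z).

(** a is a multiplier on l^p(Z): a in L^oo and L(a) is bounded on finitely
    supported sequences w.r.t. the l^p norm (hence extends boundedly) *)
Definition Mp (p : R) (a : R -> C) : Prop :=
  Linf a /\
  exists K : R, forall (N : nat) (x : int -> C),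
    (forall k : int, N%:Z < `|k| -> x k = 0) ->
    (\esum_(j in [set: int]) ((cabs (LaurentN a N x j)) `^ p)%:E
      <= (K `^ p)%:E * \esum_(k in [set: int]) ((cabs (x k)) `^ p)%:E)%E.

Definition climit (u : nat -> C) : C :=
  Complex (limn (fun n => complex.Re (u n))) (limn (fun n => complex.Im (u n))).

(** T_p(a) + H_p(b) on l^p, coordinatewise; for a, b in M^p the limits of
    the partial sums exist and agree with the bounded extension *)
Definition Tp (a : R -> C) (xi : nat -> C) : nat -> C :=
  fun j => climit (fun N => \sum_(k < N) fc a (j%:Z - k%:Z) * xi k).
Definition Hp (b : R -> C) (xi : nat -> C) : nat -> C :=
  fun j => climit (fun N => \sum_(k < N) fc b (j%:Z + k%:Z + 1) * xi k).
Definition TH_lp (a b : R -> C) (xi : nat -> C) : nat -> C :=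
  fun j => Tp a xi j + Hp b xi j.

(** generic Fredholm theory for linear operators A on a space S of functions
    X -> C, modulo a "null" subspace Z (Z = a.e.-zero functions for L^s,
    Z = identically zero sequences for l^p) *)
Definition lincomb (X : Type) (n : nat) (c : 'I_n -> C) (g : 'I_n -> X -> C) :
  X -> C := fun x => \sum_(i < n) c i * g i x.

Definition kerdim (X : Type) (S Z : set (X -> C)) (A : (X -> C) -> X -> C)
  (d : nat) : Prop :=
  exists g : 'I_d -> X -> C,
    [/\ forall i, S (g i) /\ Z (A (g i)),
        forall c, Z (lincomb c g) -> forall i, c i = 0 &
        forall f, S f -> Z (A f) -> exists c, Z (fun x => f x - lincomb c g x)].

Definition cokerdim (X : Type) (S Z : set (X -> C)) (A : (X -> C) -> X -> C)
  (d : nat) : Prop :=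
  exists g : 'I_d -> X -> C,
    [/\ forall i, S (g i),
        forall c f, S f -> Z (fun x => lincomb c g x - A f x) ->
          forall i, c i = 0 &
        forall h, S h -> exists c f,
          S f /\ Z (fun x => h x - lincomb c g x - A f x)].

Definition fredholm_index (X : Type) (S Z : set (X -> C))
  (A : (X -> C) -> X -> C) (k : int) : Prop :=
  (forall f, S f -> S (A f)) /\
  exists dk dc : nat,
    [/\ kerdim S Z A dk, cokerdim S Z A dc & k = dk%:Z - dc%:Z].

Definition fredholm (X : Type) (S Z : set (X -> C)) (A : (X -> C) -> X -> C) :=
  exists k : int, fredholm_index S Z A k.

Definition seq_zero (xi : nat -> C) : Prop := forall n, xi n = 0.

Definition class_Lpq (p q : R) (a b : R -> C) : Prop :=
  [/\ Mp p a, Mp p b,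
      fredholm (lp p) seq_zero (TH_lp a b),
      fredholm (Hs q) ae_zero (TH_Hardy q a b) &
      exists k : int, fredholm_index (lp p) seq_zero (TH_lp a b) k /\
                      fredholm_index (Hs q) ae_zero (TH_Hardy q a b) k].

Definition fourier_plus (h : R -> C) : nat -> C := fun n => fc h n%:Z.

End TplusH.

(* Main.v *)
Require Import Defs.
From HB Require Import structures.
From mathcomp Require Import all_boot all_order all_algebra.
From mathcomp Require Import all_classical all_reals all_analysis.
From mathcomp Require Import complex measurable_realfun ring lra.
Import Order.TTheory GRing.Theory Num.Theory.
Import numFieldNormedType.Exports.

(** Write [A] for [T(a) + H(b)] on [H^q] and [B] for [T(a) + H(b)] on [l^p].  If [q <= 2], the
    Hausdorff-Young inequality makes the Fourier transform an injective map of [H^q] onto a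
    dense subspace of [l^p] which intertwines [A] and [B]; if [p <= 2], the dual inequality makes
    the inverse transform an injective map of [l^p] onto a dense subspace of [H^q] which
    intertwines [B] and [A].  In both cases an operator on a dense, densely included space [E]
    is the restriction of a bounded operator on a Banach space [G].  The kernel on [E] embeds in
    the kernel on [G].  The range on [G] is closed (open mapping theorem), so representatives of
    a basis of the cokernel on [G] can be moved into [E] and stay independent modulo the range;
    hence the cokernel on [E] is at least as large as that on [G].  Since the two indices
    agree, both inequalities are equalities, and the two kernels coincide.

    M. Riesz's projection theorem is proved for [1 < q <= 2] by P. Stein's method: for a mean-free
    trigonometric polynomial [f] with conjugate [g], and [c = 2 / (q - 1)], the integral of
    [c (1 + |f|^2)^(q/2) - (1 + |f|^2 + |g|^2)^(q/2)] over a circle is a convex function of the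
    logarithm of the radius, hence at least its limit at the centre, which is nonnegative.
    Duality gives [q > 2]. *)

Set Implicit Arguments.
Unset Strict Implicit.
Unset Printing Implicit Defensive.

Local Open Scope classical_set_scope.
Local Open Scope ring_scope.

Local Notation Re := complex.Re.
Local Notation Im := complex.Im.

(** * The modulus on C *)

Section ComplexModulus.
Variable R : realType.
Implicit Types (z w : R[i]) (x t : R).

(** The Fourier transform is bounded between the two spaces in one direction only, decided by
    whether [q <= 2] or [p <= 2]. For the opposite inclusion of the kernels no estimate is at hand,
    and the equality of the indices takes its place. Hausdorff-Young is proved up to a constant: [f]
    is cut at a separate height for each dyadic size of coefficient, and Bessel's inequality is
    applied to the bounded pieces. In Stein's argument the summand 1 keeps the powers smooth at
    common zeros, and [c] is the number that makes the Laplacian of the integrand nonnegative: the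
    Cauchy-Riemann equations double the gradient in the subtracted term, while the concavity of the
    power costs the first term a factor [q - 1]. Functions equal almost everywhere are not
    identified, and [Rproj] is a choice among such functions. Hence the norms are seminorms, the
    operators on [H^q] are linear only up to null functions, and identities between vectors read
    [N (f - g) = 0]. *)

Lemma cabsE z : cabs z = Num.sqrt (Re z ^+ 2 + Im z ^+ 2).
Proof. by case: z. Qed.

Lemma cabs_ge0 z : 0 <= cabs z.
Proof. by rewrite cabsE sqrtr_ge0. Qed.

Lemma cabs2 z : cabs z ^+ 2 = Re z ^+ 2 + Im z ^+ 2.
Proof. by rewrite cabsE sqr_sqrtr// addr_ge0// sqr_ge0. Qed.

Lemma cabs0 : cabs (0 : R[i]) = 0.
Proof. exact: Normc.normc0. Qed.

Lemma cabs1 : cabs (1 : R[i]) = 1.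
Proof. exact: Normc.normc1. Qed.

Lemma cabs_eq0 z : cabs z = 0 -> z = 0.
Proof. exact: Normc.eq0_normc. Qed.

Lemma cabsM z w : cabs (z * w) = cabs z * cabs w.
Proof. exact: Normc.normcM. Qed.

Lemma cabsD z w : cabs (z + w) <= cabs z + cabs w.
Proof. exact: le_normcD. Qed.

Lemma cabsN z : cabs (- z) = cabs z.
Proof. exact: normcN. Qed.

Lemma cabsBC z w : cabs (z - w) = cabs (w - z).
Proof. by rewrite -cabsN opprB. Qed.

Lemma cabs_conj z : cabs (conjc z) = cabs z.
Proof. by case: z => a b; rewrite !cabsE /= sqrrN. Qed.

Lemma Re_le_cabs z : `|Re z| <= cabs z.
Proof.
rewrite cabsE -sqrtr_sqr ler_sqrt ?addr_ge0 ?sqr_ge0//.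
by rewrite lerDl sqr_ge0.
Qed.

Lemma Im_le_cabs z : `|Im z| <= cabs z.
Proof.
rewrite cabsE -sqrtr_sqr ler_sqrt ?addr_ge0 ?sqr_ge0//.
by rewrite lerDr sqr_ge0.
Qed.

Lemma cabs_le_ReIm z : cabs z <= `|Re z| + `|Im z|.
Proof.
rewrite -(@ler_pXn2r _ 2)// ?nnegrE ?cabs_ge0 ?addr_ge0// cabs2 sqrrD.
rewrite -!normrX !(ger0_norm (sqr_ge0 _)) -addrA lerD2l lerDr.
by rewrite mulrn_wge0// mulr_ge0.
Qed.

Lemma cabs_real x : cabs (x%:C)%C = `|x|.
Proof. by rewrite cabsE /= expr0n /= addr0 sqrtr_sqr. Qed.

Lemma cabs_sum (I : Type) (r : seq I) (P : pred I) (F : I -> R[i]) :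
  cabs (\sum_(i <- r | P i) F i) <= \sum_(i <- r | P i) cabs (F i).
Proof.
elim/big_rec2 : _ => [|i y z _ h]; first by rewrite cabs0.
exact: le_trans (cabsD _ _) (lerD _ h).
Qed.

Lemma cReD z w : Re (z + w) = Re z + Re w. Proof. by case: z w => ? ? []. Qed.
Lemma cImD z w : Im (z + w) = Im z + Im w. Proof. by case: z w => ? ? []. Qed.
Lemma cReN z : Re (- z) = - Re z. Proof. by case: z. Qed.
Lemma cImN z : Im (- z) = - Im z. Proof. by case: z. Qed.
Lemma cReM z w : Re (z * w) = Re z * Re w - Im z * Im w.
Proof. by case: z w => ? ? []. Qed.
Lemma cImM z w : Im (z * w) = Re z * Im w + Im z * Re w.
Proof. by case: z w => ? ? []. Qed.

Lemma cRe_sum (I : Type) (r : seq I) (P : pred I) (F : I -> R[i]) :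
  Re (\sum_(i <- r | P i) F i) = \sum_(i <- r | P i) Re (F i).
Proof. exact: (big_morph _ cReD erefl). Qed.
Lemma cIm_sum (I : Type) (r : seq I) (P : pred I) (F : I -> R[i]) :
  Im (\sum_(i <- r | P i) F i) = \sum_(i <- r | P i) Im (F i).
Proof. exact: (big_morph _ cImD erefl). Qed.

Lemma complex_ext z w : Re z = Re w -> Im z = Im w -> z = w.
Proof. by case: z w => ? ? [] ? ? /= -> ->. Qed.

Lemma mul_conj z : z * conjc z = (cabs z ^+ 2)%:C%C.
Proof.
by rewrite cabs2; apply: complex_ext; rewrite ?cReM ?cImM; case: z => a b /=; ring.
Qed.

End ComplexModulus.

Opaque cabs.

(** The same formula serves [L^s] of the circle and, with the counting measure, [l^p]. For an
    infinite integral [fine] returns 0, so a bound on [nrm] says something only together with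
    membership in [LS]; this is why the lemmas below prove both at once. *)
HB.lock Definition nrm {d} {T : measurableType d} {R : realType}
    (mu : {measure set T -> \bar R}) (D : set T) (s : R) (f : T -> R[i]) : R :=
  fine (\int[mu]_(x in D) ((cabs (f x)) `^ s)%:E)%E `^ s^-1.

(** * Complex Lebesgue spaces *)

Section Lebesgue_spaces.
Context d (T : measurableType d) (R : realType).
Variables (mu : {measure set T -> \bar R}) (D : set T) (mD : measurable D).
Local Notation C := R[i].
Implicit Types (f g : T -> C) (s : R).

Definition cmeas f :=
  measurable_fun D (fun x => Re (f x)) /\ measurable_fun D (fun x => Im (f x)).

Lemma cmeasD f g : cmeas f -> cmeas g -> cmeas (fun x => f x + g x).
Proof.
move=> [f1 f2] [g1 g2]; split.
  by under eq_fun do rewrite cReD; exact: measurable_funD.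
by under eq_fun do rewrite cImD; exact: measurable_funD.
Qed.

Lemma cmeasM f g : cmeas f -> cmeas g -> cmeas (fun x => f x * g x).
Proof.
move=> [f1 f2] [g1 g2]; split.
  under eq_fun do rewrite cReM.
  by apply: measurable_funB; apply: measurable_funM.
under eq_fun do rewrite cImM.
by apply: measurable_funD; apply: measurable_funM.
Qed.

Lemma cmeas_cst (c : C) : cmeas (fun=> c).
Proof. by split; exact: measurable_cst. Qed.

Lemma cmeasZ (c : C) f : cmeas f -> cmeas (fun x => c * f x).
Proof. by move=> mf; apply: cmeasM => //; exact: cmeas_cst. Qed.

Lemma cmeasN f : cmeas f -> cmeas (fun x => - f x).
Proof.
by move=> /(cmeasZ (-1)); congr cmeas; apply/funext => x; rewrite mulN1r.
Qed.

Lemma cmeasB f g : cmeas f -> cmeas g -> cmeas (fun x => f x - g x).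
Proof. by move=> mf mg; apply: cmeasD => //; exact: cmeasN. Qed.

Lemma cmeas_conj f : cmeas f -> cmeas (fun x => conjc (f x)).
Proof.
move=> [f1 f2]; split.
  by apply: eq_measurable_fun f1 => x _; case: (f x).
have : measurable_fun D (fun x => - Im (f x)) by exact: measurable_funN.
by apply: eq_measurable_fun => x _; case: (f x).
Qed.

Lemma cmeas_sum (I : Type) (r : seq I) (P : pred I) (F : I -> T -> C) :
  (forall i, cmeas (F i)) -> cmeas (fun x => \sum_(i <- r | P i) F i x).
Proof.
move=> mF; elim: r => [|i r IH].
  under eq_fun do rewrite big_nil; exact: cmeas_cst.
under eq_fun do rewrite big_cons.
by case: (P i) => //; exact: cmeasD.
Qed.

Lemma cmeas_real (h : T -> R) : measurable_fun D h -> cmeas (fun x => (h x)%:C%C).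
Proof. by move=> mh; split => //=; exact: measurable_cst. Qed.

Lemma measurable_cabs f : cmeas f -> measurable_fun D (fun x => cabs (f x)).
Proof.
move=> [f1 f2].
have -> : (fun x => cabs (f x)) =
    (fun x => (Re (f x) ^+ 2 + Im (f x) ^+ 2) `^ 2^-1).
  by apply/funext => x; rewrite cabsE powR12_sqrt// addr_ge0// sqr_ge0.
apply: (measurableT_comp (measurable_powR _)).
by apply: measurable_funD; apply: measurable_funX.
Qed.

Lemma measurable_cabs_powR s f :
  cmeas f -> measurable_fun D (fun x => cabs (f x) `^ s).
Proof.
by move=> mf; apply: (measurableT_comp (measurable_powR _)); exact: measurable_cabs.
Qed.


Definition LS s f :=
  cmeas f /\ (\int[mu]_(x in D) ((cabs (f x)) `^ s)%:E < +oo)%E.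

Local Notation nrm := (nrm mu D).

Lemma nrmE s f :
  nrm s f = fine (\int[mu]_(x in D) ((cabs (f x)) `^ s)%:E)%E `^ s^-1.
Proof. by rewrite nrm.unlock. Qed.

Lemma nrm_ge0 s f : 0 <= nrm s f.
Proof. by rewrite nrmE powR_ge0. Qed.

Lemma LS_fin_num s f : LS s f ->
  (\int[mu]_(x in D) ((cabs (f x)) `^ s)%:E)%E \is a fin_num.
Proof.
move=> [_ fi]; rewrite ge0_fin_numE//.
by apply: integral_ge0 => x _; rewrite lee_fin powR_ge0.
Qed.

Lemma nrm_powR s f : 0 < s -> LS s f ->
  (\int[mu]_(x in D) ((cabs (f x)) `^ s)%:E)%E = ((nrm s f) `^ s)%:E.
Proof.
move=> s0 Lf; rewrite nrmE -powRrM mulVf ?gt_eqF// powRr1 ?fineK ?LS_fin_num//.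
apply: fine_ge0; apply: integral_ge0 => x _; exact: powR_ge0.
Qed.

(** The modulus is extended by zero outside [D], so that Minkowski's and Hoelder's inequalities for
    integrals over the whole space apply. *)
Let cabsD_ f : T -> \bar R := EFin \o ((fun x => cabs (f x)) \_ D).

Let Lnorm_cabs s f : 0 < s -> ('N[mu]_(s%:E)[cabsD_ f] =
  (\int[mu]_(x in D) ((cabs (f x)) `^ s)%:E) `^ s^-1)%E.
Proof.
move=> s0; rewrite unlock [X in _ = (X `^ _)%E]integral_mkcond.
congr (_ `^ _)%E; apply: eq_integral => x _.
rewrite /cabsD_ /= !patchE; case: ifP => _.
  by rewrite ger0_norm ?cabs_ge0.
by rewrite normr0 powR0// gt_eqF.
Qed.

Let Lnorm_nrm s f : 0 < s -> LS s f -> Lnorm mu s%:E (cabsD_ f) = (nrm s f)%:E.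
Proof.
move=> s0 Lf; rewrite Lnorm_cabs// nrmE -poweR_EFin fineK//.
exact: LS_fin_num.
Qed.

Let cabsD_meas f : cmeas f -> measurable_fun setT ((fun x => cabs (f x)) \_ D).
Proof.
by move=> mf; apply/(measurable_restrictT _ mD).1; exact: measurable_cabs.
Qed.

Lemma LS_le s f g : 0 < s -> cmeas f -> LS s g ->
  (forall x, D x -> cabs (f x) <= cabs (g x)) -> LS s f /\ nrm s f <= nrm s g.
Proof.
move=> s0 mf Lg fg.
have le : (\int[mu]_(x in D) ((cabs (f x)) `^ s)%:E <=
    \int[mu]_(x in D) ((cabs (g x)) `^ s)%:E)%E.
  apply: ge0_le_integral => //.
  - by move=> x _; rewrite lee_fin powR_ge0.
  - by apply/measurable_EFinP; exact: measurable_cabs_powR.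
  - by apply/measurable_EFinP; apply: measurable_cabs_powR; case: Lg.
  - move=> x Dx; rewrite lee_fin ge0_ler_powR ?nnegrE ?cabs_ge0 ?fg//.
    exact: ltW.
have Lf : LS s f by split => //; apply: le_lt_trans le _; case: Lg.
split; first exact: Lf.
rewrite !nrmE.
have fi0 h : 0 <= fine (\int[mu]_(x in D) ((cabs (h x)) `^ s)%:E)%E.
  by apply: fine_ge0; apply: integral_ge0 => x _; exact: powR_ge0.
apply: ge0_ler_powR.
- by rewrite invr_ge0 ltW.
- exact: fi0.
- exact: fi0.
- by apply: fine_le; [exact: LS_fin_num|exact: LS_fin_num|exact: le].
Qed.

Lemma eq_nrm s f g : (forall x, D x -> f x = g x) -> nrm s f = nrm s g.
Proof.
move=> fg; rewrite !nrmE.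
by under eq_integral => x /set_mem Dx do rewrite fg//.
Qed.

Lemma LS_eq_cabs s f g : 0 < s -> cmeas f -> LS s g ->
  (forall x, D x -> cabs (f x) = cabs (g x)) -> LS s f /\ nrm s f = nrm s g.
Proof.
move=> s0 mf Lg fg.
have E : (\int[mu]_(x in D) ((cabs (f x)) `^ s)%:E =
    \int[mu]_(x in D) ((cabs (g x)) `^ s)%:E)%E.
  by apply: eq_integral => x /set_mem Dx; rewrite fg.
by split; [split=> //; rewrite E; case: Lg|rewrite !nrmE E].
Qed.

Lemma LSD s f g : 1 <= s -> LS s f -> LS s g ->
  LS s (fun x => f x + g x) /\ nrm s (fun x => f x + g x) <= nrm s f + nrm s g.
Proof.
move=> s1 Lf Lg; have s0 : 0 < s by apply: lt_le_trans s1.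
have [mf mg] := (Lf.1, Lg.1).
pose h x := ((cabs (f x) + cabs (g x))%:C)%C : C.
have mh : cmeas h.
  by apply: cmeas_real; apply: measurable_funD; exact: measurable_cabs.
have hE x : cabs (h x) = cabs (f x) + cabs (g x).
  by rewrite cabs_real ger0_norm// addr_ge0// cabs_ge0.
have : (Lnorm mu s%:E (EFin \o ((fun x => cabs (f x)) \_ D \+
    (fun x => cabs (g x)) \_ D)%R) <= Lnorm mu s%:E (cabsD_ f) +
    Lnorm mu s%:E (cabsD_ g))%E.
  exact: minkowski_EFin (cabsD_meas mf) (cabsD_meas mg) s1.
rewrite (Lnorm_nrm s0 Lf) (Lnorm_nrm s0 Lg).
have -> : Lnorm mu s%:E (EFin \o ((fun x => cabs (f x)) \_ D \+
    (fun x => cabs (g x)) \_ D)) = Lnorm mu s%:E (cabsD_ h).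
  congr Lnorm; apply/funext => x; rewrite /cabsD_ !fctE; congr EFin.
  rewrite [LHS]/(((fun x => cabs (f x)) \_ D) x + ((fun x => cabs (g x)) \_ D) x).
  by rewrite !patchE; case: ifP => _; [rewrite hE|exact: addr0].
move=> le.
(* An infinite integral would make the left side of Minkowski's inequality infinite, against its
   finite right side. *)
have Lh : LS s h.
  split=> //; rewrite ltey; apply/eqP => hoo.
  by move: le; rewrite (Lnorm_cabs _ s0) hoo poweRyr// gt_eqF ?invr_gt0.
move: le; rewrite (Lnorm_nrm s0 Lh) -EFinD lee_fin => le.
have [] := LS_le s0 (cmeasD mf mg) Lh.
  by move=> x _; rewrite hE cabsD.
by move=> h1 h2; split; [exact: h1|exact: le_trans h2 le].
Qed.

Lemma LSZ s (c : C) f : 0 < s -> LS s f ->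
  LS s (fun x => c * f x) /\ nrm s (fun x => c * f x) = cabs c * nrm s f.
Proof.
move=> s0 [mf fi].
have E : (\int[mu]_(x in D) ((cabs (c * f x)) `^ s)%:E =
    (cabs c `^ s)%:E * \int[mu]_(x in D) ((cabs (f x)) `^ s)%:E)%E.
  rewrite -ge0_integralZl//.
  - by apply: eq_integral => x _; rewrite cabsM powRM ?cabs_ge0// EFinM.
  - by apply/measurable_EFinP; exact: measurable_cabs_powR.
  - by move=> x _; rewrite lee_fin powR_ge0.
  - by rewrite lee_fin powR_ge0.
split.
  split; first exact: cmeasZ.
  by rewrite E lte_mul_pinfty// lee_fin powR_ge0.
rewrite !nrmE E fineM ?LS_fin_num// powRM ?powR_ge0//; last first.
  by apply: fine_ge0; apply: integral_ge0 => x _; exact: powR_ge0.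
by rewrite -powRrM mulfV ?gt_eqF// powRr1// cabs_ge0.
Qed.

Lemma LSN s f : 0 < s -> LS s f ->
  LS s (fun x => - f x) /\ nrm s (fun x => - f x) = nrm s f.
Proof.
move=> s0 /(LSZ (-1) s0)[].
rewrite cabsN cabs1 mul1r; under eq_fun do rewrite mulN1r.
by move=> L; split.
Qed.

Lemma LSB s f g : 1 <= s -> LS s f -> LS s g ->
  LS s (fun x => f x - g x) /\ nrm s (fun x => f x - g x) <= nrm s f + nrm s g.
Proof.
move=> s1 Lf Lg; have s0 : 0 < s by apply: lt_le_trans s1.
by have [Lg' <-] := LSN s0 Lg; exact: LSD.
Qed.

Lemma LS0 s : 0 < s -> LS s (fun=> 0) /\ nrm s (fun=> 0) = 0.
Proof.
move=> s0.
have E : (\int[mu]_(x in D) ((cabs (0 : C)) `^ s)%:E = 0)%E.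
  by rewrite cabs0 powR0 ?gt_eqF// integral0.
split; first by split; [exact: cmeas_cst|rewrite E].
by rewrite nrmE E powR0// invr_neq0// gt_eqF.
Qed.

Lemma LS_sum s (I : Type) (r : seq I) (P : pred I) (F : I -> T -> C) :
  1 <= s -> (forall i, LS s (F i)) -> LS s (fun x => \sum_(i <- r | P i) F i x) /\
  nrm s (fun x => \sum_(i <- r | P i) F i x) <= \sum_(i <- r | P i) nrm s (F i).
Proof.
move=> s1 LF; have s0 : 0 < s by apply: lt_le_trans s1.
elim: r => [|i r [IH1 IH2]].
  have -> : (fun x => \sum_(i <- [::] | P i) F i x) = fun=> 0.
    by apply/funext => x; rewrite big_nil.
  by rewrite big_nil; have [? ->] := LS0 s0.
rewrite big_cons; have [Pi|nPi] := boolP (P i); last first.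
  by under eq_fun do rewrite big_cons (negbTE nPi).
have [h1 h2] := LSD s1 (LF i) IH1.
under eq_fun do rewrite big_cons Pi.
by split; [exact: h1|apply: (le_trans h2); rewrite lerD2l].
Qed.

Lemma nrmBC s f g : 0 < s ->
  nrm s (fun x => f x - g x) = nrm s (fun x => g x - f x).
Proof.
move=> s0; rewrite !nrmE.
by under eq_integral => x _ do rewrite cabsBC.
Qed.

Lemma nrm_eq0 s f : 0 < s -> LS s f ->
  nrm s f = 0 <-> {ae mu, forall x, D x -> f x = 0}.
Proof.
move=> s0 Lf.
have mfs : measurable_fun D (fun x => (cabs (f x) `^ s)%:E).
  by apply/measurable_EFinP; apply: measurable_cabs_powR; case: Lf.
have := ae_eq_integral_abs mu mD mfs.
have -> : (\int[mu]_(x in D) `|(cabs (f x) `^ s)%:E| = (nrm s f `^ s)%:E)%E.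
  rewrite -nrm_powR//; apply: eq_integral => x _.
  by rewrite gee0_abs// lee_fin powR_ge0.
move=> [h1 h2]; split => [n0|fae].
  have := h1 _; rewrite n0 powR0 ?gt_eqF// => /(_ erefl).
  apply: filterS => x /[apply] /= -[] /powR_eq0_eq0 /cabs_eq0; exact.
have : (nrm s f `^ s)%:E = 0%E.
  apply: h2; move: fae; apply: filterS => x /[apply] -> /=.
  by rewrite cabs0 powR0// gt_eqF.
by move=> [] /powR_eq0_eq0.
Qed.

Lemma LS_ae s f g : 0 < s -> LS s f -> cmeas g ->
  {ae mu, forall x, D x -> g x = f x} -> LS s g /\ nrm s g = nrm s f.
Proof.
move=> s0 Lf mg gf.
have E : (\int[mu]_(x in D) ((cabs (g x)) `^ s)%:E =
    \int[mu]_(x in D) ((cabs (f x)) `^ s)%:E)%E.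
  apply: ae_eq_integral => //.
  - by apply/measurable_EFinP; exact: measurable_cabs_powR.
  - by apply/measurable_EFinP; apply: measurable_cabs_powR; case: Lf.
  - by move: gf; apply: filterS => x /[apply] ->.
by split; [split => //; rewrite E; case: Lf|by rewrite !nrmE E].
Qed.

Lemma hoelder_cabs p q f g : 0 < p -> 0 < q -> p^-1 + q^-1 = 1 ->
  LS p f -> LS q g ->
  (\int[mu]_(x in D) (cabs (f x * g x))%:E <= (nrm p f * nrm q g)%:E)%E.
Proof.
move=> p0 q0 pq Lf Lg; have [mf mg] := (Lf.1, Lg.1).
have -> : (nrm p f * nrm q g)%:E =
    (Lnorm mu p%:E (cabsD_ f) * Lnorm mu q%:E (cabsD_ g))%E.
  by rewrite (Lnorm_nrm p0 Lf) (Lnorm_nrm q0 Lg).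
refine (le_trans _ (@hoelder _ _ _ mu _ _ _ _
  (cabsD_meas mf) (cabsD_meas mg) p0 q0 pq)).
rewrite Lnorm1 integral_mkcond le_eqVlt; apply/orP; left; apply/eqP.
apply: eq_integral => x _; rewrite /= !patchE; case: ifP => _.
  by rewrite cabsM ger0_norm// mulr_ge0// cabs_ge0.
by rewrite mulr0 normr0.
Qed.

End Lebesgue_spaces.

(** * Limits of real and complex sequences *)

Section RealSequences.
Variable R : realType.
Implicit Types (u v : nat -> R) (s l : R).

Lemma cvg_lb u l M : u n @[n --> \oo] --> l ->
  (\forall n \near \oo, M <= u n) -> M <= l.
Proof.
move=> ul h; rewrite -(cvg_lim _ ul)//; apply: limr_ge => //.
by apply/cvg_ex; exists l.
Qed.

Lemma cvg_distP u l :
  u n @[n --> \oo] --> l <-> `|u n - l| @[n --> \oo] --> 0.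
Proof.
split=> [/subr_cvg0 h|h]; first by apply/norm_cvg0P.
by apply/subr_cvg0/norm_cvg0P.
Qed.

Lemma cvg_squeeze0 u v : (forall n, 0 <= u n <= v n) ->
  v n @[n --> \oo] --> 0 -> u n @[n --> \oo] --> 0.
Proof.
move=> uv v0; apply: (squeeze_cvgr (f := fun=> 0) _ _ v0).
  exact: nearW.
exact: cvg_cst.
Qed.

Lemma cvg_powR s u l : 0 < s -> (forall n, 0 <= u n) ->
  u n @[n --> \oo] --> l -> (u n `^ s) @[n --> \oo] --> l `^ s.
Proof.
move=> s0 u0 ul.
have l0 : 0 <= l.
  by apply: (cvg_lb ul); exact: nearW.
move: l0; rewrite le_eqVlt => /orP[/eqP l0|l0]; last first.
  have cl : {for l, continuous (fun x : R => x `^ s)}.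
    apply: differentiable_continuous; apply/derivable1_diffP.
    by apply: derivable_powR; rewrite in_itv/= l0.
  exact: (@cvg_comp _ _ _ u (fun x => x `^ s) _ _ _ ul cl).
(* At [l = 0] the power need not be differentiable; instead [u n] is brought below the [s]-th root
   of [e] and the inequality is raised to the power [s]. *)
rewrite -l0 powR0 ?gt_eqF//; apply/cvgr0Pnorm_le => e e0.
have e'0 : 0 < e `^ s^-1 by rewrite powR_gt0.
have := ul; rewrite -l0 => /cvgr0Pnorm_le /(_ _ e'0); apply: filterS => n un.
rewrite ger0_norm ?powR_ge0//.
have -> : e = (e `^ s^-1) `^ s by rewrite -powRrM mulVf ?gt_eqF// powRr1// ltW.
by apply: ge0_ler_powR; rewrite ?nnegrE ?powR_ge0 ?(ltW s0)// -(ger0_norm (u0 n)).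
Qed.

End RealSequences.

Section ComplexSequences.
Variable R : realType.
Implicit Types (u v : nat -> R[i]) (l m : R[i]).

(** Coordinatewise, to fit [climit]; [ccvgP] turns it into convergence of moduli, in which the
    estimates are made. *)
Definition ccvg u l :=
  (Re (u n) @[n --> \oo] --> Re l) /\ (Im (u n) @[n --> \oo] --> Im l).

Lemma ccvgP u l : ccvg u l <-> cabs (u n - l) @[n --> \oo] --> 0.
Proof.
split=> [[/cvg_distP h1 /cvg_distP h2]|h].
  have h : `|Re (u n) - Re l| + `|Im (u n) - Im l| @[n --> \oo] --> 0.
    by rewrite -(addr0 0); exact: cvgD.
  apply: cvg_squeeze0 h => n; rewrite cabs_ge0 (le_trans (cabs_le_ReIm _))//.
  by rewrite !cReD !cImD !cReN !cImN.
split; apply/cvg_distP; apply: cvg_squeeze0 h => n; rewrite normr_ge0/=.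
  by rewrite -cReN -cReD Re_le_cabs.
by rewrite -cImN -cImD Im_le_cabs.
Qed.

Lemma ccvg_cabs u l : ccvg u l -> cabs (u n) @[n --> \oo] --> cabs l.
Proof.
move=> /ccvgP h; apply/cvg_distP; apply: cvg_squeeze0 h => n.
rewrite normr_ge0/= ler_distl; apply/andP; split.
  by rewrite lerBlDr (cabsBC (u n)); have := cabsD (u n) (l - u n); rewrite subrKC.
by have := cabsD l (u n - l); rewrite subrKC.
Qed.

Lemma ccvg_cst l : ccvg (fun=> l) l.
Proof. by split; exact: cvg_cst. Qed.

Lemma ccvgD u v l m : ccvg u l -> ccvg v m -> ccvg (fun n => u n + v n) (l + m).
Proof.
move=> [h1 h2] [k1 k2]; split.
  by under eq_fun do rewrite cReD; rewrite cReD; exact: cvgD.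
by under eq_fun do rewrite cImD; rewrite cImD; exact: cvgD.
Qed.

Lemma ccvgN u l : ccvg u l -> ccvg (fun n => - u n) (- l).
Proof.
move=> [h1 h2]; split.
  by under eq_fun do rewrite cReN; rewrite cReN; exact: cvgN.
by under eq_fun do rewrite cImN; rewrite cImN; exact: cvgN.
Qed.

Lemma ccvgB u v l m : ccvg u l -> ccvg v m -> ccvg (fun n => u n - v n) (l - m).
Proof. by move=> h k; apply: ccvgD => //; exact: ccvgN. Qed.

Lemma ccvgZ c u l : ccvg u l -> ccvg (fun n => c * u n) (c * l).
Proof.
move=> /ccvgP h; apply/ccvgP.
rewrite -(mulr0 (cabs c)).
under eq_fun do rewrite -mulrBr cabsM.
exact: cvgMl_tmp.
Qed.

Lemma ccvg_unique u l m : ccvg u l -> ccvg u m -> l = m.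
Proof.
move=> [h1 h2] [k1 k2]; apply: complex_ext.
  exact: (cvg_unique _ h1 k1).
exact: (cvg_unique _ h2 k2).
Qed.

Lemma ccvg_shift N u l : ccvg u l -> ccvg (fun n => u (N + n)%N) l.
Proof.
move=> [h1 h2]; split.
  exact: (@cvg_comp _ _ _ (addn N) (fun n => Re (u n)) _ _ _ (@cvg_addnl N) h1).
exact: (@cvg_comp _ _ _ (addn N) (fun n => Im (u n)) _ _ _ (@cvg_addnl N) h2).
Qed.

Lemma ccvg_climit u l : ccvg u l -> climit u = l.
Proof.
move=> [h1 h2]; apply: complex_ext => /=.
  exact: (cvg_lim _ h1).
exact: (cvg_lim _ h2).
Qed.

Lemma ccvg_abs_series u (M : R) :
  (forall n, \sum_(i < n) cabs (u i) <= M) ->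
  exists l, ccvg (fun n => \sum_(i < n) u i) l.
Proof.
move=> uM.
have cv (v : nat -> R) : (forall i, `|v i| <= cabs (u i)) ->
    cvgn (fun n => \sum_(i < n) v i).
  move=> vu.
  have : cvgn (series (fun i => `|v i|)).
    apply: nondecreasing_is_cvgn.
      by apply/nondecreasing_seqP => n; rewrite /series/= big_nat_recr//= lerDl.
    exists M => _ [n _ <-]; rewrite /= /series/= big_mkord.
    by apply: le_trans (uM n); apply: ler_sum.
  move=> /(@normed_cvg R R^o v).
  have -> // : series v = (fun n => \sum_(i < n) v i).
  by apply/funext => n; rewrite /series/= big_mkord.
have c1 := cv (fun i => Re (u i)) (fun i => Re_le_cabs (u i)).
have c2 := cv (fun i => Im (u i)) (fun i => Im_le_cabs (u i)).
exists (Complex (limn (fun n => \sum_(i < n) Re (u i)))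
                (limn (fun n => \sum_(i < n) Im (u i)))).
split => /=.
  by under eq_fun do rewrite cRe_sum; exact: c1.
by under eq_fun do rewrite cIm_sum; exact: c2.
Qed.

End ComplexSequences.

Definition trunc (R : realType) (T : Type) (M : R) (f : T -> R[i]) (x : T) : R[i] :=
  if cabs (f x) <= M then f x else 0.

(** * Completeness of L^s, dominated convergence and truncation *)

Section Riesz_Fischer.
Context d (T : measurableType d) (R : realType).
Variables (mu : {measure set T -> \bar R}) (D : set T) (mD : measurable D).
Local Notation C := R[i].
Local Notation LS := (LS mu D).
Local Notation nrm := (nrm mu D).
Implicit Types (f g : T -> C) (s : R).

Lemma nrm_le s f c : 0 < s -> 0 <= c -> cmeas D f ->
  (\int[mu]_(x in D) ((cabs (f x)) `^ s)%:E <= (c `^ s)%:E)%E ->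
  LS s f /\ nrm s f <= c.
Proof.
move=> s0 c0 mf fc.
have Lf : LS s f by split => //; apply: le_lt_trans fc _; rewrite ltry.
split; first exact: Lf.
move: fc; rewrite (nrm_powR s0 Lf) lee_fin => fc.
rewrite leNgt; apply/negP => cf; move: fc; apply/negP; rewrite -ltNge.
by apply: gt0_ltr_powR; rewrite ?nnegrE ?nrm_ge0.
Qed.

Lemma limn_einf_le (u : nat -> \bar R) (c : \bar R) :
  (forall n, (u n <= c)%E) -> (limn_einf u <= c)%E.
Proof.
move=> uc; rewrite limn_einf_lim; apply: lime_le; first exact: is_cvg_einfs.
apply: nearW => n; apply: le_trans (uc n); apply: ereal_inf_lbound.
by exists n => //=.
Qed.

Lemma ler_sum_half n : \sum_(i < n) (2^-1 : R) ^+ i <= 2.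
Proof.
have -> : \sum_(i < n) (2^-1 : R) ^+ i = 2 - 2 * 2^-1 ^+ n.
  elim: n => [|n IH]; first by rewrite big_ord0 expr0; lra.
  by rewrite big_ord_recr/= IH exprS; lra.
by rewrite gerBl mulr_ge0// exprn_ge0.
Qed.

Section series.
Variables (s : R) (u : nat -> T -> C) (K : R).
Hypotheses (s1 : 1 <= s) (Lu : forall n, LS s (u n)).
Hypothesis uK : forall n, nrm s (u n) <= K * 2^-1 ^+ n.

Let s0 : 0 < s. Proof. exact: lt_le_trans s1. Qed.
Let K0 : 0 <= K.
Proof. by have := le_trans (nrm_ge0 _ _ _ _) (uK 0); rewrite expr0 mulr1. Qed.

Let g n m x : R := \sum_(i < m) cabs (u (n + i) x).

Let g_ge0 n m x : 0 <= g n m x.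
Proof. by apply: sumr_ge0 => i _; exact: cabs_ge0. Qed.

Let mg n m : measurable_fun D (g n m).
Proof.
rewrite /g; apply: measurable_sum => i; apply: measurable_cabs.
by case: (Lu (n + i)).
Qed.

Let Lg n m : LS s (fun x => (g n m x)%:C%C) /\
  nrm s (fun x => (g n m x)%:C%C) <= 2 * K * 2^-1 ^+ n.
Proof.
pose v i x : C := ((cabs (u (n + i) x))%:C)%C.
have Lv i : LS s (v i) /\ nrm s (v i) <= K * 2^-1 ^+ (n + i).
  have mv : cmeas D (v i).
    by apply: cmeas_real; apply: measurable_cabs; case: (Lu (n + i)).
  have [|h1 h2] := LS_le mD s0 mv (Lu (n + i)).
    by move=> x _; rewrite cabs_real ger0_norm ?cabs_ge0.
  by split; [exact: h1|exact: le_trans h2 (uK _)].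
have [h1 h2] := LS_sum mD (index_enum 'I_m) xpredT s1 (fun i : 'I_m => (Lv i).1).
have E : (fun x => (g n m x)%:C%C) = (fun x => \sum_(i < m) v i x).
  by apply/funext => x; rewrite rmorph_sum.
rewrite E; split; first exact: h1.
apply: (le_trans h2).
apply: (@le_trans _ _ (\sum_(i < m) K * 2^-1 ^+ n * 2^-1 ^+ i)).
  by apply: ler_sum => i _; rewrite -mulrA -exprD; case: (Lv i).
rewrite -mulr_sumr [leRHS](_ : _ = K * 2^-1 ^+ n * 2); last by ring.
by apply: ler_wpM2l; [rewrite mulr_ge0 ?exprn_ge0|exact: ler_sum_half].
Qed.

Let int_g n m : (\int[mu]_(x in D) ((g n m x) `^ s)%:E <=
  ((2 * K * 2^-1 ^+ n) `^ s)%:E)%E.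
Proof.
have [h1 h2] := Lg n m.
have := nrm_powR s0 h1.
under eq_integral => x _ do rewrite cabs_real ger0_norm ?g_ge0//.
move=> ->; rewrite lee_fin; apply: ge0_ler_powR (h2); rewrite ?(ltW s0)//.
  by rewrite nnegrE nrm_ge0.
by rewrite nnegrE !mulr_ge0 ?exprn_ge0.
Qed.

(** Minkowski's inequality bounds the [L^s] norms of the sums of moduli by a geometric series,
    uniformly in [m]. Monotone convergence then makes the limit of their [s]-th powers integrable,
    hence finite almost everywhere. *)
Let ae_bounded : {ae mu, forall x, D x -> exists M, forall m, g 0 m x <= M}.
Proof.
pose h m x := ((g 0 m x) `^ s)%:E.
have h0 m x : D x -> (0 <= h m x)%E by move=> _; rewrite lee_fin powR_ge0.
have mh m : measurable_fun D (h m).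
  by apply/measurable_EFinP; apply: (measurableT_comp (measurable_powR _)).
have ndh x : D x -> {homo h ^~ x : m n / (m <= n)%N >-> (m <= n)%E}.
  move=> _ m n mn; rewrite lee_fin; apply: ge0_ler_powR; rewrite ?(ltW s0)//.
  - by rewrite nnegrE g_ge0.
  - by rewrite nnegrE g_ge0.
  - have gnd : nondecreasing_seq (fun n => g 0 n x).
      by apply/nondecreasing_seqP => k; rewrite /g big_ord_recr/= lerDl cabs_ge0.
    exact: gnd.
have hcv x : D x -> h ^~ x @ \oo --> limn (h ^~ x).
  by move=> Dx; apply: ereal_nondecreasing_is_cvgn; exact: ndh.
have ml : measurable_fun D (fun x => limn (h ^~ x)).
  exact: emeasurable_fun_cvg mh hcv.
have l0 x : D x -> (0 <= limn (h ^~ x))%E.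
  by move=> Dx; apply: lime_ge; [exact: hcv|apply: nearW => n; exact: h0].
have ih : mu.-integrable D (fun x => limn (h ^~ x)).
  apply/integrableP; split; first exact: ml.
  under eq_integral => x /set_mem Dx do rewrite gee0_abs ?l0//.
  rewrite (monotone_convergence mu mD mh h0 ndh).
  apply: (@le_lt_trans _ _ ((2 * K * 2^-1 ^+ 0) `^ s)%:E); last by rewrite ltry.
  apply: lime_le.
    apply: ereal_nondecreasing_is_cvgn => m n mn.
    by apply: ge0_le_integral => //; [exact: h0|move=> x Dx; exact: ndh].
  by apply: nearW => n; exact: int_g.
have := integrable_ae mD ih; apply: filterS => x h1 Dx.
have Dfin := h1 Dx.
exists ((fine (limn (h ^~ x))) `^ s^-1) => m.
have le : (h m x <= limn (h ^~ x))%E.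
  rewrite (cvg_lim _ (ereal_nondecreasing_cvgn (ndh x Dx)))//.
  by apply: ereal_sup_ubound; exists m.
rewrite -(fineK Dfin) lee_fin in le.
have {1}-> : g 0 m x = ((g 0 m x) `^ s) `^ s^-1.
  by rewrite -powRrM mulfV ?gt_eqF// powRr1.
apply: ge0_ler_powR => //; first by rewrite invr_ge0 ltW.
  by rewrite nnegrE powR_ge0.
by rewrite nnegrE (le_trans _ le)// powR_ge0.
Qed.

Let S n x : C := \sum_(i < n) u i x.

Let mS n : cmeas D (S n).
Proof. by apply: cmeas_sum => i; case: (Lu i). Qed.

(** The upper limit is measurable before anything is known about convergence; where the series
    converges it is the limit. *)
Let lim_part (p : C -> R) x : R := fine (limn_esup (fun n => (p (S n x))%:E)).

Let f x : C := Complex (lim_part (@Re R) x) (lim_part (@Im R) x).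

Let mf : cmeas D f.
Proof.
have mp (p : C -> R) : (forall n, measurable_fun D (fun x => p (S n x))) ->
    measurable_fun D (lim_part p).
  move=> mpS; apply: (@measurableT_comp _ _ _ _ _ _ fine) => //.
  by apply: measurable_fun_limn_esup => n; apply/measurable_EFinP.
by split; apply: mp => n; have [] := mS n.
Qed.

Let S_shift n m x : S (n + m) x - S n x = \sum_(i < m) u (n + i) x.
Proof. by rewrite /S big_split_ord/= addrAC subrr add0r. Qed.

Let cvgS x : (exists M, forall m, g 0 m x <= M) -> ccvg (S ^~ x) (f x).
Proof.
move=> [M gM].
have [l Sl] := @ccvg_abs_series R (u ^~ x) M gM.
suff -> : f x = l by [].
have lp (p : C -> R) : p (S n x) @[n --> \oo] --> p l -> lim_part p x = p l.
  move=> pl; rewrite /lim_part.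
  have h : (fun n => (p (S n x))%:E) @ \oo --> (p l)%:E.
    by apply: cvg_EFin => //; exact: nearW.
  by have [_ ->] := cvg_limn_einf_sup h.
by case: Sl => h1 h2; apply: complex_ext; [exact: lp|exact: lp].
Qed.

(** The series converges absolutely almost everywhere, and Fatou's lemma passes the uniform bound
    for [S (n + m) - S n] to the limit in [m]. The factor 2 is the sum of the powers of 1/2. *)
Lemma riesz_fischer_series : exists f, LS s f /\
  forall n, nrm s (fun x => f x - \sum_(i < n) u i x) <= 2 * K * 2^-1 ^+ n.
Proof.
have c0 n : 0 <= 2 * K * 2^-1 ^+ n by rewrite !mulr_ge0 ?exprn_ge0.
have tail n : LS s (fun x => f x - S n x) /\
    nrm s (fun x => f x - S n x) <= 2 * K * 2^-1 ^+ n.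
  have mfS : cmeas D (fun x => f x - S n x) by exact: cmeasB.
  apply: nrm_le => //.
  pose phi m x := ((cabs (S (n + m) x - S n x)) `^ s)%:E.
  have mphi m : measurable_fun D (phi m).
    apply/measurable_EFinP; apply: measurable_cabs_powR => //.
    exact: cmeasB.
  have phi0 m x : D x -> (0 <= phi m x)%E by rewrite lee_fin powR_ge0.
  have mliminf : measurable_fun D (fun x => limn_einf (phi ^~ x)).
    under eq_fun do rewrite -[limn_einf _]oppeK -limn_esupN.
    apply: measurableT_comp => //; apply: measurable_fun_limn_esup => m.
    exact: measurableT_comp.
  have -> : (\int[mu]_(x in D) ((cabs (f x - S n x)) `^ s)%:E =
      \int[mu]_(x in D) limn_einf (phi ^~ x))%E.
    apply: ae_eq_integral => //.
      by apply/measurable_EFinP; exact: measurable_cabs_powR.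
    move: ae_bounded; apply: filterS => x h1 Dx.
    have Sf := cvgS (h1 Dx).
    have -> // : limn_einf (phi ^~ x) = (cabs (f x - S n x) `^ s)%:E.
    suff h : phi ^~ x @ \oo --> (cabs (f x - S n x) `^ s)%:E.
      by have [->] := cvg_limn_einf_sup h.
    apply: cvg_EFin; first exact: nearW.
    apply: cvg_powR => //; first by move=> m; exact: cabs_ge0.
    apply: ccvg_cabs; apply: ccvgB; last exact: ccvg_cst.
    exact: ccvg_shift Sf.
  apply: (le_trans (fatou _ mD mphi phi0)).
  apply: limn_einf_le => m; apply: le_trans (int_g n m).
  apply: ge0_le_integral => //; first exact: phi0.
    by apply/measurable_EFinP; apply: (measurableT_comp (measurable_powR _)).
  move=> x _; rewrite lee_fin; apply: ge0_ler_powR.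
  - exact: ltW.
  - by rewrite nnegrE cabs_ge0.
  - by rewrite nnegrE g_ge0.
  - by rewrite S_shift cabs_sum.
exists f; split; last by move=> n; have [] := tail n.
have [+ _] := tail 0; congr LS; apply/funext => x.
by rewrite /S big_ord0 subr0.
Qed.

End series.

Lemma nrm_triangle s f g h (a b : R) : 1 <= s -> LS s f -> LS s g -> LS s h ->
  nrm s (fun x => f x - g x) <= a -> nrm s (fun x => g x - h x) <= b ->
  nrm s (fun x => f x - h x) <= a + b.
Proof.
move=> s1 Lf Lg Lh fga ghb.
have [Lfg _] := LSB mD s1 Lf Lg; have [Lgh _] := LSB mD s1 Lg Lh.
have [_ le] := LSD mD s1 Lfg Lgh.
rewrite (eq_nrm mu s (g := fun x => (f x - g x) + (g x - h x))).
  exact: le_trans le (lerD fga ghb).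
by move=> x _; rewrite addrA subrK.
Qed.

(** A subsequence whose increments have norm at most [2 * 2^-k] telescopes to a series summed by
    [riesz_fischer_series]; the Cauchy condition brings in the other indices. *)
Lemma LS_complete s (w : nat -> T -> C) : 1 <= s -> (forall n, LS s (w n)) ->
  (forall e, 0 < e -> exists N, forall m, (N <= m)%N ->
     nrm s (fun x => w m x - w N x) <= e) ->
  exists h, LS s h /\ forall e, 0 < e -> exists N, forall m, (N <= m)%N ->
     nrm s (fun x => h x - w m x) <= e.
Proof.
move=> s1 Lw cw; have s0 : 0 < s by apply: lt_le_trans s1.
have half k : 0 < 2^-1 ^+ k :> R by rewrite exprn_gt0.
pose N k := projT1 (cid (cw _ (half k))).
have NP k m : (N k <= m)%N -> nrm s (fun x => w m x - w (N k) x) <= 2^-1 ^+ k.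
  exact: (projT2 (cid (cw _ (half k)))).
pose u k x := w (N k.+1) x - w (N k) x.
have Lu k : LS s (u k) by have [] := LSB mD s1 (Lw (N k.+1)) (Lw (N k)).
have uK k : nrm s (u k) <= 2 * 2^-1 ^+ k.
  (* The indices [N k] need not increase, so [w (N k)] and [w (N k.+1)] are compared through a
     common later index. *)
  have h1 := NP k (maxn (N k) (N k.+1)) (leq_maxl _ _).
  have h2 := NP k.+1 (maxn (N k) (N k.+1)) (leq_maxr _ _).
  rewrite (nrmBC mu D _ _ s0) in h2.
  have := nrm_triangle s1 (Lw _) (Lw _) (Lw _) h2 h1.
  by rewrite exprS; have := half k; lra.
have [f0 [Lf0 f0P]] := riesz_fischer_series s1 Lu uK.
have [Lh _] := LSD mD s1 Lf0 (Lw (N 0%N)).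
exists (fun x => f0 x + w (N 0%N) x); split; first exact: Lh.
have tele k x : \sum_(i < k) u i x = w (N k) x - w (N 0%N) x.
  elim: k => [|k IH]; first by rewrite big_ord0 subrr.
  by rewrite big_ord_recr /= IH /u addrC addrA subrK.
move=> e e0.
(* 4 is the constant of the series with [K = 2], and 1 comes from the distance of [w m] to
   [w (N k)]. *)
have [k hk] : exists k, 5 * 2^-1 ^+ k <= e.
  have c0 : (2^-1 : R) ^+ k @[k --> \oo] --> 0.
    by apply: cvg_expr; rewrite ger0_norm// invf_lt1// ltr1n.
  have e5 : 0 < e / 5 by rewrite divr_gt0.
  have /cvgr0Pnorm_le/(_ _ e5)[k _ /(_ k (leqnn k))] := c0.
  rewrite ger0_norm; last exact: ltW.
  by move=> hk; exists k; lra.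
exists (N k) => m Nm; apply: le_trans hk.
have h1 : nrm s (fun x => f0 x + w (N 0%N) x - w (N k) x) <= 4 * 2^-1 ^+ k.
  rewrite (eq_nrm mu s (g := fun x => f0 x - \sum_(i < k) u i x)).
    by apply: (le_trans (f0P k)); have := half k; lra.
  by move=> x _; rewrite tele opprB addrA.
have h2 := NP k m Nm; rewrite (nrmBC mu D _ _ s0) in h2.
have := nrm_triangle s1 Lh (Lw _) (Lw _) h1 h2.
by have := half k; lra.
Qed.

(** One good index is all that the density arguments ask for. If there were none, the integrals
    would stay above [e ^ s], against their limit 0. *)
Lemma dominated_nrm s (h : nat -> T -> C) (F : T -> C) (e : R) : 0 < s -> 0 < e ->
  (forall k, cmeas D (h k)) -> LS s F ->
  (forall k x, D x -> cabs (h k x) <= cabs (F x)) ->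
  {ae mu, forall x, D x -> cabs (h k x) @[k --> \oo] --> 0} ->
  exists k, LS s (h k) /\ nrm s (h k) <= e.
Proof.
move=> s0 e0 mh LF hF h0.
have Lh k : LS s (h k) by have [] := LS_le mD s0 (mh k) LF (hF k).
have m1 k : measurable_fun D (fun x => (cabs (h k x) `^ s)%:E).
  by apply/measurable_EFinP; exact: measurable_cabs_powR.
have iF : mu.-integrable D (fun x => (cabs (F x) `^ s)%:E).
  apply/integrableP; split.
    by apply/measurable_EFinP; apply: measurable_cabs_powR; case: LF.
  under eq_integral do rewrite gee0_abs ?lee_fin ?powR_ge0//.
  by case: LF.
have c0 : {ae mu, forall x, D x -> (fun k => (cabs (h k x) `^ s)%:E) @ \oo --> 0%E}.
  move: h0; apply: filterS => x hx Dx.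
  apply: cvg_EFin; first exact: nearW.
  have := cvg_powR s0 (fun k => cabs_ge0 (h k x)) (hx Dx).
  by rewrite powR0 ?gt_eqF.
have dom : {ae mu, forall x k, D x ->
    (`|(cabs (h k x) `^ s)%:E| <= (cabs (F x) `^ s)%:E)%E}.
  apply: aeW => x k Dx; rewrite gee0_abs ?lee_fin ?powR_ge0//.
  by apply: ge0_ler_powR; rewrite ?nnegrE ?cabs_ge0 ?hF// ltW.
have [_ _] := dominated_convergence mD m1 (measurable_cst 0%E) c0 iF dom.
rewrite integral0 => cv.
apply: contrapT => /forallNP H.
have e's : 0 < e `^ s by rewrite powR_gt0.
have : ((e `^ s)%:E <= 0)%E.
  rewrite -(cvg_lim _ cv)//; apply: lime_ge; first by apply/cvg_ex; exists 0%E.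
  apply: nearW => k /=; rewrite leNgt; apply/negP => lt.
  by apply: (H k); apply: (nrm_le s0 (ltW e0) (mh k)); exact: ltW.
by rewrite lee_fin leNgt e's.
Qed.

Lemma cmeas_trunc M f : cmeas D f -> cmeas D (trunc M f).
Proof.
move=> mf; have [f1 f2] := mf.
have mb : measurable_fun D (fun x => cabs (f x) <= M).
  by apply: measurable_fun_ler; [exact: measurable_cabs|exact: measurable_cst].
have mif (p : T -> R) : measurable_fun D p ->
    measurable_fun D (fun x => if cabs (f x) <= M then p x else 0).
  by move=> mp; apply: measurable_fun_if => //; exact: measurable_funS mp.
split.
  by apply: eq_measurable_fun (mif _ f1) => x _; rewrite /trunc; case: ifP.
by apply: eq_measurable_fun (mif _ f2) => x _; rewrite /trunc; case: ifP.
Qed.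

End Riesz_Fischer.

(** * Fourier coefficients on the circle *)

Section Circle.
Variable R : realType.
Local Notation C := R[i].
Local Notation mu := (@lebesgue_measure R).
Local Notation D := (@Tdom R).
Local Notation LS := (LS mu D).
Local Notation nrm := (nrm mu D).
Local Notation cmeas := (@cmeas _ (measurableTypeR R) R D).
Implicit Types (f g : R -> C) (s p q : R) (m n : int).

Lemma TdomE : D = `[0, 2 * pi]%classic.
Proof. by apply/seteqP; split => x /=; rewrite in_itv. Qed.

Lemma measurable_Tdom : @measurable _ (measurableTypeR R) D.
Proof. by rewrite TdomE; exact: measurable_itv. Qed.
Local Notation mD := measurable_Tdom.

Lemma pi2_gt0 : 0 < 2 * pi :> R.
Proof. by rewrite mulr_gt0// pi_gt0. Qed.

Lemma mu_Tdom : mu D = (2 * pi)%:E.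
Proof.
rewrite TdomE lebesgue_measure_itv /= lte_fin pi2_gt0.
by rewrite -EFinB subr0.
Qed.

Lemma integrable_cst_Tdom (c : R) : mu.-integrable D (EFin \o cst c).
Proof.
apply/integrableP; split.
  by apply/measurable_EFinP; exact: measurable_cst.
rewrite (_ : (fun x => _) = cst `|c|%:E)//.
by rewrite (integral_cst mu mD) [X in (_ * X)%E]mu_Tdom -EFinM ltry.
Qed.

Lemma ae_imp (P Q : R -> Prop) : (forall x, P x -> Q x) ->
  {ae mu, forall x, P x} -> {ae mu, forall x, Q x}.
Proof. by move=> PQ [N [mN N0 sN]]; exists N; split => // x nQ; apply: sN => /PQ. Qed.

Lemma ae_and (P Q : R -> Prop) : {ae mu, forall x, P x} ->
  {ae mu, forall x, Q x} -> {ae mu, forall x, P x /\ Q x}.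
Proof.
move=> h1 h2; apply: (@filterI _ _ (ae_filter_ringOfSetsType _) _ _ h1 h2).
Qed.

Definition cint f :=
  mu.-integrable D (EFin \o (fun x => Re (f x))) /\
  mu.-integrable D (EFin \o (fun x => Im (f x))).

Lemma cint_cmeas f : cint f -> cmeas f.
Proof.
by move=> [/integrableP[/measurable_EFinP h1 _] /integrableP[/measurable_EFinP h2 _]].
Qed.

Lemma cintP f : cmeas f ->
  mu.-integrable D (EFin \o (fun x => cabs (f x))) -> cint f.
Proof.
move=> [m1 m2] h; split.
  apply: (le_integrable mD _ _ h); first exact/measurable_EFinP.
  move=> x _; rewrite lee_fin (le_trans (Re_le_cabs _))// ler_norm.
  by [].
apply: (le_integrable mD _ _ h); first exact/measurable_EFinP.
move=> x _; rewrite lee_fin (le_trans (Im_le_cabs _))// ler_norm.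
by [].
Qed.

Lemma cint_cabs f : cint f -> mu.-integrable D (EFin \o (fun x => cabs (f x))).
Proof.
move=> fi; have [h1 h2] := fi.
apply: (le_integrable mD _ _ (integrableD mD (integrable_norm h1) (integrable_norm h2))).
  by apply/measurable_EFinP; apply: measurable_cabs; exact: cint_cmeas.
move=> x _; rewrite [leRHS](_ : _ = `|(`|Re (f x)| + `|Im (f x)|)%:E|%E)//.
rewrite !abse_EFin lee_fin ger0_norm ?cabs_ge0// ger0_norm ?addr_ge0//.
exact: cabs_le_ReIm.
Qed.

Lemma cintD f g : cint f -> cint g -> cint (fun x => f x + g x).
Proof.
move=> [f1 f2] [g1 g2]; split.
  under [X in EFin \o X]eq_fun do rewrite cReD.
  exact: (integrableD mD f1 g1).
under [X in EFin \o X]eq_fun do rewrite cImD.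
exact: (integrableD mD f2 g2).
Qed.

Lemma cintZ (c : C) f : cint f -> cint (fun x => c * f x).
Proof.
move=> fi; apply: cintP; first by apply: cmeasZ; exact: cint_cmeas.
under [X in EFin \o X]eq_fun do rewrite cabsM.
exact: (integrableZl mD (cabs c) (cint_cabs fi)).
Qed.

Lemma cintN f : cint f -> cint (fun x => - f x).
Proof.
by move=> /(cintZ (-1)); under eq_fun do rewrite mulN1r.
Qed.

Lemma cint0 : cint (fun=> 0).
Proof. by split; exact: integrable_cst_Tdom. Qed.

Lemma cint_sum (I : Type) (r : seq I) (P : pred I) (F : I -> R -> C) :
  (forall i, cint (F i)) -> cint (fun x => \sum_(i <- r | P i) F i x).
Proof.
move=> iF; elim: r => [|i r IH].
  by under eq_fun do rewrite big_nil; exact: cint0.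
under eq_fun do rewrite big_cons.
by case: (P i) => //; exact: cintD.
Qed.

Definition av f : C :=
  Complex ((2 * pi)^-1 * Rintegral mu D (fun x => Re (f x)))
          ((2 * pi)^-1 * Rintegral mu D (fun x => Im (f x))).

Lemma fcE f n : fc f n = av (fun x => f x * cexpi (- (n%:~R * x))).
Proof. by []. Qed.

Lemma eq_av f g : (forall x, D x -> f x = g x) -> av f = av g.
Proof.
move=> fg; rewrite /av; congr Complex; congr (_ * _).
  by apply: eq_Rintegral => x /set_mem Dx; rewrite fg.
by apply: eq_Rintegral => x /set_mem Dx; rewrite fg.
Qed.

Lemma av_ae f g : cmeas f -> cmeas g ->
  {ae mu, forall x, D x -> f x = g x} -> av f = av g.
Proof.
move=> [f1 f2] [g1 g2] fg; rewrite /av; congr Complex; congr (_ * fine _).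
  apply: ae_eq_integral => //; first exact: mD.
  - exact/measurable_EFinP.
  - exact/measurable_EFinP.
  - by apply: ae_imp fg => x /[apply] ->.
apply: ae_eq_integral => //; first exact: mD.
- exact/measurable_EFinP.
- exact/measurable_EFinP.
- by apply: ae_imp fg => x /[apply] ->.
Qed.

Lemma avD f g : cint f -> cint g -> av (fun x => f x + g x) = av f + av g.
Proof.
move=> [f1 f2] [g1 g2]; apply: complex_ext => /=.
  under [X in _ * X]eq_Rintegral do rewrite cReD.
  by rewrite (RintegralD mD f1 g1) mulrDr.
under [X in _ * X]eq_Rintegral do rewrite cImD.
by rewrite (RintegralD mD f2 g2) mulrDr.
Qed.

Lemma avZ (c : C) f : cint f -> av (fun x => c * f x) = c * av f.
Proof.
move=> [f1 f2].
have Z r (h : R -> R) : mu.-integrable D (EFin \o h) ->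
  mu.-integrable D (EFin \o (fun x => r * h x)) by exact: (integrableZl mD).
apply: complex_ext; rewrite ?cReM ?cImM /=.
  under [X in _ * X]eq_Rintegral do rewrite cReM.
  rewrite (RintegralB mD (Z _ _ f1) (Z _ _ f2)) (RintegralZl _ mD f1).
  by rewrite (RintegralZl _ mD f2); ring.
under [X in _ * X]eq_Rintegral do rewrite cImM.
rewrite (RintegralD mD (Z _ _ f2) (Z _ _ f1)) (RintegralZl _ mD f1).
by rewrite (RintegralZl _ mD f2); ring.
Qed.

Lemma avN f : cint f -> av (fun x => - f x) = - av f.
Proof.
by move=> fi; rewrite -mulN1r -avZ//; apply: eq_av => x _; rewrite mulN1r.
Qed.

Lemma avB f g : cint f -> cint g -> av (fun x => f x - g x) = av f - av g.
Proof. by move=> fi gi; rewrite (avD fi (cintN gi)) avN. Qed.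

Lemma av_sum (I : Type) (r : seq I) (P : pred I) (F : I -> R -> C) :
  (forall i, cint (F i)) ->
  av (fun x => \sum_(i <- r | P i) F i x) = \sum_(i <- r | P i) av (F i).
Proof.
move=> iF; elim: r => [|i r IH].
  rewrite big_nil; under [X in av X]eq_fun do rewrite big_nil.
  by apply: complex_ext; rewrite /= (Rintegral_cst mu mD) mul0r mulr0.
rewrite big_cons; under [X in av X]eq_fun do rewrite big_cons.
by case: (P i) => //; rewrite avD ?IH//; exact: cint_sum.
Qed.

Lemma av_conj f : cint f -> av (fun x => conjc (f x)) = conjc (av f).
Proof.
move=> [f1 f2]; rewrite /av; apply: complex_ext => /=.
  by congr (_ * _); apply: eq_Rintegral => x _; case: (f x).
rewrite -mulrN; congr (_ * _).
rewrite -mulN1r -(RintegralZl _ mD f2).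
by apply: eq_Rintegral => x _; rewrite mulN1r; case: (f x).
Qed.

(** Real and imaginary parts are bounded separately, which costs a factor 2 against the sharp
    constant [(2 * pi)^-1]. The loss is inherited by [hoelder_av] and [bessel]. *)
Lemma av_cabs f : cint f ->
  cabs (av f) <= pi^-1 * \int[mu]_(x in D) cabs (f x).
Proof.
move=> fi; have [f1 f2] := fi; have ci := cint_cabs fi.
apply: (le_trans (cabs_le_ReIm _)); rewrite /= !normrM.
have h1 : `|\int[mu]_(x in D) Re (f x)| <= \int[mu]_(x in D) cabs (f x).
  apply: (le_trans (le_normr_Rintegral mD f1)).
  apply: le_Rintegral => //; [exact: mD|exact: integrable_norm|].
  by move=> x _; exact: Re_le_cabs.
have h2 : `|\int[mu]_(x in D) Im (f x)| <= \int[mu]_(x in D) cabs (f x).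
  apply: (le_trans (le_normr_Rintegral mD f2)).
  apply: le_Rintegral => //; [exact: mD|exact: integrable_norm|].
  by move=> x _; exact: Im_le_cabs.
have p0 : 0 <= (2 * pi)^-1 :> R by rewrite invr_ge0 ltW// pi2_gt0.
rewrite (ger0_norm p0).
rewrite -mulrDr [X in _ <= X](_ : _ = (2 * pi)^-1 * (2 * \int[mu]_(x in D) cabs (f x))).
  by apply: ler_wpM2l; [exact: p0|rewrite mulr_natl mulr2n lerD].
have -> : (2 * pi)^-1 = pi^-1 / 2 :> R by rewrite invfM mulrC.
by rewrite -mulrA mulKf// pnatr_eq0.
Qed.


Lemma LS_bounded s f (M : R) : 0 < s -> cmeas f ->
  (forall x, D x -> cabs (f x) <= M) -> LS s f.
Proof.
move=> s0 mf fM; have Lc : LS s (fun=> (`|M|%:C)%C).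
  split; first exact: cmeas_cst.
  by rewrite (integral_cst mu mD) [X in (_ * X)%E]mu_Tdom -EFinM ltry.
have [|Lf _] := LS_le mD s0 mf Lc; last exact: Lf.
by move=> x Dx; rewrite cabs_real normr_id (le_trans (fM _ Dx))// ler_norm.
Qed.

Lemma LS_cst s (c : C) : 0 < s -> LS s (fun=> c).
Proof. by move=> s0; apply: (@LS_bounded _ _ (cabs c)) => //; exact: cmeas_cst. Qed.

Lemma hoelder_int p q f g : 0 < p -> 0 < q -> p^-1 + q^-1 = 1 ->
  LS p f -> LS q g -> cint (fun x => f x * g x) /\
  \int[mu]_(x in D) cabs (f x * g x) <= nrm p f * nrm q g.
Proof.
move=> p0 q0 pq Lf Lg.
have h := hoelder_cabs mD p0 q0 pq Lf Lg.
have mfg : cmeas (fun x => f x * g x) by apply: cmeasM; [case: Lf|case: Lg].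
have fi : (\int[mu]_(x in D) (cabs (f x * g x))%:E)%E \is a fin_num.
  rewrite ge0_fin_numE; first by apply: le_lt_trans h _; rewrite ltry.
  by apply: integral_ge0 => x _; rewrite lee_fin cabs_ge0.
split; last by rewrite -lee_fin /Rintegral fineK.
apply: cintP => //; apply/integrableP; split.
  by apply/measurable_EFinP; exact: measurable_cabs.
under eq_integral do rewrite /= ger0_norm ?cabs_ge0//.
by apply: le_lt_trans h _; rewrite ltry.
Qed.

Lemma hoelder_av p q f g : 0 < p -> 0 < q -> p^-1 + q^-1 = 1 ->
  LS p f -> LS q g ->
  cabs (av (fun x => f x * g x)) <= pi^-1 * (nrm p f * nrm q g).
Proof.
move=> p0 q0 pq Lf Lg; have [h1 h2] := hoelder_int p0 q0 pq Lf Lg.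
apply: (le_trans (av_cabs h1)); apply: ler_wpM2l h2.
by rewrite invr_ge0 pi_ge0.
Qed.

Definition conjex s : R := (1 - s^-1)^-1.

Lemma conjexP s : 1 < s -> [/\ 0 < s, 1 < conjex s & s^-1 + (conjex s)^-1 = 1].
Proof.
move=> s1; have s0 : 0 < s by apply: lt_trans s1.
have h : s^-1 < 1 by rewrite invf_lt1.
split=> //; last by rewrite /conjex invrK; ring.
rewrite /conjex -[X in X < _]invr1 ltf_pV2 ?posrE ?subr_gt0//.
by rewrite ltrBlDr ltrDl invr_gt0.
Qed.

Definition Kav s : R := pi^-1 * nrm (conjex s) (fun=> 1).

Lemma Kav_ge0 s : 0 <= Kav s.
Proof. by rewrite mulr_ge0 ?nrm_ge0// invr_ge0 pi_ge0. Qed.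

Lemma LS_cint s f : 1 < s -> LS s f -> cint f.
Proof.
move=> s1 Lf; have [s0 c1 sc] := conjexP s1; have c0 := lt_trans ltr01 c1.
have [+ _] := hoelder_int s0 c0 sc Lf (LS_cst 1 c0).
by under eq_fun do rewrite mulr1.
Qed.

Lemma av_nrm s f : 1 < s -> LS s f -> cabs (av f) <= Kav s * nrm s f.
Proof.
move=> s1 Lf; have [s0 c1 sc] := conjexP s1; have c0 := lt_trans ltr01 c1.
have := hoelder_av s0 c0 sc Lf (LS_cst 1 c0).
have -> : Kav s * nrm s f = pi^-1 * (nrm s f * nrm (conjex s) (fun=> 1)).
  by rewrite /Kav -mulrA; congr (_ * _); rewrite mulrC.
by under [X in av X]eq_fun do rewrite mulr1.
Qed.

Lemma cexpiD (x y : R) : cexpi (x + y) = cexpi x * cexpi y.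
Proof.
by rewrite /cexpi cosD sinD; apply: complex_ext; rewrite ?cReM ?cImM /=; ring.
Qed.

Lemma cexpi0 : cexpi 0 = 1 :> C.
Proof. by rewrite /cexpi cos0 sin0. Qed.

Lemma conj_cexpi (x : R) : conjc (cexpi x) = cexpi (- x).
Proof. by rewrite /cexpi cosN sinN. Qed.

Lemma cabs_cexpi (x : R) : cabs (cexpi x) = 1.
Proof. by rewrite cabsE /= cos2Dsin2 sqrtr1. Qed.

Definition ex n (x : R) : C := cexpi (n%:~R * x).

Lemma exD m n x : ex (m + n) x = ex m x * ex n x.
Proof. by rewrite /ex intrD mulrDl cexpiD. Qed.

Lemma ex0 x : ex 0 x = 1.
Proof. by rewrite /ex mul0r cexpi0. Qed.

Lemma conj_ex n x : conjc (ex n x) = ex (- n) x.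
Proof. by rewrite /ex conj_cexpi mulrNz mulNr. Qed.

Lemma cabs_ex n x : cabs (ex n x) = 1.
Proof. exact: cabs_cexpi. Qed.

Lemma fc_ex f n : fc f n = av (fun x => f x * ex (- n) x).
Proof. by rewrite fcE; apply: eq_av => x _; rewrite /ex mulrNz mulNr. Qed.

Lemma cmeas_cexpi (h : R -> R) :
  continuous h -> cmeas (fun x => cexpi (h x)).
Proof.
move=> ch; split=> /=; apply: measurable_funTS; apply: continuous_measurable_fun.
  by move=> x; apply: continuous_comp; [exact: ch|exact: continuous_cos].
by move=> x; apply: continuous_comp; [exact: ch|exact: continuous_sin].
Qed.

Lemma cmeas_ex n : cmeas (ex n).
Proof.
apply: cmeas_cexpi => x; apply: cvgMl_tmp; exact: cvg_id.
Qed.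

Lemma LS_ex s n : 0 < s -> LS s (ex n).
Proof.
move=> s0; apply: (@LS_bounded _ _ 1) => //; first exact: cmeas_ex.
by move=> x _; rewrite cabs_ex.
Qed.

Lemma LS_mul_ex s f n : 0 < s -> LS s f ->
  LS s (fun x => f x * ex n x) /\ nrm s (fun x => f x * ex n x) = nrm s f.
Proof.
move=> s0 Lf.
have E x : cabs (f x * ex n x) = cabs (f x) by rewrite cabsM cabs_ex mulr1.
have mfe : cmeas (fun x => f x * ex n x).
  by apply: cmeasM; [case: Lf|exact: cmeas_ex].
exact: LS_eq_cabs s0 mfe Lf (fun x _ => E x).
Qed.

Lemma cint_mul_ex f n : cint f -> cint (fun x => f x * ex n x).
Proof.
move=> fi; apply: cintP.
  by apply: cmeasM; [exact: cint_cmeas|exact: cmeas_ex].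
under [X in EFin \o X]eq_fun do rewrite cabsM cabs_ex mulr1.
exact: cint_cabs.
Qed.

Lemma fcD f g n : cint f -> cint g -> fc (fun x => f x + g x) n = fc f n + fc g n.
Proof.
move=> fi gi; rewrite !fc_ex -avD; try exact: cint_mul_ex.
by apply: eq_av => x _; rewrite mulrDl.
Qed.

Lemma fcZ (c : C) f n : cint f -> fc (fun x => c * f x) n = c * fc f n.
Proof.
move=> fi; rewrite !fc_ex -avZ; last exact: cint_mul_ex.
by apply: eq_av => x _; rewrite mulrA.
Qed.

Lemma fcB f g n : cint f -> cint g -> fc (fun x => f x - g x) n = fc f n - fc g n.
Proof.
move=> fi gi; rewrite !fc_ex -avB; try exact: cint_mul_ex.
by apply: eq_av => x _; rewrite mulrBl.
Qed.

Lemma fc_sum (I : Type) (r : seq I) (P : pred I) (F : I -> R -> C) n :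
  (forall i, cint (F i)) ->
  fc (fun x => \sum_(i <- r | P i) F i x) n = \sum_(i <- r | P i) fc (F i) n.
Proof.
move=> iF; under [RHS]eq_bigr do rewrite fc_ex.
rewrite -av_sum; last by move=> i; exact: cint_mul_ex.
by rewrite fc_ex; apply: eq_av => x _; rewrite mulr_suml.
Qed.

Lemma eq_fc f g n : (forall x, D x -> f x = g x) -> fc f n = fc g n.
Proof. by move=> fg; rewrite !fc_ex; apply: eq_av => x Dx; rewrite fg. Qed.

Lemma fc_ae f g n : cmeas f -> cmeas g ->
  {ae mu, forall x, D x -> f x = g x} -> fc f n = fc g n.
Proof.
move=> mf mg fg; rewrite !fc_ex; apply: av_ae.
- by apply: cmeasM => //; exact: cmeas_ex.
- by apply: cmeasM => //; exact: cmeas_ex.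
- by apply: ae_imp fg => x /[apply] ->.
Qed.

Lemma fc_nrm s f n : 1 < s -> LS s f -> cabs (fc f n) <= Kav s * nrm s f.
Proof.
move=> s1 Lf; have s0 := lt_trans ltr01 s1.
have [h1 h2] := LS_mul_ex (- n) s0 Lf.
by rewrite fc_ex; have := av_nrm s1 h1; rewrite h2.
Qed.

Lemma cos_int_2pi n : cos (n%:~R * (2 * pi)) = 1 :> R /\ sin (n%:~R * (2 * pi)) = 0 :> R.
Proof.
have nat_case (k : nat) : cos (k%:R * (2 * pi)) = 1 :> R /\ sin (k%:R * (2 * pi)) = 0 :> R.
  elim: k => [|k [IH1 IH2]]; first by rewrite mul0r cos0 sin0.
  rewrite -natr1 mulrDl mul1r cosD sinD IH1 IH2.
  have -> : 2 * pi = pi *+ 2 :> R by rewrite mulr_natl.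
  by rewrite cos2pi sin2pi; split; ring.
case: n => k; first by have := nat_case k.
by rewrite NegzE mulrNz mulNr cosN sinN; have [-> ->] := nat_case k.+1; rewrite oppr0.
Qed.

Lemma ex_2pi n x : ex n (2 * pi - x) = ex (- n) x.
Proof.
rewrite /ex mulrBr cexpiD -mulNr -mulrNz.
have [h1 h2] := cos_int_2pi n.
by rewrite {1}/cexpi h1 h2 mul1r.
Qed.

Lemma Tdom_FTC (f F : R -> R) : continuous f ->
  (forall x : R, is_derive x (1 : R) F (f x)) ->
  \int[mu]_(x in D) f x = F (2 * pi) - F 0.
Proof.
move=> cf dF; have dF' x : derivable F x 1 by exact: ex_derive.
have cF : continuous F.
  by move=> x; apply: differentiable_continuous; apply/derivable1_diffP.
rewrite TdomE /Rintegral (continuous_FTC2 (F := F)) //.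
- exact: pi2_gt0.
- exact: continuous_subspaceT.
- by split => //; [apply: cvg_at_right_filter; exact: cF|apply: cvg_at_left_filter; exact: cF].
- by move=> x _; rewrite derive1E derive_val.
Qed.

Lemma av_ex n : av (ex n) = (n == 0)%:R.
Proof.
have [->|n0] := eqVneq n 0.
  apply: complex_ext => /=.
    under eq_Rintegral do rewrite mul0r cos0.
    rewrite (Rintegral_cst mu mD) [X in fine X]mu_Tdom/= mul1r mulVf//.
    by rewrite gt_eqF// pi2_gt0.
  under eq_Rintegral do rewrite mul0r sin0.
  by rewrite (Rintegral_cst mu mD) mul0r mulr0.
have [c1 s0] := cos_int_2pi n.
have nR : n%:~R != 0 :> R by rewrite intr_eq0.
have cn : continuous (fun x : R => n%:~R * x).
  by move=> x; apply: cvgMl_tmp; exact: cvg_id.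
have dS x : is_derive x (1 : R) (fun x => n%:~R^-1 * sin (n%:~R * x)) (cos (n%:~R * x)).
  by apply: is_derive_eq; rewrite /GRing.scale/=; field.
have dC x : is_derive x (1 : R) (fun x => - n%:~R^-1 * cos (n%:~R * x)) (sin (n%:~R * x)).
  by apply: is_derive_eq; rewrite /GRing.scale/=; field.
have cC : continuous (fun x : R => cos (n%:~R * x)).
  by move=> x; apply: continuous_comp; [exact: cn|exact: continuous_cos].
have cS : continuous (fun x : R => sin (n%:~R * x)).
  by move=> x; apply: continuous_comp; [exact: cn|exact: continuous_sin].
apply: complex_ext => /=.
  by rewrite (Tdom_FTC cC dS) s0 !mulr0 sin0 !mulr0 subr0 mulr0.
by rewrite (Tdom_FTC cS dC) c1 mulr0 cos0 subrr mulr0.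
Qed.

Lemma fc_of_ex m n : fc (ex m) n = (m == n)%:R.
Proof.
rewrite fc_ex -subr_eq0 -av_ex; apply: eq_av => x _.
by rewrite -exD.
Qed.

Lemma Linf_mul (a : R -> C) : Linf a -> exists2 M : R, 0 <= M &
  forall s f, 0 < s -> LS s f ->
    LS s (fun x => a x * f x) /\ nrm s (fun x => a x * f x) <= M * nrm s f.
Proof.
move=> [ma [M aM]]; exists `|M|; first exact: normr_ge0.
move=> s f s0 Lf.
apply: (nrm_le s0).
- by rewrite mulr_ge0// nrm_ge0.
- by apply: cmeasM => //; case: Lf.
have mM : cmeas (fun x => (`|M|%:C)%C * f x) by apply: cmeasZ; case: Lf.
have [h1 h2] := LSZ mD ((`|M|%:C)%C) s0 Lf.
rewrite cabs_real normr_id in h2; rewrite -h2 -(nrm_powR s0 h1).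
apply: ae_ge0_le_integral; first exact: mD.
- by move=> x _; rewrite lee_fin powR_ge0.
- by apply/measurable_EFinP; apply: measurable_cabs_powR; apply: cmeasM => //; case: Lf.
- by move=> x _; rewrite lee_fin powR_ge0.
- by apply/measurable_EFinP; apply: measurable_cabs_powR.
apply: ae_imp aM => x h Dx; rewrite lee_fin; apply: ge0_ler_powR.
- exact: ltW.
- by rewrite nnegrE cabs_ge0.
- by rewrite nnegrE cabs_ge0.
rewrite !cabsM cabs_real normr_id ler_wpM2r ?cabs_ge0//.
by rewrite (le_trans (h Dx))// ler_norm.
Qed.

End Circle.

(** * Trigonometric polynomials and approximation by a convolution kernel *)

Section Trigonometric_density.
Variable R : realType.
Local Notation C := R[i].
Local Notation mu := (@lebesgue_measure R).
Local Notation D := (@Tdom R).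
Local Notation LS := (LS mu D).
Local Notation nrm := (nrm mu D).
Local Notation cmeas := (@cmeas _ (measurableTypeR R) R D).
Local Notation mD := (@measurable_Tdom R).
Implicit Types (f g : R -> C) (s p q : R) (m n : int).

Definition trigpoly f :=
  exists l : seq (C * int), forall x, f x = \sum_(u <- l) u.1 * ex u.2 x.

Lemma trigpoly_ex n : trigpoly (ex n).
Proof. by exists [:: (1, n)] => x; rewrite big_seq1 mul1r. Qed.

Lemma trigpoly_cst (c : C) : trigpoly (fun=> c).
Proof. by exists [:: (c, 0)] => x; rewrite big_seq1 ex0 mulr1. Qed.

Lemma trigpolyD f g : trigpoly f -> trigpoly g -> trigpoly (fun x => f x + g x).
Proof. by move=> [l fl] [r gr]; exists (l ++ r) => x; rewrite fl gr big_cat. Qed.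

Lemma trigpolyM f g : trigpoly f -> trigpoly g -> trigpoly (fun x => f x * g x).
Proof.
move=> [l fl] [r gr].
exists [seq (u.1 * v.1, u.2 + v.2) | u <- l, v <- r] => x.
rewrite fl gr big_distrlr big_allpairs_dep /=.
by apply: eq_bigr => u _; apply: eq_bigr => v _; rewrite exD; ring.
Qed.

Lemma trigpolyX f k : trigpoly f -> trigpoly (fun x => f x ^+ k).
Proof.
move=> tf; elim: k => [|k IH].
  by under eq_fun do rewrite expr0; exact: trigpoly_cst.
by under eq_fun do rewrite exprS; exact: trigpolyM.
Qed.

Lemma trigpolyZ (c : C) f : trigpoly f -> trigpoly (fun x => c * f x).
Proof. by move=> tf; apply: trigpolyM => //; exact: trigpoly_cst. Qed.

Lemma trigpoly_ind (P : (R -> C) -> Prop) : P (fun=> 0) ->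
  (forall (c : C) n f, trigpoly f -> P f -> P (fun x => c * ex n x + f x)) ->
  forall f, trigpoly f -> P f.
Proof.
move=> P0 PS f [l fl]; have -> : f = (fun x => \sum_(u <- l) u.1 * ex u.2 x).
  exact/funext.
elim: l {f fl} => [|[c n] l IH].
  by under eq_fun do rewrite big_nil.
by under eq_fun do rewrite big_cons; apply: PS => //; exists l.
Qed.

Lemma trigpoly_LS s f : 1 <= s -> trigpoly f -> LS s f.
Proof.
move=> s1; have s0 : 0 < s by apply: lt_le_trans s1.
elim/trigpoly_ind => [|c n g _ Lg]; first by case: (LS0 mu D s0).
apply: (LSD mD s1 _ Lg).1.
exact: (LSZ mD c s0 (LS_ex n s0)).1.
Qed.

Lemma trigpoly_cint f : trigpoly f -> cint f.
Proof.
by move=> tf; apply: (@LS_cint _ 2); [rewrite ltr1n|apply: trigpoly_LS => //; rewrite ler1n].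
Qed.

Lemma trigpoly_translate f x : trigpoly f -> trigpoly (fun t => f (x - t)).
Proof.
elim/trigpoly_ind => [|c n g _ tg]; first exact: trigpoly_cst.
apply: trigpolyD => //.
have -> : (fun t => c * ex n (x - t)) = (fun t => (c * ex n x) * ex (- n) t).
  by apply/funext => t; rewrite /ex mulrBr cexpiD -mulNr -mulrNz mulrA.
by apply: trigpolyZ; exact: trigpoly_ex.
Qed.

(** Checked on exponentials: both sides see only the coefficient of frequency 0. The kernel below is
    a trigonometric polynomial, so its translates are covered. *)
Lemma av_translate f x : trigpoly f -> av (fun t => f (x - t)) = av f.
Proof.
elim/trigpoly_ind => [//|c n g tg IH].
have tgx := trigpoly_cint (trigpoly_translate x tg).
have E t : c * ex n (x - t) = (c * ex n x) * ex (- n) t.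
  by rewrite /ex mulrBr cexpiD -mulNr -mulrNz mulrA.
under [X in av X]eq_fun do rewrite E.
have ce (k : int) : cint (@ex R k) by apply: trigpoly_cint; exact: trigpoly_ex.
rewrite !avD ?IH ?avZ//; try exact: cintZ; try exact: trigpoly_cint.
rewrite !av_ex oppr_eq0; have [->|_] := eqVneq n 0; last by rewrite !mulr0.
by rewrite ex0 !mulr1.
Qed.

Lemma cint_trigpoly_mul f g : trigpoly f -> cint g -> cint (fun x => f x * g x).
Proof.
move=> tf ig; elim/trigpoly_ind : tf => [|c n h _ IH].
  by under eq_fun do rewrite mul0r; exact: cint0.
have -> : (fun x => (c * ex n x + h x) * g x) =
    (fun x => c * (g x * ex n x) + h x * g x) by apply/funext => x; ring.
by apply: cintD => //; apply: cintZ; exact: cint_mul_ex.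
Qed.

(** The addition formula separates [x] from [t] in each exponential, so only frequencies of [f]
    occur. *)
Lemma av_convolution f g : trigpoly f -> cint g ->
  trigpoly (fun x => av (fun t => f (x - t) * g t)).
Proof.
move=> tf ig.
have ige k : cint (fun t => ex k t * g t).
  by under eq_fun do rewrite mulrC; exact: cint_mul_ex.
elim/trigpoly_ind : tf => [|c n h th IH].
  under eq_fun => x do under [X in av X]eq_fun do rewrite mul0r.
  exact: trigpoly_cst.
have -> : (fun x => av (fun t => (c * ex n (x - t) + h (x - t)) * g t)) =
    (fun x => c * av (fun t => ex (- n) t * g t) * ex n x +
      av (fun t => h (x - t) * g t)).
  apply/funext => x.
  have E t : (c * ex n (x - t) + h (x - t)) * g t =
      (c * ex n x) * (ex (- n) t * g t) + h (x - t) * g t.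
    by rewrite /ex mulrBr cexpiD -[in LHS]mulNr -[in LHS]mulrNz; ring.
  under [X in av X]eq_fun do rewrite E.
  rewrite avD ?avZ//; first by ring.
    exact: cintZ.
  exact: cint_trigpoly_mul (trigpoly_translate x th) ig.
by apply: trigpolyD => //; apply: trigpolyZ; exact: trigpoly_ex.
Qed.

(** The de la Vallee Poussin kernel [cos (y / 2) ^ (2 k)], not normalised: nonnegative, a
    trigonometric polynomial, and geometrically small in [k] away from the multiples of [2 pi]. *)
Definition kern (k : nat) (y : R) : R := ((1 + cos y) / 2) ^+ k.

Lemma kern_ge0 k y : 0 <= kern k y.
Proof. by rewrite exprn_ge0// divr_ge0//; have := cos_geN1 y; lra. Qed.

Lemma trigpoly_kern k : trigpoly (fun y => (kern k y)%:C%C).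
Proof.
have -> : (fun y => (kern k y)%:C%C) =
    (fun y => ((2^-1)%:C%C + (4^-1)%:C%C * ex 1 y + (4^-1)%:C%C * ex (- 1) y) ^+ k).
  apply/funext => y; rewrite /kern rmorphXn; congr (_ ^+ _).
  rewrite /ex mulrNz mulNr mul1r /cexpi cosN sinN.
  by apply: complex_ext; rewrite ?(cReD, cImD, cReM, cImM) /=; field.
apply: trigpolyX; apply: trigpolyD; last first.
  by apply: trigpolyZ; exact: trigpoly_ex.
apply: trigpolyD; first exact: trigpoly_cst.
by apply: trigpolyZ; exact: trigpoly_ex.
Qed.

Lemma av_real (h : R -> R) :
  av (fun x => (h x)%:C%C) = (((2 * pi)^-1 * \int[mu]_(x in D) h x)%:C)%C.
Proof.
apply: complex_ext => //=.
by rewrite (Rintegral_cst mu mD) mul0r mulr0.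
Qed.

Lemma cos_le_far (dl y : R) : 0 <= dl -> dl <= y -> y <= 2 * pi - dl ->
  cos y <= cos dl.
Proof.
move=> d0 dy yd.
have mono (z : R) : dl <= z -> z <= pi -> cos z <= cos dl.
  move=> dz zp; rewrite leNgt (@ltr_cos R) ?in_itv/= -?leNgt//.
    by rewrite zp (le_trans d0).
  by rewrite d0 (le_trans dz).
have [yp|yp] := leP y pi; first exact: mono.
have -> : cos y = cos (2 * pi - y).
  have -> : 2 * pi = pi *+ 2 :> R by rewrite mulr_natl.
  by rewrite addrC cosD2pi cosN.
by apply: mono; lra.
Qed.


Section approximate_identity.
Variables (g : R -> R) (M : R).
Hypotheses (cg : continuous g) (gM : forall x, `|g x| <= M).

Let c k := \int[mu]_(t in D) kern k t.
Let sig k x := (c k)^-1 * \int[mu]_(t in D) (kern k (x - t) * g t).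

Let ik k x : mu.-integrable D (EFin \o (fun t => kern k (x - t))).
Proof. by have [] := trigpoly_cint (trigpoly_translate x (trigpoly_kern k)). Qed.

Let mg : @measurable_fun _ _ (measurableTypeR R) _ D g.
Proof. by apply: measurable_funTS; exact: continuous_measurable_fun. Qed.

Let cg_ : cint (fun x => (g x)%:C%C).
Proof.
apply: (@LS_cint _ 2); first by rewrite ltr1n.
apply: (@LS_bounded _ _ _ M); [by rewrite ltr0n|exact: (@cmeas_real _ (measurableTypeR R) R  D g mg)|].
by move=> x _; rewrite cabs_real.
Qed.

Let ikg k x : mu.-integrable D (EFin \o (fun t => kern k (x - t) * g t)).
Proof.
have [+ _] := cint_trigpoly_mul (trigpoly_translate x (trigpoly_kern k)) cg_.
by under [X in EFin \o X]eq_fun do rewrite cReM /= mul0r subr0.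
Qed.

Let c_translate k x : \int[mu]_(t in D) kern k (x - t) = c k.
Proof.
have := av_translate x (trigpoly_kern k); rewrite !av_real => -[].
by apply: mulfI; rewrite invr_eq0 gt_eqF// pi2_gt0.
Qed.

(** The kernel decreases on [[0, dl]], so its mass there is at least [dl] times its value at
    [dl]. *)
Let c_ge k (dl : R) : 0 < dl -> dl <= pi -> dl * ((1 + cos dl) / 2) ^+ k <= c k.
Proof.
move=> d0 dp; set r := (1 + cos dl) / 2.
have sub : `[0, dl]%classic `<=` D.
  by move=> x; rewrite TdomE /= !in_itv/= => /andP[-> xd] /=; have := pi_gt0 R; lra.
have mI : @measurable _ (measurableTypeR R) `[0, dl]%classic by exact: measurable_itv.
have ik0 : mu.-integrable D (EFin \o kern k).
  by have [] := trigpoly_cint (trigpoly_kern k).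
have -> : dl * r ^+ k = \int[mu]_(t in `[0, dl]%classic) (r ^+ k).
  have mI2 : mu `[0, dl]%classic = dl%:E.
    by rewrite lebesgue_measure_itv /= lte_fin d0 -EFinB subr0.
  by rewrite (Rintegral_cst mu mI) [X in fine X]mI2 /= mulrC.
rewrite /c /Rintegral fine_le//.
- exact: (integrable_fin_num mI (integrableS mD mI sub (integrable_cst_Tdom _))).
- exact: (integrable_fin_num mD ik0).
apply: (@le_trans _ _ (\int[mu]_(t in `[0%R, dl]%classic) (kern k t)%:E)%E).
  apply: ge0_le_integral => //.
  - by move=> x _; rewrite lee_fin exprn_ge0// divr_ge0.
  - by have /integrableP[] := integrableS mD mI sub ik0.
  - move=> x /=; rewrite in_itv/= => /andP[x0 xd]; rewrite lee_fin.
    have hc : cos dl <= cos x.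
      rewrite leNgt (@ltr_cos R) ?in_itv/= -?leNgt//.
        by rewrite (ltW d0).
      by rewrite x0 (le_trans xd).
    by rewrite /kern /r lerXn2r ?nnegrE ?divr_ge0//; lra.
apply: ge0_subset_integral => //.
- exact: mD.
- by have /integrableP[] := ik0.
- by move=> x _; rewrite lee_fin kern_ge0.
Qed.

Let c_gt0 k : 0 < c k.
Proof.
have p0 : 0 < pi / 2 :> R by rewrite divr_gt0 ?pi_gt0.
have := c_ge k p0; rewrite cos_pihalf addr0 => h.
apply: lt_le_trans (h _); last by have := pi_gt0 R; lra.
by rewrite mulr_gt0// exprn_gt0.
Qed.

Let sig_trigpoly k : trigpoly (fun x => (sig k x)%:C%C).
Proof.
have := trigpolyZ ((2 * pi / c k)%:C)%C (av_convolution (trigpoly_kern k) cg_).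
congr trigpoly; apply/funext => x.
have E t : (kern k (x - t))%:C%C * (g t)%:C%C = (kern k (x - t) * g t)%:C%C.
  by rewrite rmorphM.
under [X in av X]eq_fun do rewrite E.
rewrite av_real -rmorphM; congr (_%:C)%C.
rewrite /sig mulrA; congr (_ * _); rewrite mulrAC mulfV ?mul1r//.
by rewrite gt_eqF// pi2_gt0.
Qed.

Let sig_bound k x : `|sig k x| <= M.
Proof.
have M0 : 0 <= M by exact: le_trans (gM 0).
rewrite /sig normrM normfV (gtr0_norm (c_gt0 k)) mulrC ler_pdivrMr//.
apply: (le_trans (le_normr_Rintegral mD (ikg k x))).
rewrite -(c_translate k x) -(RintegralZl _ mD (ik k x)).
apply: le_Rintegral; [exact: mD|exact: (integrable_norm (ikg k x))|exact: (integrableZl mD M (ik k x))|].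
move=> t _; rewrite normrM (ger0_norm (kern_ge0 _ _)) mulrC.
by rewrite ler_wpM2r ?kern_ge0.
Qed.

(** [g] is not periodic, and at 0 and [2 pi] the kernel would mix its values at both ends; hence the
    open interval. *)
Let sig_cvg x : 0 < x < 2 * pi -> sig k x @[k --> \oo] --> g x.
Proof.
move=> /andP[x0 x2].
have M0 : 0 <= M by exact: le_trans (gM 0).
apply/cvgrPdist_le => e e0.
have e2 : 0 < e / 2 by rewrite divr_gt0.
have /cvgrPdist_le/(_ _ e2)/nbhs_ballP[d1 /= d10 hd1] := @cg x.
(* With [dl] at most the distance from [x] to both ends, a point [t] of the domain with
   [|x - t| >= dl] has [x - t] at distance at least [dl] from every multiple of [2 pi]. *)
pose dl := Num.min (d1 / 2) (Num.min x (2 * pi - x)).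
have dl0 : 0 < dl by rewrite !lt_min x0 subr_gt0 x2 divr_gt0.
have [dd1 dx d2x] : [/\ dl < d1, dl <= x & dl <= 2 * pi - x].
  split.
  - by apply: (@le_lt_trans _ _ (d1 / 2)); [rewrite ge_min lexx|have: 0 < d1 by []; lra].
  - by rewrite /dl !ge_min lexx orbT.
  - by rewrite /dl !ge_min lexx !orbT.
have dlpi : dl <= pi by lra.
(* Outside radius [dl] the kernel is at most [r ^+ k], whereas its mass, taken over half that
   radius, is at least [dl / 2 * r' ^+ k]; the quotient [r / r'] is below 1. *)
pose r := (1 + cos dl) / 2; pose r' := (1 + cos (dl / 2)) / 2.
have r0 : 0 <= r by rewrite divr_ge0//; have := cos_geN1 dl; lra.
have rr' : r < r'.
  rewrite /r /r' ltr_pM2r ?invr_gt0// ltrD2l ltr_cos ?in_itv/=; first lra.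
    by apply/andP; split; lra.
  by apply/andP; split; lra.
have r'0 : 0 < r' by exact: le_lt_trans rr'.
have bound k : `|g x - sig k x| <= e / 2 + (8 * M * pi / dl) * (r / r') ^+ k.
  have ck := c_gt0 k.
  have cge : dl / 2 * r' ^+ k <= c k by apply: c_ge; lra.
  have igx : mu.-integrable D (EFin \o (fun t => kern k (x - t) * (g t - g x))).
    under [X in EFin \o X]eq_fun do rewrite mulrBr.
    rewrite /comp; under eq_fun do rewrite EFinB.
    apply: (integrableB mD (ikg k x)).
    rewrite /comp; under eq_fun do rewrite mulrC.
    exact: (integrableZl mD (g x) (ik k x)).
  have iz : mu.-integrable D (EFin \o (fun t => e / 2 * kern k (x - t))).
    exact: (integrableZl mD (e / 2) (ik k x)).
  have iub : mu.-integrable D (EFin \o (fun t => e / 2 * kern k (x - t) + 2 * M * r ^+ k)).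
    exact: (integrableD mD iz (integrable_cst_Tdom _)).
  have E : sig k x - g x = (c k)^-1 * \int[mu]_(t in D) (kern k (x - t) * (g t - g x)).
    under eq_Rintegral do rewrite mulrBr.
    rewrite (RintegralB mD (ikg k x)); last first.
      under [X in EFin \o X]eq_fun do rewrite mulrC.
      exact: (integrableZl mD (g x) (ik k x)).
    rewrite (RintegralZr _ mD (ik k x)) c_translate mulrBr /sig; congr (_ - _).
    by rewrite mulKf// gt_eqF.
  have le1 : `|\int[mu]_(t in D) (kern k (x - t) * (g t - g x))| <=
      e / 2 * c k + 2 * M * r ^+ k * (2 * pi).
    apply: (le_trans (le_normr_Rintegral mD igx)).
    have -> : e / 2 * c k + 2 * M * r ^+ k * (2 * pi) =
        \int[mu]_(t in D) (e / 2 * kern k (x - t) + 2 * M * r ^+ k).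
      rewrite (RintegralD mD iz (integrable_cst_Tdom _)).
      rewrite (RintegralZl _ mD (ik k x)) c_translate (Rintegral_cst mu mD).
      by rewrite [X in fine X]mu_Tdom.
    apply: (le_Rintegral mD (integrable_norm igx) iub) => t Dt.
    rewrite /= normrM (ger0_norm (kern_ge0 _ _)).
    have [dxt|dxt] := ltP `|x - t| dl.
      have : `|g x - g t| <= e / 2 by apply: hd1; rewrite /ball/=; exact: lt_trans dd1.
      rewrite distrC => h; rewrite mulrC; apply: (@le_trans _ _ (e / 2 * kern k (x - t))).
        by rewrite ler_wpM2r ?kern_ge0.
      by rewrite lerDl mulr_ge0 ?exprn_ge0// mulr_ge0.
    have kr : kern k (x - t) <= r ^+ k.
      rewrite /kern lerXn2r ?nnegrE ?divr_ge0//.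
      suff : cos (x - t) <= cos dl by rewrite /r; lra.
      rewrite -cos_norm; apply: cos_le_far => //; first exact: ltW.
      by rewrite ler_norml; case/andP: Dt => ? ?; apply/andP; split; lra.
    have gg : `|g t - g x| <= 2 * M.
      by rewrite (le_trans (ler_normB _ _))//; have := gM t; have := gM x; lra.
    apply: (@le_trans _ _ (2 * M * r ^+ k)).
      by rewrite mulrC; apply: ler_pM; rewrite ?kern_ge0.
    by rewrite lerDr mulr_ge0 ?kern_ge0// ltW.
  rewrite distrC E normrM normfV (gtr0_norm ck) mulrC ler_pdivrMr//.
  apply: (le_trans le1); rewrite [X in _ <= X]mulrDl lerD2l.
  have -> : 2 * M * r ^+ k * (2 * pi) =
      (8 * M * pi / dl) * (r / r') ^+ k * (dl / 2 * r' ^+ k).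
    have fE (P A B : R) : B != 0 ->
        2 * M * A * (2 * P) = 8 * M * P / dl * (A / B) * (dl / 2 * B).
      by move=> B0; field; rewrite B0 gt_eqF.
    by rewrite (expr_div_n r r'); apply: fE; rewrite expf_neq0// gt_eqF.
  apply: ler_wpM2l cge; apply: mulr_ge0; last first.
    by apply: exprn_ge0; apply: divr_ge0; [exact: r0|exact: ltW].
  apply: divr_ge0; last exact: ltW.
  by apply: mulr_ge0; [apply: mulr_ge0|exact: pi_ge0].
have r1 : `|r / r'| < 1.
  by rewrite ger0_norm ?divr_ge0 ?(ltW r'0)// ltr_pdivrMr// mul1r.
have c0 : (8 * M * pi / dl) * (r / r') ^+ k @[k --> \oo] --> 0.
  by rewrite -(mulr0 (8 * M * pi / dl)); apply: cvgMl_tmp; exact: cvg_expr.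
have /cvgr0Pnorm_le/(_ _ e2) := c0; apply: filterS => k hk.
apply: (le_trans (bound k)); rewrite [leRHS](splitr e) lerD2l.
exact: le_trans (ler_norm _) hk.
Qed.

Lemma kernel_approximation : exists u : nat -> R -> R,
  [/\ forall k, trigpoly (fun x => (u k x)%:C%C), forall k x, `|u k x| <= M &
      forall x, 0 < x < 2 * pi -> u k x @[k --> \oo] --> g x].
Proof. by exists sig; split. Qed.

End approximate_identity.

End Trigonometric_density.

(** * Density in L^s, duality, and uniqueness of Fourier coefficients *)

Section Duality.
Variable R : realType.
Local Notation C := R[i].
Local Notation mu := (@lebesgue_measure R).
Local Notation D := (@Tdom R).
Local Notation LS := (LS mu D).
Local Notation nrm := (nrm mu D).
Local Notation cmeas := (@cmeas _ (measurableTypeR R) R D).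
Local Notation mD := (@measurable_Tdom R).
Implicit Types (f g : R -> C) (s p q : R) (m n : int).

Lemma ae_neq (a : R) : {ae mu, forall x, x != a}.
Proof.
exists [set a]; split; first exact: measurable_set1.
  exact: lebesgue_measure_set1.
by move=> x /= /negP; rewrite negbK => /eqP.
Qed.

Lemma ae_Tdom_oo : {ae mu, forall x, D x -> 0 < x < 2 * pi}.
Proof.
apply: ae_imp (ae_and (ae_neq 0) (ae_neq (2 * pi))) => x [x0 x2] /andP[h1 h2].
by rewrite !lt_neqAle h1 h2 x2 eq_sym x0.
Qed.

Lemma dominated_Tdom s (h : nat -> R -> C) (F : R -> C) (e : R) : 0 < s -> 0 < e ->
  (forall k, cmeas (h k)) -> LS s F ->
  (forall k x, D x -> cabs (h k x) <= cabs (F x)) ->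
  (forall x, 0 < x < 2 * pi -> cabs (h k x) @[k --> \oo] --> 0) ->
  exists k, LS s (h k) /\ nrm s (h k) <= e.
Proof.
move=> s0 e0 mh LF hF h0; apply: (dominated_nrm mD s0 e0 mh LF hF).
by apply: ae_imp ae_Tdom_oo => x xD Dx; apply: h0; exact: xD.
Qed.

(** For [0 <= M], the point of [[-M, M]] nearest to [y]; written with absolute values it is visibly
    continuous. *)
Definition clip (M y : R) : R := (`|y + M| - `|y - M|) / 2.

Lemma clip_le M y : 0 <= M -> `|clip M y| <= M.
Proof.
move=> M0; rewrite /clip ler_norml.
by case: (ger0P (y + M)) => ?; case: (ger0P (y - M)) => ?; apply/andP; split; lra.
Qed.

Lemma clip_dist M y h : `|h| <= M -> `|h - clip M y| <= `|h - y|.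
Proof.
rewrite /clip ler_norml => /andP[h1 h2].
case: (ger0P (y + M)) => ?; case: (ger0P (y - M)) => ?;
  case: (ger0P (h - y)) => ?; rewrite ler_norml; apply/andP; split; lra.
Qed.

Lemma clip_continuous M : continuous (clip M).
Proof.
move=> y; rewrite /clip; apply: cvgMr_tmp; apply: cvgB; apply: cvg_norm.
  by apply: cvgD; [exact: cvg_id|exact: cvg_cst].
by apply: cvgB; [exact: cvg_id|exact: cvg_cst].
Qed.

(** Continuous functions approximate [h] in [L^1]. Clipping them to [[-N, N]] keeps the error [d]
    below [2 N], and [d ^ s <= (2 N) ^ (s - 1) * d] converts the [L^1] estimate into one in [L^s].
    The kernel then replaces the continuous function by a polynomial. *)
Lemma real_trigpoly_dense s (h : R -> R) (M e : R) : 1 <= s -> 0 < e ->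
  @measurable_fun _ _ (measurableTypeR R) _ D h -> (forall x, D x -> `|h x| <= M) ->
  exists2 u : R -> C, trigpoly u & nrm s (fun x => (h x)%:C%C - u x) <= e.
Proof.
move=> s1 e0 mh hM; have s0 : 0 < s by apply: lt_le_trans s1.
pose N := `|M| + 1; have N0 : 0 < N by rewrite ltr_pwDr.
have hN x : D x -> `|h x| <= N.
  by move=> Dx; rewrite (le_trans (hM _ Dx))// (le_trans (ler_norm _))// lerDl.
have e2 : 0 < e / 2 by rewrite divr_gt0.
have ch : cint (fun x => (h x)%:C%C).
  apply: (@LS_cint _ 2); first by rewrite ltr1n.
  apply: (@LS_bounded _ _ _ M).
  - by rewrite ltr0n.
  - exact: (@cmeas_real _ (measurableTypeR R) R D h mh).
  - by move=> x Dx; rewrite cabs_real hM.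
have ih : mu.-integrable D (EFin \o h) by case: ch.
have muD : (mu D < +oo)%E by rewrite mu_Tdom ltry.
have [g_ [cg ig gh]] := approximation_continuous_integrable mD muD ih.
(* After multiplication by [(2 N) ^ (s - 1)] this tolerance becomes [(e / 2) ^ s]. *)
have [k hk] : exists k, (\int[mu]_(x in D) `|(h x - g_ k x)%:E| <=
    ((e / 2) `^ s / (2 * N) `^ (s - 1))%:E)%E.
  apply: contrapT => /forallNP H.
  have c0 : 0 < (e / 2) `^ s / (2 * N) `^ (s - 1).
    by rewrite divr_gt0 ?powR_gt0 ?mulr_gt0.
  have : (((e / 2) `^ s / (2 * N) `^ (s - 1))%:E <= 0)%E.
    rewrite -(cvg_lim _ gh)//; apply: lime_ge; first by apply/cvg_ex; exists 0%E.
    by apply: nearW => k; apply/ltW; rewrite ltNge; apply/negP; exact: H.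
  by rewrite lee_fin leNgt c0.
pose g x := clip N (g_ k x).
have gN x : `|g x| <= N by apply: clip_le; exact: ltW.
have cgg : continuous g.
  move=> x; apply: (@continuous_comp _ _ _ (g_ k) (clip N)).
    exact: cg.
  exact: clip_continuous.
have mg : @measurable_fun _ _ (measurableTypeR R) _ D g.
  by apply: measurable_funTS; exact: continuous_measurable_fun.
have chg : cmeas (fun x => (h x - g x)%:C%C).
  apply: (@cmeas_real _ (measurableTypeR R) R D (fun x => h x - g x)).
  exact: measurable_funB.
have [L1 n1] : LS s (fun x => (h x - g x)%:C%C) /\
    nrm s (fun x => (h x - g x)%:C%C) <= e / 2.
  apply: (nrm_le s0 (ltW e2) chg).
  have step : (\int[mu]_(x in D) (cabs ((h x - g x)%:C%C) `^ s)%:E <=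
    ((2 * N) `^ (s - 1))%:E * \int[mu]_(x in D) `|(h x - g_ k x)%:E|)%E.
    have mhg : @measurable_fun _ _ (measurableTypeR R) _ D (fun x => `|(h x - g_ k x)%:E|%E).
      apply: measurableT_comp => //; apply/measurable_EFinP; apply: measurable_funB => //.
      by apply: measurable_funTS; exact: continuous_measurable_fun.
    rewrite -ge0_integralZl//; last 2 first.
      exact: mD.
      by rewrite lee_fin powR_ge0.
    apply: ge0_le_integral.
    - exact: mD.
    - by move=> x _; rewrite lee_fin powR_ge0.
    - by apply/measurable_EFinP; exact: measurable_cabs_powR.
    - by apply: emeasurable_funM => //; exact: measurable_cst.
    move=> x Dx; rewrite cabs_real /= -EFinM lee_fin.
    set d := `|h x - g x|.
    have d0 : 0 <= d by exact: normr_ge0.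
    have d2 : d <= 2 * N.
      by rewrite (le_trans (ler_normB _ _))//; have := hN x Dx; have := gN x; lra.
    have dd : d <= `|h x - g_ k x| by apply: clip_dist; exact: hN.
    rewrite -(mulr_powRB1 d0 s0) mulrC; apply: ler_pM => //; first exact: powR_ge0.
    apply: ge0_ler_powR; rewrite ?nnegrE ?subr_ge0//.
    by rewrite mulr_ge0// ltW.
  apply: (le_trans step).
  apply: (@le_trans _ _ (((2 * N) `^ (s - 1))%:E * ((e / 2) `^ s / (2 * N) `^ (s - 1))%:E)%E).
    by apply: lee_wpmul2l => //; rewrite lee_fin powR_ge0.
  by rewrite -EFinM lee_fin mulrC divfK// gt_eqF// powR_gt0// mulr_gt0.
have [u [tu uN ug]] := kernel_approximation cgg gN.
pose hh k x : C := (g x)%:C%C - (u k x)%:C%C.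
have mu_ k' : cmeas (fun x => (u k' x)%:C%C) by apply: (trigpoly_LS s1 (tu k')).1.
have mgC : cmeas (fun x => (g x)%:C%C).
  exact: (@cmeas_real _ (measurableTypeR R) R D g mg).
have [k' [L2 n2]] : exists k', LS s (hh k') /\ nrm s (hh k') <= e / 2.
  apply: (dominated_Tdom (F := fun=> (2 * N)%:C%C) s0 e2).
  - by move=> j; exact: cmeasB.
  - exact: LS_cst.
  - move=> j x _; rewrite /hh -rmorphB !cabs_real [X in _ <= X]ger0_norm; last by rewrite mulr_ge0// ltW.
    by rewrite (le_trans (ler_normB _ _))//; have := uN j x; have := gN x; lra.
  - move=> x xD; have /cvg_distP := ug x xD.
    have -> // : (fun k' => cabs (hh k' x)) = (fun k' => `|u k' x - g x|).
    by apply/funext => j; rewrite /hh -rmorphB cabs_real distrC.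
exists (fun x => (u k' x)%:C%C); first exact: tu.
have [_ n3] := LSD mD s1 L1 L2.
rewrite (_ : nrm s _ = nrm s (fun x => (h x - g x)%:C%C + hh k' x)); last first.
  by apply: eq_nrm => x _; rewrite /hh rmorphB addrA subrK.
by apply: (le_trans n3); rewrite [leRHS]splitr lerD.
Qed.

Lemma trigpoly_dense s f (e : R) : 1 <= s -> 0 < e -> LS s f ->
  exists2 u : R -> C, trigpoly u & nrm s (fun x => f x - u x) <= e.
Proof.
move=> s1 e0 Lf; have s0 : 0 < s by apply: lt_le_trans s1.
have e4 : 0 < e / 4 by rewrite divr_gt0.
have mf := Lf.1.
have mt (k : R) : cmeas (trunc k f) by exact: (cmeas_trunc (T := measurableTypeR R) mD k mf).
have [k [L1 n1]] : exists k : nat, LS s (fun x => f x - trunc k%:R f x) /\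
    nrm s (fun x => f x - trunc k%:R f x) <= e / 2.
  apply: (dominated_Tdom (h := fun k x => f x - trunc k%:R f x) s0 _ _ Lf).
  - by rewrite divr_gt0.
  - by move=> k; exact: cmeasB.
  - move=> k x _; rewrite /trunc; case: ifP => _; last by rewrite subr0.
    by rewrite subrr cabs0 cabs_ge0.
  - move=> x _; apply/cvgr0Pnorm_le => d d0.
    exists (Num.bound (cabs (f x))) => // k /= hk.
    rewrite /trunc ifT ?subrr ?cabs0 ?normr0 ?ltW//.
    by rewrite (lt_le_trans (archi_boundP (cabs_ge0 _)))// ler_nat.
set F := trunc k%:R f.
have FM x : cabs (F x) <= k%:R.
  by rewrite /F /trunc; case: ifP => // _; rewrite cabs0.
have [F1 F2] := mt k%:R.
have [u tu nu] := @real_trigpoly_dense s (fun x => Re (F x)) k%:R _ s1 e4 F1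
  (fun x _ => le_trans (Re_le_cabs _) (FM x)).
have [v tv nv] := @real_trigpoly_dense s (fun x => Im (F x)) k%:R _ s1 e4 F2
  (fun x _ => le_trans (Im_le_cabs _) (FM x)).
exists (fun x => u x + 'i%C * v x).
  by apply: trigpolyD => //; exact: trigpolyZ.
have LF (h : R -> R) (w : R -> C) : @measurable_fun _ _ (measurableTypeR R) _ D h ->
    (forall x, `|h x| <= k%:R) -> trigpoly w -> LS s (fun x => (h x)%:C%C - w x).
  move=> mh hk tw; apply: (LSB mD s1 _ (trigpoly_LS s1 tw)).1.
  apply: (@LS_bounded _ _ _ k%:R s0).
    exact: (@cmeas_real _ (measurableTypeR R) R D h mh).
  by move=> x _; rewrite cabs_real.
have Lu := LF _ _ F1 (fun x => le_trans (Re_le_cabs _) (FM x)) tu.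
have Lv := LF _ _ F2 (fun x => le_trans (Im_le_cabs _) (FM x)) tv.
have [Lv' nv'] := LSZ mD 'i%C s0 Lv.
have [Luv nuv] := LSD mD s1 Lu Lv'.
have [_ n3] := LSD mD s1 L1 Luv.
rewrite (_ : nrm s _ = nrm s (fun x => (f x - trunc k%:R f x) +
   (((Re (F x))%:C%C - u x) + 'i%C * ((Im (F x))%:C%C - v x)))); last first.
  apply: eq_nrm => x _; rewrite -/(F x).
  have {1}-> : F x = (Re (F x))%:C%C + 'i%C * (Im (F x))%:C%C.
    by apply: complex_ext; rewrite ?cReD ?cImD ?cReM ?cImM /=; ring.
  by ring.
apply: (le_trans n3); rewrite [leRHS]splitr; apply: lerD => //.
apply: (le_trans nuv); rewrite nv'.
have -> : cabs ('i%C : C) = 1 by rewrite cabsE /= expr0n expr1n /= add0r sqrtr1.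
rewrite mul1r (_ : e / 2 = e / 4 + e / 4); last by lra.
exact: lerD.
Qed.

(** Hoelder's inequality for [f] is an equality against this function. At a zero of [f] the factor
    [conjc (f x)] settles the value, whatever the power of 0 is. *)
Definition dualf s f (x : R) : C := conjc (f x) * ((cabs (f x)) `^ (s - 2))%:C%C.

Lemma cabs_dualf s f x : 1 < s -> cabs (dualf s f x) = cabs (f x) `^ (s - 1).
Proof.
move=> s1; rewrite cabsM cabs_conj cabs_real ger0_norm ?powR_ge0//.
have [f0|f0] := eqVneq (cabs (f x)) 0.
  by rewrite f0 mul0r powR0// subr_eq0 gt_eqF.
rewrite -{1}(powRr1 (cabs_ge0 (f x))) -powRD; last by rewrite f0 implybT.
by congr (_ `^ _); ring.
Qed.

Lemma mul_dualf s f x : 1 < s -> f x * dualf s f x = ((cabs (f x)) `^ s)%:C%C.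
Proof.
move=> s1; rewrite /dualf mulrA mul_conj -rmorphM; congr (_%:C%C).
have [f0|f0] := eqVneq (cabs (f x)) 0.
  by rewrite f0 expr0n mul0r powR0// gt_eqF// (lt_trans ltr01).
rewrite -(powR_mulrn 2 (cabs_ge0 (f x))) -powRD; last by rewrite f0 implybT.
by congr (_ `^ _); ring.
Qed.

Lemma LS_dualf s f : 1 < s -> LS s f ->
  LS (conjex s) (dualf s f) /\ nrm (conjex s) (dualf s f) = nrm s f `^ (s - 1).
Proof.
move=> s1 Lf; have [s0 c1 sc] := conjexP s1; have c0 := lt_trans ltr01 c1.
have E : (s - 1) * conjex s = s.
  rewrite /conjex; field.
  by rewrite gt_eqF//= subr_eq0 gt_eqF.
have m : cmeas (dualf s f).
  apply: cmeasM; first by apply: cmeas_conj; case: Lf.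
  apply: (@cmeas_real _ (measurableTypeR R) R D (fun x => cabs (f x) `^ (s - 2))).
  by apply: measurable_cabs_powR; case: Lf.
have I : (\int[mu]_(x in D) (cabs (dualf s f x) `^ conjex s)%:E = (nrm s f `^ s)%:E)%E.
  rewrite -(nrm_powR s0 Lf); apply: eq_integral => x _.
  by rewrite cabs_dualf// -powRrM E.
split; first by split => //; rewrite I ltry.
have E2 : s * (conjex s)^-1 = s - 1 by rewrite -{1}E mulfK// gt_eqF.
by rewrite nrmE I /= -powRrM E2.
Qed.

Lemma av_dualf s f : 1 < s -> LS s f ->
  av (fun x => f x * dualf s f x) = ((2 * pi)^-1 * nrm s f `^ s)%:C%C.
Proof.
move=> s1 Lf; have s0 := lt_trans ltr01 s1.
rewrite (eq_av (g := fun x => (cabs (f x) `^ s)%:C%C)); last first.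
  by move=> x _; rewrite mul_dualf.
by rewrite av_real /Rintegral nrm_powR.
Qed.

(* Testing against trigonometric polynomials suffices by density;
   the extremal function is [dualf s f]. *)
Lemma nrm_le_test s f (K : R) : 1 < s -> LS s f -> 0 <= K ->
  (forall g, trigpoly g -> cabs (av (fun x => f x * g x)) <= K * nrm (conjex s) g) ->
  nrm s f <= 2 * pi * K.
Proof.
move=> s1 Lf K0 test; have [s0 c1 sc] := conjexP s1; have c0 := lt_trans ltr01 c1.
have [Ld nd] := LS_dualf s1 Lf.
set N := nrm s f; have N0 : 0 <= N by exact: nrm_ge0.
have main e : 0 < e -> (2 * pi)^-1 * N `^ s <= K * N `^ (s - 1) + (K + pi^-1 * N) * e.
  move=> e0; have [g tg ng] := trigpoly_dense (ltW c1) e0 Ld.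
  have Lg := trigpoly_LS (ltW c1) tg.
  have [Ldg _] := LSB mD (ltW c1) Ld Lg.
  have i1 := (hoelder_int s0 c0 sc Lf Lg).1.
  have i2 := (hoelder_int s0 c0 sc Lf Ldg).1.
  have -> : (2 * pi)^-1 * N `^ s = cabs (av (fun x => f x * dualf s f x)).
    rewrite (av_dualf s1 Lf) cabs_real ger0_norm; first by [].
    by rewrite mulr_ge0 ?powR_ge0// invr_ge0 ltW// pi2_gt0.
  have -> : av (fun x => f x * dualf s f x) =
      av (fun x => f x * g x) + av (fun x => f x * (dualf s f x - g x)).
    by rewrite -avD//; apply: eq_av => x _; rewrite -mulrDr addrC subrK.
  apply: (le_trans (cabsD _ _)).
  have h1 : cabs (av (fun x => f x * g x)) <= K * (N `^ (s - 1) + e).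
    apply: (le_trans (test g tg)); apply: ler_wpM2l => //.
    have [_] := LSB mD (ltW c1) Ld Ldg.
    have -> : nrm (conjex s) (fun x => dualf s f x - (dualf s f x - g x)) =
        nrm (conjex s) g by apply: eq_nrm => x _; rewrite opprB addrC subrK.
    by move=> h; apply: (le_trans h); rewrite nd lerD2l.
  have h2 : cabs (av (fun x => f x * (dualf s f x - g x))) <= pi^-1 * N * e.
    apply: (le_trans (hoelder_av s0 c0 sc Lf Ldg)); rewrite -mulrA.
    by rewrite !ler_wpM2l ?invr_ge0 ?pi_ge0.
  by apply: (le_trans (lerD h1 h2)); rewrite mulrDr mulrDl addrA.
(* Letting [e] tend to 0 removes the error of replacing the extremal function by a polynomial. *)
have {main} main : (2 * pi)^-1 * N `^ s <= K * N `^ (s - 1).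
  apply/ler_addgt0Pr => e e0.
  have A0 : 0 < K + pi^-1 * N + 1.
    by rewrite ltr_pwDr// addr_ge0// mulr_ge0// invr_ge0 pi_ge0.
  apply: (le_trans (main (e / (K + pi^-1 * N + 1)) _)); first by rewrite divr_gt0.
  rewrite lerD2l mulrCA ger_pMr// ler_pdivrMr// mul1r.
  by rewrite lerDl.
move: N0; rewrite le_eqVlt => /orP[/eqP <-|N0].
  by rewrite mulr_ge0// ltW// pi2_gt0.
move: main; rewrite -(mulr_powRB1 (ltW N0) s0) mulrA.
rewrite ler_pM2r ?powR_gt0// mulrC ler_pdivrMr ?pi2_gt0//.
by rewrite mulrC.
Qed.

(** Every test against a trigonometric polynomial gives 0, so [nrm_le_test] applies with [K = 0]. *)
Lemma fc_eq0 s f : 1 < s -> LS s f -> (forall n, fc f n = 0) ->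
  {ae mu, forall x, D x -> f x = 0}.
Proof.
move=> s1 Lf f0; have s0 := lt_trans ltr01 s1.
apply/(nrm_eq0 mD s0 Lf)/le_anti; rewrite nrm_ge0 andbT.
rewrite -(mulr0 (2 * pi)); apply: (nrm_le_test s1 Lf) => // g tg.
rewrite mul0r; have fi := LS_cint s1 Lf.
suff -> : av (fun x => f x * g x) = 0 by rewrite cabs0.
elim/trigpoly_ind : tg => [|c n h th IH].
  under [X in av X]eq_fun do rewrite mulr0.
  by apply: complex_ext; rewrite /= (Rintegral_cst mu mD) mul0r mulr0.
have ifh : cint (fun x => f x * h x).
  by under eq_fun do rewrite mulrC; exact: cint_trigpoly_mul.
have ife : cint (fun x => f x * ex n x) by exact: cint_mul_ex.
rewrite (eq_av (g := fun x => c * (f x * ex n x) + f x * h x)); last first.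
  by move=> x _; ring.
rewrite avD ?avZ ?IH//; last exact: cintZ.
by have := f0 (- n); rewrite fc_ex opprK => ->; rewrite mulr0 addr0.
Qed.

Lemma fc_inj s f g : 1 < s -> LS s f -> LS s g -> (forall n, fc f n = fc g n) ->
  {ae mu, forall x, D x -> f x = g x}.
Proof.
move=> s1 Lf Lg fg.
have [Lfg _] := LSB mD (ltW s1) Lf Lg.
have := fc_eq0 s1 Lfg _; set P := (X in (X -> _) -> _) => H.
apply: ae_imp (H _) => [x h Dx|n]; first by apply/eqP; rewrite -subr_eq0 h.
by rewrite (fcB n (LS_cint s1 Lf) (LS_cint s1 Lg)) fg subrr.
Qed.

End Duality.

(** * M. Riesz's inequality for conjugate functions *)

Section Derivatives.
Variable R : realType.
Implicit Types (f g : R -> R) (x a b c l : R).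

Definition isd f x l := is_derive x (1 : R) f l.

Lemma isd_eq f x a b : isd f x a -> a = b -> isd f x b.
Proof. by move=> ? <-. Qed.

Lemma isd_cst c x : isd (fun=> c) x 0.
Proof. exact: is_derive_cst. Qed.

Lemma isdD f g x a b : isd f x a -> isd g x b -> isd (fun y => f y + g y) x (a + b).
Proof. by move=> fa gb; exact: is_deriveD. Qed.

Lemma isdM f g x a b : isd f x a -> isd g x b ->
  isd (fun y => f y * g y) x (a * g x + f x * b).
Proof.
move=> fa gb; apply: (isd_eq (a := f x *: b + g x *: a)); first exact: is_deriveM.
by rewrite /GRing.scale /=; ring.
Qed.

Lemma isdZ f x a c : isd f x a -> isd (fun y => c * f y) x (c * a).
Proof.
move=> fa; apply: (isd_eq (isdM (is_derive_cst c x 1) fa)).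
by rewrite mul0r add0r.
Qed.

Lemma isd_sum n (h : 'I_n -> R -> R) x (dh : 'I_n -> R) :
  (forall i, isd (h i) x (dh i)) ->
  isd (fun y => \sum_(i < n) h i y) x (\sum_(i < n) dh i).
Proof.
move=> hd; have := is_derive_sum hd; congr is_derive.
by apply/funext => y; rewrite fct_sumE.
Qed.

Lemma isd_lin c x : isd (fun y => c * y) x c.
Proof.
by apply: (isd_eq (isdZ c (is_derive_id x 1))); rewrite mulr1.
Qed.

Lemma isd_comp f g x a b : isd f (g x) a -> isd g x b ->
  isd (fun y => f (g y)) x (a * b).
Proof. by move=> fa gb; exact: (@is_derive1_comp _ f g). Qed.

Lemma isd_powR f x a b : 0 < f x -> isd f x b ->
  isd (fun y => f y `^ a) x (a * f x `^ (a - 1) * b).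
Proof. by move=> f0 fb; exact: (isd_comp (f := fun y => y `^ a) (is_derive1_powR a f0) fb). Qed.

Lemma isd_continuous f : (forall x, exists l, isd f x l) -> continuous f.
Proof.
move=> df x; have [l fl] := df x.
by apply: differentiable_continuous; apply/derivable1_diffP; case: fl.
Qed.

Lemma isd_nondecreasing f (df : R -> R) (u v : R) :
  (forall x, u < x < v -> isd f x (df x)) -> (forall x, u < x < v -> 0 <= df x) ->
  forall a b, u < a -> a <= b -> b < v -> f a <= f b.
Proof.
move=> fd d0 a b ua; rewrite le_eqVlt => /orP[/eqP -> //|ab] bv.
have sub x : a <= x <= b -> u < x < v by move=> /andP[? ?]; apply/andP; split; lra.
have [||c] := @MVT R f df a b ab.
- move=> x; rewrite in_itv/= => /andP[xa xb]; apply: fd; apply: sub.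
  by rewrite !ltW.
- apply: derivable_within_continuous => x; rewrite in_itv/= => xab.
  by case: (fd x (sub x xab)).
rewrite in_itv/= => /andP[ac cb] E; rewrite -subr_ge0 E mulr_ge0 ?subr_ge0 ?(ltW ab)//.
by apply: d0; apply: sub; rewrite !ltW.
Qed.

Lemma integrable_Tdom_continuous f : continuous f ->
  (@lebesgue_measure R).-integrable (@Tdom R) (EFin \o f).
Proof.
move=> cf; rewrite TdomE; apply: continuous_compact_integrable.
  exact: segment_compact.
exact: continuous_subspaceT.
Qed.

Lemma isd_integral (h h1 : R -> R -> R) (u v M : R) :
  (forall s, u < s < v -> continuous (h s)) ->
  (forall s t, u < s < v -> isd (h ^~ t) s (h1 s t)) ->
  (forall s t, u < s < v -> `|h1 s t| <= M) ->
  forall s, u < s < v ->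
    isd (fun s => \int[lebesgue_measure]_(t in @Tdom R) h s t) s
        (\int[lebesgue_measure]_(t in @Tdom R) h1 s t).
Proof.
move=> ch dh hM s suv.
have suv' : `]u, v[%classic s by rewrite /= in_itv.
have itvE x : `]u, v[%classic x -> u < x < v by rewrite /= in_itv.
have M0 : 0 <= M by exact: le_trans (hM s 0 suv).
have ih x : `]u, v[%classic x -> lebesgue_measure.-integrable (@Tdom R) (EFin \o h x).
  by move=> /itvE ?; apply: integrable_Tdom_continuous; exact: ch.
have dh1 x y : `]u, v[%classic x -> @Tdom R y -> derivable (h ^~ y) x 1.
  by move=> /itvE xuv _; case: (dh x y xuv).
have pE x y : u < x < v -> partial1of2 h x y = h1 x y.
  by move=> xuv; rewrite partial1of2E; have := dh x y xuv => -[].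
have hub x y : `]u, v[%classic x -> @Tdom R y -> `|partial1of2 h x y| <= cst M y.
  by move=> /itvE xuv _; rewrite pE// hM.
have iM := @integrable_cst_Tdom R M.
have dv := derivable_under_integral (@measurable_Tdom R) suv' ih dh1 (fun=> M0) iM hub.
have de := differentiation_under_integral (@measurable_Tdom R) suv' ih dh1 (fun=> M0) iM hub.
apply: (DeriveDef dv); rewrite -derive1E de.
by apply: eq_Rintegral => y _; rewrite pE.
Qed.

End Derivatives.

(** * P. Stein's convexity argument *)

Section Harmonic.
Variable R : realType.
Local Notation mu := (@lebesgue_measure R).
Local Notation D := (@Tdom R).
Implicit Types (A B : nat -> R) (s t : R).

(* Harmonic functions of [log z = s + i t] that vanish at the centre [s = -oo]. *)
Definition harm (N : nat) A B s t : R :=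
  \sum_(k < N) expR (k.+1%:R * s) *
    (A k * cos (k.+1%:R * t) + B k * sin (k.+1%:R * t)).

(** Differentiation stays inside the family [harm]: [d/ds] multiplies the coefficients by the
    frequency, and [d/dt] in addition turns [(A, B)] into [(B, -A)]. *)
Definition mulk A : nat -> R := fun k => k.+1%:R * A k.

Lemma harm_ds N A B t s : isd (harm N A B ^~ t) s (harm N (mulk A) (mulk B) s t).
Proof.
apply: (isd_eq (a := \sum_(k < N) k.+1%:R * expR (k.+1%:R * s) *
    (A k * cos (k.+1%:R * t) + B k * sin (k.+1%:R * t)))).
  apply: isd_sum => k.
  have := isdM (isd_comp (is_derive_expR _) (isd_lin k.+1%:R s))
    (is_derive_cst (A k * cos (k.+1%:R * t) + B k * sin (k.+1%:R * t)) s 1).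
  by move/isd_eq; apply; rewrite mulr0 addr0 (mulrC (expR _)).
by apply: eq_bigr => k _; rewrite /mulk; ring.
Qed.

Lemma harm_dt N A B s t :
  isd (harm N A B s) t (harm N (mulk B) (fun k => - mulk A k) s t).
Proof.
apply: (isd_eq (a := \sum_(k < N) expR (k.+1%:R * s) *
    (A k * (- sin (k.+1%:R * t) * k.+1%:R) + B k * (cos (k.+1%:R * t) * k.+1%:R)))).
  apply: isd_sum => k; apply: isdZ; apply: isdD; apply: isdZ.
    exact: (isd_comp (is_derive_cos _) (isd_lin k.+1%:R t)).
  exact: (isd_comp (is_derive_sin _) (isd_lin k.+1%:R t)).
by apply: eq_bigr => k _; rewrite /mulk; ring.
Qed.

Lemma harm_2pi N A B s : harm N A B s (2 * pi) = harm N A B s 0.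
Proof.
apply: eq_bigr => k _; have [h1 h2] := cos_int_2pi R k.+1.
by rewrite h1 h2 !mulr0 cos0 sin0 !mulr0.
Qed.

Definition hbound N A B : R := \sum_(k < N) (`|A k| + `|B k|).

Lemma hbound_ge0 N A B : 0 <= hbound N A B.
Proof. by apply: sumr_ge0 => k _; rewrite addr_ge0. Qed.

Lemma harm_le N A B s t c : (forall k : 'I_N, expR (k.+1%:R * s) <= c) ->
  `|harm N A B s t| <= c * hbound N A B.
Proof.
move=> ec; rewrite /hbound mulr_sumr; apply: (le_trans (ler_norm_sum _ _ _)).
apply: ler_sum => k _; rewrite normrM (ger0_norm (expR_ge0 _)).
apply: ler_pM => //.
apply: (le_trans (ler_normD _ _)); rewrite !normrM lerD//.
  by rewrite ler_piMr// cos_max.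
by rewrite ler_piMr// sin_max.
Qed.

(** All frequencies are at least 1, which gives the decay towards the centre. *)
Lemma harm_le_exp N A B s t : s <= 0 -> `|harm N A B s t| <= expR s * hbound N A B.
Proof.
move=> s0; apply: harm_le => k; rewrite ler_expR.
by rewrite -natr1 mulrDl mul1r gerDr mulr_ge0_le0.
Qed.

(** The range reaches beyond the unit circle [s = 0], so that integrals can be differentiated there
    from both sides. *)
Lemma harm_le1 N A B s t : s <= 1 -> `|harm N A B s t| <= expR N%:R * hbound N A B.
Proof.
move=> s1; apply: harm_le => k; rewrite ler_expR.
apply: (@le_trans _ _ (k.+1%:R * 1)); first by rewrite ler_wpM2l.
by rewrite mulr1 ler_nat.
Qed.

Section square_sum.
Variables (n N : nat) (A B : 'I_n -> nat -> R) (a : R).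
Hypotheses (a0 : 0 < a) (a1 : a <= 1).

Let x i := harm N (A i) (B i).
Let xs i := harm N (mulk (A i)) (mulk (B i)).
Let xt i := harm N (mulk (B i)) (fun k => - mulk (A i) k).
Let xss i := harm N (mulk (mulk (A i))) (mulk (mulk (B i))).
Let xst i := harm N (mulk (mulk (B i))) (fun k => - mulk (mulk (A i)) k).

Let x_ds i t s : isd (x i ^~ t) s (xs i s t). Proof. exact: harm_ds. Qed.
Let x_dt i s t : isd (x i s) t (xt i s t). Proof. exact: harm_dt. Qed.
Let xs_ds i t s : isd (xs i ^~ t) s (xss i s t). Proof. exact: harm_ds. Qed.
Let xs_dt i s t : isd (xs i s) t (xst i s t). Proof. exact: harm_dt. Qed.
Let xss_dt i s t : exists l, isd (xss i s) t l.
Proof. by eexists; exact: harm_dt. Qed.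
Let xt_dt i s t : isd (xt i s) t (- xss i s t).
Proof.
apply: (isd_eq (harm_dt _ _ _ _ _)); rewrite /xss /harm -sumrN.
by apply: eq_bigr => k _; rewrite /mulk; ring.
Qed.

(** Taken below with [n = 2] for [|f|^2], split into real and imaginary parts, and with [n = 4] for
    [|f|^2 + |g|^2]. *)
Definition sqsum s t := \sum_(i < n) x i s t ^+ 2.
Definition sqsum_s s t := \sum_(i < n) 2 * (x i s t * xs i s t).
Definition sqsum_t s t := \sum_(i < n) 2 * (x i s t * xt i s t).
Definition sqsum_ss s t := \sum_(i < n) 2 * (xs i s t ^+ 2 + x i s t * xss i s t).
Definition sqsum_tt s t := \sum_(i < n) 2 * (xt i s t ^+ 2 - x i s t * xss i s t).
Definition sqsum_grad s t := \sum_(i < n) (xs i s t ^+ 2 + xt i s t ^+ 2).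

Lemma sqsum_ge0 s t : 0 <= sqsum s t.
Proof. by apply: sumr_ge0 => i _; exact: sqr_ge0. Qed.

Lemma sqsum_gt0 s t : 0 < 1 + sqsum s t.
Proof. by rewrite ltr_pwDl// sqsum_ge0. Qed.

Let S_ds t s : isd (sqsum ^~ t) s (sqsum_s s t).
Proof.
apply: isd_sum => i; apply: (isd_eq (isdM (x_ds i t s) (x_ds i t s))).
by ring.
Qed.

Let S_dt s t : isd (sqsum s) t (sqsum_t s t).
Proof.
apply: isd_sum => i; apply: (isd_eq (isdM (x_dt i s t) (x_dt i s t))).
by ring.
Qed.

Let Ss_ds t s : isd (sqsum_s ^~ t) s (sqsum_ss s t).
Proof.
apply: isd_sum => i; apply: isdZ.
by apply: (isd_eq (isdM (x_ds i t s) (xs_ds i t s))); ring.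
Qed.

Let St_dt s t : isd (sqsum_t s) t (sqsum_tt s t).
Proof.
apply: isd_sum => i; apply: isdZ.
by apply: (isd_eq (isdM (x_dt i s t) (xt_dt i s t))); ring.
Qed.

Let Ss_dt s t : exists l, isd (sqsum_s s) t l.
Proof.
eexists; apply: isd_sum => i; apply: isdZ.
exact: (isdM (x_dt i s t) (xs_dt i s t)).
Qed.

Let Sss_dt s t : exists l, isd (sqsum_ss s) t l.
Proof.
have dx i : {l | isd (xss i s) t l} by apply: cid; exact: xss_dt.
eexists; apply: isd_sum => i; apply: isdZ; apply: isdD.
  exact: (isdM (xs_dt i s t) (xs_dt i s t)).
exact: (isdM (x_dt i s t) (projT2 (dx i))).
Qed.

Let Stt_dt s t : exists l, isd (sqsum_tt s) t l.
Proof.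
have dx i : {l | isd (xss i s) t l} by apply: cid; exact: xss_dt.
have E : sqsum_tt s = fun t => \sum_(i < n) 2 * (xt i s t ^+ 2 + (-1) * (x i s t * xss i s t)).
  by apply/funext => u; apply: eq_bigr => i _; rewrite mulN1r.
rewrite E; eexists; apply: isd_sum => i; apply: isdZ; apply: isdD.
  exact: (isdM (xt_dt i s t) (xt_dt i s t)).
apply: isdZ; exact: (isdM (x_dt i s t) (projT2 (dx i))).
Qed.

Let w b s t := (1 + sqsum s t) `^ b.

Let w_ds b t s : isd (w b ^~ t) s (b * w (b - 1) s t * sqsum_s s t).
Proof.
apply: isd_powR; first exact: sqsum_gt0.
by apply: (isd_eq (isdD (isd_cst 1 s) (S_ds t s))); rewrite add0r.
Qed.

Let w_dt b s t : isd (w b s) t (b * w (b - 1) s t * sqsum_t s t).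
Proof.
apply: isd_powR; first exact: sqsum_gt0.
by apply: (isd_eq (isdD (isd_cst 1 t) (S_dt s t))); rewrite add0r.
Qed.

Let w_le1 b s t : b <= 0 -> 0 <= w b s t <= 1.
Proof.
move=> b0; rewrite powR_ge0 /= -(powRr0 (1 + sqsum s t)).
by apply: ler_powR => //; rewrite lerDl sqsum_ge0.
Qed.

Definition psi s t := w a s t.
Definition psi_s s t := a * w (a - 1) s t * sqsum_s s t.
Definition psi_ss s t := a * (a - 1) * w (a - 2) s t * sqsum_s s t ^+ 2 +
  a * w (a - 1) s t * sqsum_ss s t.
Definition psi_t s t := a * w (a - 1) s t * sqsum_t s t.
Definition psi_tt s t := a * (a - 1) * w (a - 2) s t * sqsum_t s t ^+ 2 +
  a * w (a - 1) s t * sqsum_tt s t.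

Lemma psi_ds t s : isd (psi ^~ t) s (psi_s s t).
Proof. exact: w_ds. Qed.

Lemma psi_s_ds t s : isd (psi_s ^~ t) s (psi_ss s t).
Proof.
apply: (isd_eq (isdM (isdZ a (w_ds (a - 1) t s)) (Ss_ds t s))).
by rewrite /psi_ss -(addrA a) (_ : - 1 - 1 = - 2 :> R); ring.
Qed.

Lemma psi_t_dt s t : isd (psi_t s) t (psi_tt s t).
Proof.
apply: (isd_eq (isdM (isdZ a (w_dt (a - 1) s t)) (St_dt s t))).
by rewrite /psi_tt -(addrA a) (_ : - 1 - 1 = - 2 :> R); ring.
Qed.

Lemma psi_continuous s : continuous (psi s).
Proof. by apply: isd_continuous => t; eexists; exact: w_dt. Qed.

Lemma psi_s_continuous s : continuous (psi_s s).
Proof.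
apply: isd_continuous => t; have [l Sl] := Ss_dt s t.
by eexists; exact: (isdM (isdZ a (w_dt (a - 1) s t)) Sl).
Qed.

Lemma psi_ss_continuous s : continuous (psi_ss s).
Proof.
apply: isd_continuous => t; have [l Sl] := Ss_dt s t; have [m Sm] := Sss_dt s t.
eexists; apply: isdD.
  exact: (isdM (isdZ (a * (a - 1)) (w_dt (a - 2) s t)) (isdM Sl Sl)).
exact: (isdM (isdZ a (w_dt (a - 1) s t)) Sm).
Qed.

Lemma psi_tt_continuous s : continuous (psi_tt s).
Proof.
apply: isd_continuous => t; have [m Sm] := Stt_dt s t.
eexists; apply: isdD.
  exact: (isdM (isdZ (a * (a - 1)) (w_dt (a - 2) s t)) (isdM (St_dt s t) (St_dt s t))).
exact: (isdM (isdZ a (w_dt (a - 1) s t)) Sm).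
Qed.

(** By periodicity in [t]. The integral of [psi_ss] is therefore that of the Laplacian, whose sign
    can be read off pointwise. *)
Lemma int_psi_tt s : \int[mu]_(t in D) psi_tt s t = 0.
Proof.
rewrite (Tdom_FTC (@psi_tt_continuous s) (psi_t_dt s)).
rewrite /psi_t /w /sqsum /sqsum_t /x /xt.
rewrite (eq_bigr (fun i => harm N (A i) (B i) s 0 ^+ 2)); last first.
  by move=> i _; rewrite harm_2pi.
rewrite [X in _ * X - _](eq_bigr (fun i => 2 * (harm N (A i) (B i) s 0 *
   harm N (mulk (B i)) (fun k => - mulk (A i) k) s 0))); last first.
  by move=> i _; rewrite !harm_2pi.
by rewrite subrr.
Qed.

Definition sqb : R := \sum_(i < n) 2 * (hbound N (A i) (B i) * hbound N (mulk (A i)) (mulk (B i))).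

Lemma sqsum_s_le s t c : 0 <= c -> (forall A' B', `|harm N A' B' s t| <= c * hbound N A' B') ->
  `|sqsum_s s t| <= c ^+ 2 * sqb.
Proof.
move=> c0 hc; rewrite /sqb mulr_sumr; apply: (le_trans (ler_norm_sum _ _ _)).
apply: ler_sum => i _; rewrite normrM normr_nat mulrCA ler_wpM2l//.
rewrite normrM expr2 mulrACA; apply: ler_pM => //; exact: hc.
Qed.

Lemma psi_s_le s t c : 0 <= c -> (forall A' B', `|harm N A' B' s t| <= c * hbound N A' B') ->
  `|psi_s s t| <= c ^+ 2 * sqb.
Proof.
move=> c0 hc; rewrite /psi_s normrM.
have /andP[w0 w1] : 0 <= w (a - 1) s t <= 1 by apply: w_le1; rewrite subr_le0.
rewrite (ger0_norm (mulr_ge0 (ltW a0) w0)); apply: le_trans (sqsum_s_le c0 hc).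
by rewrite ler_piMl// mulr_ile1// ltW.
Qed.

Lemma psi_ss_le : exists M, forall s t, s <= 1 -> `|psi_ss s t| <= M.
Proof.
pose c := expR N%:R : R; have c0 : 0 <= c by exact: expR_ge0.
pose sb := \sum_(i < n) 2 * ((c * hbound N (mulk (A i)) (mulk (B i))) ^+ 2 +
   (c * hbound N (A i) (B i)) * (c * hbound N (mulk (mulk (A i))) (mulk (mulk (B i))))).
exists ((c ^+ 2 * sqb) ^+ 2 + sb) => s t s1.
have hc A' B' : `|harm N A' B' s t| <= c * hbound N A' B' by exact: harm_le1.
have hs := sqsum_s_le c0 hc.
have hss : `|sqsum_ss s t| <= sb.
  apply: (le_trans (ler_norm_sum _ _ _)); apply: ler_sum => i _.
  rewrite normrM normr_nat ler_wpM2l//; apply: (le_trans (ler_normD _ _)).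
  rewrite normrX normrM; apply: lerD.
    by rewrite lerXn2r ?nnegrE ?mulr_ge0 ?hbound_ge0//; exact: hc.
  by apply: ler_pM => //; exact: hc.
have /andP[w0 w1] : 0 <= w (a - 1) s t <= 1 by apply: w_le1; rewrite subr_le0.
have /andP[v0 v1] : 0 <= w (a - 2) s t <= 1 by apply: w_le1; rewrite subr_le0 (le_trans a1)// ler1n.
apply: (le_trans (ler_normD _ _)); apply: lerD.
  rewrite normrM; apply: (@le_trans _ _ (1 * (c ^+ 2 * sqb) ^+ 2)); last by rewrite mul1r.
  apply: ler_pM => //.
    rewrite normrM (ger0_norm v0) mulr_ile1// ?normr_ge0//.
    have h1a : 0 <= 1 - a by rewrite subr_ge0.
    rewrite normrM (ger0_norm (ltW a0)) distrC (ger0_norm h1a).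
    by rewrite mulr_ile1 ?(ltW a0)// gerBl ltW.
  by rewrite normrX lerXn2r ?nnegrE// (le_trans _ hs).
rewrite normrM (ger0_norm (mulr_ge0 (ltW a0) w0)).
apply: le_trans hss; by rewrite ler_piMl// mulr_ile1// ltW.
Qed.

(** The functions [x i] are harmonic, so in the Laplacian of their squares the second derivatives
    cancel and only gradients remain. *)
Lemma psi_laplacian s t : psi_ss s t + psi_tt s t =
  a * (a - 1) * (1 + sqsum s t) `^ (a - 2) * (sqsum_s s t ^+ 2 + sqsum_t s t ^+ 2) +
  2 * a * (1 + sqsum s t) `^ (a - 1) * sqsum_grad s t.
Proof.
have E : sqsum_ss s t + sqsum_tt s t = 2 * sqsum_grad s t.
  by rewrite -big_split mulr_sumr; apply: eq_bigr => i _ /=; ring.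
rewrite /psi_ss /psi_tt -!/(w _ s t).
rewrite (_ : 2 * a * w (a - 1) s t * sqsum_grad s t =
  a * w (a - 1) s t * (sqsum_ss s t + sqsum_tt s t)); last by rewrite E; ring.
by ring.
Qed.

End square_sum.

Section conjugate.
Variables (N : nat) (A B A' B' : nat -> R) (q : R).
Hypotheses (q1 : 1 < q) (q2 : q <= 2).

Let a := q / 2.
Let a0 : 0 < a. Proof. by rewrite divr_gt0// (lt_trans ltr01). Qed.
Let a1 : a <= 1. Proof. by rewrite ler_pdivrMr// mul1r. Qed.
Let c := 2 / (q - 1).
Let c2 : 2 <= c.
Proof. by rewrite ler_pdivlMr ?subr_gt0//; have := q2; lra. Qed.

Let A2 (i : 'I_2) := [:: A; A']`_i.
Let B2 (i : 'I_2) := [:: B; B']`_i.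
Let A4 (i : 'I_4) := [:: A; A'; B'; fun k => - B k]`_i.
Let B4 (i : 'I_4) := [:: B; B'; fun k => - A' k; A]`_i.

Let T2 := sqsum N A2 B2.
Let T4 := sqsum N A4 B4.

Let harmN X Y s t : harm N (fun k => - X k) (fun k => - Y k) s t = - harm N X Y s t.
Proof. by rewrite /harm -sumrN; apply: eq_bigr => k _; ring. Qed.

Let harm_eq X Y X' Y' s t : X =1 X' -> Y =1 Y' -> harm N X Y s t = harm N X' Y' s t.
Proof. by move=> h1 h2; apply: eq_bigr => k _; rewrite h1 h2. Qed.

Let T2E s t : T2 s t = harm N A B s t ^+ 2 + harm N A' B' s t ^+ 2.
Proof. by rewrite /T2 /sqsum !big_ord_recl big_ord0 addr0. Qed.

Let T4E s t : T4 s t = T2 s t + harm N B' (fun k => - A' k) s t ^+ 2 +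
  harm N (fun k => - B k) A s t ^+ 2.
Proof. by rewrite T2E /T4 /sqsum !big_ord_recl big_ord0 addr0 !addrA. Qed.

Let T24 s t : T2 s t <= T4 s t.
Proof. by rewrite T4E -addrA lerDl addr_ge0// sqr_ge0. Qed.

(* Cauchy-Riemann: the conjugate functions have rotated gradients. *)
Let grad4 s t : sqsum_grad N A4 B4 s t = 2 * sqsum_grad N A2 B2 s t.
Proof.
rewrite /sqsum_grad !big_ord_recl !big_ord0 /=.
have E1 : harm N (mulk B') (mulk (fun k => - A' k)) s t =
    harm N (mulk B') (fun k => - mulk A' k) s t.
  by apply: harm_eq => // k; rewrite /mulk mulrN.
have E2 : harm N (mulk (fun k => - A' k)) (fun k => - mulk B' k) s t =
    - harm N (mulk A') (mulk B') s t.
  by rewrite -harmN; apply: harm_eq => // k; rewrite /mulk mulrN.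
have E3 : harm N (mulk (fun k => - B k)) (mulk A) s t =
    - harm N (mulk B) (fun k => - mulk A k) s t.
  by rewrite -harmN; apply: harm_eq => // k; rewrite /mulk ?mulrN ?opprK.
have E4 : harm N (mulk A) (fun k => - mulk (fun k => - B k) k) s t =
    harm N (mulk A) (mulk B) s t.
  by apply: harm_eq => // k; rewrite /mulk mulrN opprK.
by rewrite E1 E2 E3 E4; ring.
Qed.

(** Cauchy-Schwarz, with the defect written out as squares by Lagrange's identity. *)
Let gradT2 s t : sqsum_s N A2 B2 s t ^+ 2 + sqsum_t N A2 B2 s t ^+ 2 <=
  4 * T2 s t * sqsum_grad N A2 B2 s t.
Proof.
rewrite T2E /sqsum_s /sqsum_t /sqsum_grad !big_ord_recl !big_ord0 /= !addr0.
set X := harm N A B s t; set Y := harm N A' B' s t.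
set Xs := harm N (mulk A) _ s t; set Ys := harm N (mulk A') _ s t.
set Xt := harm N (mulk B) _ s t; set Yt := harm N (mulk B') _ s t.
rewrite -subr_ge0 [leRHS](_ : _ = 4 * (X * Ys - Y * Xs) ^+ 2 + 4 * (X * Yt - Y * Xt) ^+ 2).
  by rewrite addr_ge0// mulr_ge0// sqr_ge0.
by ring.
Qed.

(** With [E] the gradient term of [f] and [w2 = (1 + T2) ^ (a - 1)], the Laplacian for [n = 2] is at
    least [2 a (2 a - 1) w2 E] by [gradT2], and the one for [n = 4] is at most [4 a w2 E] by [grad4]
    and [T24], its other term being nonpositive. Since [2 a - 1 = q - 1], the constant [c] balances
    the two exactly. *)
Let lap_ge0 s t : 0 <= c * (psi_ss N A2 B2 a s t + psi_tt N A2 B2 a s t) -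
  (psi_ss N A4 B4 a s t + psi_tt N A4 B4 a s t).
Proof.
rewrite !psi_laplacian grad4 -/(T2 s t) -/(T4 s t).
set E := sqsum_grad N A2 B2 s t.
have E0 : 0 <= E by apply: sumr_ge0 => i _; rewrite addr_ge0// sqr_ge0.
have := gradT2 s t; rewrite -/E.
set G2 := sqsum_s N A2 B2 s t ^+ 2 + _; set G4 := sqsum_s N A4 B4 s t ^+ 2 + _ => hG.
have G40 : 0 <= G4 by rewrite addr_ge0// sqr_ge0.
have P2 : 0 < 1 + T2 s t by exact: sqsum_gt0.
have P4 : 0 < 1 + T4 s t by exact: sqsum_gt0.
have w24 : (1 + T4 s t) `^ (a - 1) <= (1 + T2 s t) `^ (a - 1).
  rewrite -(opprB 1 a) !powRN lef_pV2 ?posrE ?powR_gt0//.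
  by apply: ge0_ler_powR; rewrite ?nnegrE ?subr_ge0 ?(ltW P2) ?(ltW P4)// lerD2l T24.
have v2 : (1 + T2 s t) * (1 + T2 s t) `^ (a - 2) = (1 + T2 s t) `^ (a - 1).
  rewrite -{1}(powRr1 (ltW P2)) -powRD; last by rewrite (gt_eqF P2) implybT.
  by congr (_ `^ _); ring.
have v20 : 0 <= (1 + T2 s t) `^ (a - 2) by exact: powR_ge0.
have v40 : 0 <= (1 + T4 s t) `^ (a - 2) by exact: powR_ge0.
move: v2 w24 v20 v40.
set v2 := (1 + T2 s t) `^ (a - 2); set v4 := (1 + T4 s t) `^ (a - 2).
set w2 := (1 + T2 s t) `^ (a - 1); set w4 := (1 + T4 s t) `^ (a - 1) => vw w24 v20 v40.
have t20 : 0 <= T2 s t by exact: sqsum_ge0.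
have h4 : a * (a - 1) * v4 * G4 <= 0.
  by rewrite mulr_le0_ge0// mulr_le0_ge0// mulr_ge0_le0 ?(ltW a0) ?subr_le0.
have h2 : a * (a - 1) * v2 * (4 * T2 s t * E) <= a * (a - 1) * v2 * G2.
  by apply: ler_wnM2l hG; rewrite mulr_le0_ge0// mulr_ge0_le0 ?(ltW a0) ?subr_le0.
have h3 : a * (a - 1) * w2 * (4 * E) <= a * (a - 1) * v2 * (4 * T2 s t * E).
  rewrite -vw -subr_ge0.
  rewrite [leRHS](_ : _ = - (a * (a - 1)) * (4 * (v2 * E))); last by ring.
  by rewrite mulr_ge0 ?mulr_ge0// oppr_ge0 mulr_ge0_le0 ?(ltW a0) ?subr_le0.
have c0 : 0 <= c by apply: le_trans c2.
have ca : c * (2 * a - 1) = 2.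
  by rewrite /c /a; field; rewrite subr_eq0 gt_eqF.
have key : 4 * a * w2 * E <= c * (a * (a - 1) * v2 * G2 + 2 * a * w2 * E).
  rewrite (_ : 4 * a * w2 * E = c * (a * (a - 1) * w2 * (4 * E) + 2 * a * w2 * E)).
    by rewrite ler_wpM2l// lerD2r (le_trans h3).
  have -> : 4 * a * w2 * E = 2 * (2 * a * w2 * E) by ring.
  have -> : c * (a * (a - 1) * w2 * (4 * E) + 2 * a * w2 * E) =
      c * (2 * a - 1) * (2 * a * w2 * E) by ring.
  by rewrite ca.
have h5 : 4 * a * w4 * E <= 4 * a * w2 * E.
  by rewrite ler_wpM2r// ler_wpM2l// mulr_ge0// ltW.
rewrite subr_ge0; apply: le_trans key.
rewrite (_ : 2 * a * w4 * (2 * E) = 4 * a * w4 * E); last by ring.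
by apply: le_trans h5; rewrite gerDr.
Qed.

(** [s] is the logarithm of the radius; [W] and [Z] are the first and second derivatives of [V]. *)
Let V s := c * \int[mu]_(t in D) psi N A2 B2 a s t - \int[mu]_(t in D) psi N A4 B4 a s t.
Let W s := c * \int[mu]_(t in D) psi_s N A2 B2 a s t - \int[mu]_(t in D) psi_s N A4 B4 a s t.
Let Z s := c * \int[mu]_(t in D) psi_ss N A2 B2 a s t - \int[mu]_(t in D) psi_ss N A4 B4 a s t.

Let s_bound n (X Y : 'I_n -> nat -> R) s t : s <= 1 ->
  `|psi_s N X Y a s t| <= expR N%:R ^+ 2 * sqb N X Y.
Proof. by move=> s1; apply: psi_s_le => // *; exact: harm_le1. Qed.

Let V_W s : s < 1 -> isd V s (W s).
Proof.
move=> s1; have uv : s - 1 < s < 1 by apply/andP; split => //; lra.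
have dI n (X Y : 'I_n -> nat -> R) :
  isd (fun s => \int[mu]_(t in D) psi N X Y a s t) s (\int[mu]_(t in D) psi_s N X Y a s t).
  apply: (@isd_integral R _ _ (s - 1) 1 (expR N%:R ^+ 2 * sqb N X Y)) => //.
  - by move=> s' _; exact: psi_continuous.
  - by move=> s' t _; exact: psi_ds.
  - by move=> s' t /andP[_ /ltW]; exact: s_bound.
have := isdD (isdZ c (dI 2 A2 B2)) (isdZ (-1) (dI 4 A4 B4)).
rewrite mulN1r; move/isd_eq => /(_ _ erefl); congr is_derive.
by apply/funext => y; rewrite mulN1r.
Qed.

Let W_Z s : s < 1 -> isd W s (Z s).
Proof.
move=> s1; have uv : s - 1 < s < 1 by apply/andP; split => //; lra.
have dI n (X Y : 'I_n -> nat -> R) :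
  isd (fun s => \int[mu]_(t in D) psi_s N X Y a s t) s (\int[mu]_(t in D) psi_ss N X Y a s t).
  have [M hM] := psi_ss_le N X Y a0 a1.
  apply: (@isd_integral R _ _ (s - 1) 1 M) => //.
  - by move=> s' _; exact: psi_s_continuous.
  - by move=> s' t _; exact: psi_s_ds.
  - by move=> s' t /andP[_ /ltW]; exact: hM.
have := isdD (isdZ c (dI 2 A2 B2)) (isdZ (-1) (dI 4 A4 B4)).
rewrite mulN1r; move/isd_eq => /(_ _ erefl); congr is_derive.
by apply/funext => y; rewrite mulN1r.
Qed.

Let Z_ge0 s : 0 <= Z s.
Proof.
have ii n (X Y : 'I_n -> nat -> R) :=
  integrable_Tdom_continuous (@psi_ss_continuous n N X Y a s).
have ij n (X Y : 'I_n -> nat -> R) :=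
  integrable_Tdom_continuous (@psi_tt_continuous n N X Y a s).
have E n (X Y : 'I_n -> nat -> R) : \int[mu]_(t in D) psi_ss N X Y a s t =
    \int[mu]_(t in D) (psi_ss N X Y a s t + psi_tt N X Y a s t).
  by rewrite (RintegralD (@measurable_Tdom R) (ii n X Y) (ij n X Y)) int_psi_tt addr0.
have ik n (X Y : 'I_n -> nat -> R) : mu.-integrable D
    (EFin \o (fun t => psi_ss N X Y a s t + psi_tt N X Y a s t)).
  exact: (integrableD (@measurable_Tdom R) (ii n X Y) (ij n X Y)).
rewrite /Z !E subr_ge0 -(RintegralZl _ (@measurable_Tdom R) (ik 2 A2 B2)).
apply: le_Rintegral.
- exact: measurable_Tdom.
- exact: ik.
- exact: (integrableZl (@measurable_Tdom R) c (ik 2 A2 B2)).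
- by move=> t _; rewrite -subr_ge0 lap_ge0.
Qed.

Let W_small s : s <= 0 -> `|W s| <= expR s * (2 * pi * (c * sqb N A2 B2 + sqb N A4 B4)).
Proof.
move=> s0.
have c0 : 0 <= c by apply: le_trans c2.
have bI n (X Y : 'I_n -> nat -> R) : `|\int[mu]_(t in D) psi_s N X Y a s t| <=
    expR s * (2 * pi * sqb N X Y).
  have ii := integrable_Tdom_continuous (@psi_s_continuous n N X Y a s).
  apply: (le_trans (le_normr_Rintegral (@measurable_Tdom R) ii)).
  have -> : expR s * (2 * pi * sqb N X Y) = \int[mu]_(t in D) (expR s * sqb N X Y).
    rewrite (Rintegral_cst mu (@measurable_Tdom R)) [X in fine X]mu_Tdom /=.
    by ring.
  apply: le_Rintegral; [exact: measurable_Tdom|exact: integrable_norm|exact: integrable_cst_Tdom|].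
  move=> t _ /=; apply: (@le_trans _ _ (expR s ^+ 2 * sqb N X Y)).
    by apply: psi_s_le => // X' Y'; exact: harm_le_exp.
  have sq0 : 0 <= sqb N X Y.
    by apply: sumr_ge0 => i _; rewrite !mulr_ge0// hbound_ge0.
  by rewrite ler_wpM2r// expr2 ler_piMl ?expR_ge0// -expR0 ler_expR.
apply: (le_trans (ler_normB _ _)); rewrite normrM (ger0_norm c0).
rewrite [leRHS](_ : _ = c * (expR s * (2 * pi * sqb N A2 B2)) +
  expR s * (2 * pi * sqb N A4 B4)); last by ring.
by apply: lerD => //; exact: ler_wpM2l.
Qed.

(** [W] is nondecreasing and, by [W_small], tends to 0 at the centre. *)
Let W_ge0 s : s < 1 -> 0 <= W s.
Proof.
move=> s1; apply/ler_addgt0Pr => e e0; rewrite -lerBlDr sub0r.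
pose K := 2 * pi * (c * sqb N A2 B2 + sqb N A4 B4).
have K0 : 0 <= `|K| + 1 by rewrite addr_ge0.
have K1 : 0 < `|K| + 1 by rewrite ltr_pwDr.
(* Far enough towards the centre for the bound of [W_small] to fall below [e]. *)
pose r := Num.min (Num.min s 0) (ln (e / (`|K| + 1))).
have [rs r0] : r <= s /\ r <= 0 by rewrite /r !ge_min !lexx ?orbT.
have re : expR r * (`|K| + 1) <= e.
  rewrite -ler_pdivlMr// -[leRHS]lnK ?posrE ?divr_gt0// ler_expR.
  by rewrite /r ge_min lexx orbT.
apply: (@le_trans _ _ (W r)); last first.
  apply: (isd_nondecreasing (u := r - 1) (v := 1) (df := Z)).
  - by move=> x /andP[_ x1]; exact: W_Z.
  - by move=> x _; exact: Z_ge0.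
  - by rewrite ltrBlDr ltrDl.
  - exact: rs.
  - exact: s1.
have := W_small r0; rewrite ler_norml => /andP[+ _]; apply: le_trans.
rewrite lerN2; apply: le_trans re; rewrite ler_wpM2l ?expR_ge0//.
by rewrite (le_trans (ler_norm _))// lerDl.
Qed.

(** The limit at the centre is replaced by one radius [1 / K], so small that [T4 <= 1] on its
    circle: there [psi] is at most 2 for [n = 4] and at least 1 for [n = 2], and [2 <= c]. *)
Let V_ge0 : 0 <= V 0.
Proof.
pose K := hbound N A B ^+ 2 + hbound N A' B' ^+ 2 +
  hbound N B' (fun k => - A' k) ^+ 2 + hbound N (fun k => - B k) A ^+ 2 + 1.
have K1 : 1 <= K.
  by rewrite /K lerDr !addr_ge0// sqr_ge0.
have K0 : 0 < K by exact: lt_le_trans K1.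
pose r := - ln K.
have r0 : r <= 0 by rewrite oppr_le0 ln_ge0.
have eK : expR r * K = 1 by rewrite expRN lnK ?posrE// mulVf// gt_eqF.
apply: (@le_trans _ _ (V r)); last first.
  apply: (isd_nondecreasing (u := r - 1) (v := 1) (df := W)).
  - by move=> x /andP[_ x1]; exact: V_W.
  - by move=> x /andP[_ x1]; exact: W_ge0.
  - by rewrite ltrBlDr ltrDl.
  - exact: r0.
  - exact: ltr01.
have ip n (X Y : 'I_n -> nat -> R) :=
  integrable_Tdom_continuous (@psi_continuous n N X Y a r).
rewrite /V subr_ge0 -(RintegralZl _ (@measurable_Tdom R) (ip 2 A2 B2)).
apply: le_Rintegral.
- exact: measurable_Tdom.
- exact: ip.
- exact: (integrableZl (@measurable_Tdom R) c (ip 2 A2 B2)).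
move=> t _.
have h1 : 1 <= psi N A2 B2 a r t.
  rewrite /psi -[leLHS](powRr0 (1 + sqsum N A2 B2 r t)).
  by apply: ler_powR; [rewrite lerDl sqsum_ge0|exact: ltW].
have h4 : psi N A4 B4 a r t <= 1 + T4 r t.
  apply: ler1_powR => //; by rewrite lerDl sqsum_ge0.
have er0 : 0 <= expR r <= 1 by rewrite expR_ge0 -[X in _ <= X]expR0 ler_expR.
have T41 : T4 r t <= 1.
  have sq X Y : harm N X Y r t ^+ 2 <= expR r * hbound N X Y ^+ 2.
    have hb := harm_le_exp N X Y t r0.
    apply: (@le_trans _ _ ((expR r * hbound N X Y) ^+ 2)).
      rewrite -(real_normK (num_real _)) lerXn2r ?nnegrE//.
      by rewrite mulr_ge0 ?expR_ge0 ?hbound_ge0.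
    rewrite exprMn ler_wpM2r ?sqr_ge0// expr2 ler_piMl//; by case/andP: er0.
  rewrite T4E T2E -eK /K; have := sq A B; have := sq A' B'.
  have := sq B' (fun k => - A' k); have := sq (fun k => - B k) A.
  have := expR_ge0 r.
  set E := expR r; rewrite !mulrDr mulr1; lra.
apply: (le_trans h4); apply: (@le_trans _ _ (c * 1)); last first.
  by rewrite ler_wpM2l// (le_trans _ c2).
by rewrite mulr1 (le_trans _ c2)//; lra.
Qed.

Lemma conjugate_integral_le :
  \int[mu]_(t in D) (1 + (harm N A B 0 t ^+ 2 + harm N A' B' 0 t ^+ 2 +
    harm N B' (fun k => - A' k) 0 t ^+ 2 + harm N (fun k => - B k) A 0 t ^+ 2)) `^ (q / 2) <=
  2 / (q - 1) *
    \int[mu]_(t in D) (1 + (harm N A B 0 t ^+ 2 + harm N A' B' 0 t ^+ 2)) `^ (q / 2).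
Proof.
have := V_ge0; rewrite /V subr_ge0 -/a -/c.
have -> : \int[mu]_(t in D) psi N A2 B2 a 0 t = \int[mu]_(t in D)
    (1 + (harm N A B 0 t ^+ 2 + harm N A' B' 0 t ^+ 2)) `^ a.
  by apply: eq_Rintegral => t _; rewrite -T2E.
have -> // : \int[mu]_(t in D) psi N A4 B4 a 0 t = \int[mu]_(t in D)
    (1 + (harm N A B 0 t ^+ 2 + harm N A' B' 0 t ^+ 2 +
    harm N B' (fun k => - A' k) 0 t ^+ 2 + harm N (fun k => - B k) A 0 t ^+ 2)) `^ a.
by apply: eq_Rintegral => t _; rewrite -T2E -T4E.
Qed.

End conjugate.
End Harmonic.

(** * The Riesz projection *)

Section Riesz_projection.
Variable R : realType.
Local Notation C := R[i].
Local Notation mu := (@lebesgue_measure R).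
Local Notation D := (@Tdom R).
Local Notation LS := (LS mu D).
Local Notation nrm := (nrm mu D).
Local Notation cmeas := (@cmeas _ (measurableTypeR R) R D).
Local Notation mD := (@measurable_Tdom R).
Implicit Types (f g : R -> C) (s p q : R) (m n : int) (l : seq (C * int)).

Lemma conjc0 : conjc (0 : C) = 0.
Proof. by apply/eqP; rewrite eq_complex /= oppr0 !eqxx. Qed.

Lemma conjcD (z w : C) : conjc (z + w) = conjc z + conjc w.
Proof. by case: z w => [a b] [c d]; apply/eqP; rewrite eq_complex /= opprD !eqxx. Qed.

Lemma conjcM (z w : C) : conjc (z * w) = conjc z * conjc w.
Proof.
case: z w => [a b] [c d]; apply/eqP; rewrite eq_complex /=.
by apply/andP; split; apply/eqP; ring.
Qed.

Lemma conjcK (z : C) : conjc (conjc z) = z.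
Proof. by case: z => a b; rewrite /= opprK. Qed.

Lemma conjc_sum (I : Type) (r : seq I) (F : I -> C) :
  conjc (\sum_(i <- r) F i) = \sum_(i <- r) conjc (F i).
Proof. by elim/big_ind2: _ => [|x1 x2 y1 y2 <- <-|//]; [exact: conjc0|exact: conjcD]. Qed.

Definition tsum l (x : R) : C := \sum_(u <- l) u.1 * ex u.2 x.

Definition tproj l := tsum [seq u <- l | 0 <= u.2].

Lemma tsum_trigpoly l : trigpoly (tsum l).
Proof. by exists l. Qed.

Lemma trigpoly_tsum f : trigpoly f -> exists l, f = tsum l.
Proof. by move=> [l fl]; exists l; exact/funext. Qed.

Lemma fc_tsum l n : fc (tsum l) n = \sum_(u <- l) u.1 * (u.2 == n)%:R.
Proof.
have ce k : cint (@ex R k) by apply: trigpoly_cint; exact: trigpoly_ex.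
rewrite fc_sum; last by move=> u; exact: cintZ.
by apply: eq_bigr => u _; rewrite fcZ// fc_of_ex.
Qed.

Lemma fc_tproj l n : fc (tproj l) n = if 0 <= n then fc (tsum l) n else 0.
Proof.
rewrite !fc_tsum big_filter; case: ifP => n0.
  rewrite big_mkcond; apply: eq_bigr => u _; case: ifP => // u0.
  by case: eqP => [un|_]; rewrite ?mulr0//; move: n0; rewrite -un u0.
rewrite big1// => u u0; case: eqP => [un|_]; rewrite ?mulr0//.
by move: n0; rewrite -un u0.
Qed.

Definition posp (N : nat) (al : nat -> C) (x : R) : C :=
  \sum_(k < N) al k * ex (Posz k.+1) x.

Definition negp (N : nat) (be : nat -> C) (x : R) : C :=
  \sum_(k < N) be k * ex (- Posz k.+1) x.

Lemma posp_trigpoly N al : trigpoly (posp N al).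
Proof.
exists [seq (al (val k), Posz (val k).+1) | k <- enum 'I_N] => x.
by rewrite big_map big_enum.
Qed.

Lemma negp_trigpoly N be : trigpoly (negp N be).
Proof.
exists [seq (be (val k), - Posz (val k).+1) | k <- enum 'I_N] => x.
by rewrite big_map big_enum.
Qed.

Lemma fc_posp N al n : n <= 0 -> fc (posp N al) n = 0.
Proof.
have ce k : cint (@ex R k) by apply: trigpoly_cint; exact: trigpoly_ex.
move=> n0; rewrite fc_sum; last by move=> u; exact: cintZ.
apply: big1 => k _; rewrite fcZ// fc_of_ex; case: eqP => [kn|]; rewrite ?mulr0//.
by move: n0; rewrite -kn.
Qed.

Lemma fc_negp N be n : 0 <= n -> fc (negp N be) n = 0.
Proof.
have ce k : cint (@ex R k) by apply: trigpoly_cint; exact: trigpoly_ex.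
move=> n0; rewrite fc_sum; last by move=> u; exact: cintZ.
apply: big1 => k _; rewrite fcZ// fc_of_ex; case: eqP => [kn|]; rewrite ?mulr0//.
by move: n0; rewrite -kn.
Qed.

(** Stating the identity for all [M >= N] lets the induction enlarge the range when a new frequency
    comes in. *)
Lemma tsum_split l : exists c al be (N : nat), forall M, (N <= M)%N ->
  forall x, tsum l x = c + posp M al x + negp M be x.
Proof.
elim: l => [|[c n] l [c0 [al [be [N H]]]]].
  exists 0, (fun=> 0), (fun=> 0), 0%N => M _ x.
  rewrite /tsum big_nil /posp /negp !big1 ?addr0// => k _; by rewrite mul0r.
have upd (M k : nat) (ga : nat -> C) (e : nat -> C) : (k < M)%N ->
    \sum_(j < M) (ga j + (if val j == k then c else 0)) * e j =
    \sum_(j < M) ga j * e j + c * e k.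
  move=> kM; under eq_bigr do rewrite mulrDl.
  rewrite big_split; congr (_ + _); rewrite /= (bigD1 (Ordinal kM))//= eqxx.
  rewrite big1 ?addr0// => j; rewrite -val_eqE /= => /negbTE ->; exact: mul0r.
case: n => [[|k]|k].
- exists (c0 + c), al, be, N => M NM x.
  by rewrite /tsum big_cons -/(tsum l x) (H M NM) /= ex0; ring.
- exists c0, (fun j => al j + (if j == k then c else 0)), be, (maxn N k.+1) => M.
  rewrite geq_max => /andP[NM kM] x.
  rewrite /tsum big_cons -/(tsum l x) (H M NM) /posp (upd M k al (fun j => ex (Posz j.+1) x))//=.
  by ring.
- exists c0, al, (fun j => be j + (if j == k then c else 0)), (maxn N k.+1) => M.
  rewrite geq_max => /andP[NM kM] x.
  rewrite /tsum big_cons -/(tsum l x) (H M NM) /negp (upd M k be (fun j => ex (- Posz j.+1) x))//=.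
  by rewrite NegzE; ring.
Qed.

Section exponent_le2.
Variable q : R.
Hypotheses (q1 : 1 < q) (q2 : q <= 2).

Let q0 : 0 < q. Proof. exact: lt_trans q1. Qed.
(** [2 / (q - 1)] is the constant of [conjugate_integral_le], the other factor 2 that of
    [powR_half_le], and [2 * pi + 1] bounds the integral of [1 + |f|^q] for [f] of norm at most
    1. *)
Let K : R := 4 / (q - 1) * (2 * pi + 1).
Let K0 : 0 <= K.
Proof.
have h : 0 <= q - 1 by rewrite subr_ge0 ltW.
have hp := pi_gt0 R.
by rewrite mulr_ge0// ?divr_ge0//; lra.
Qed.

Let exE k (x : R) : ex (Posz k.+1) x = Complex (cos (k.+1%:R * x)) (sin (k.+1%:R * x)).
Proof. by []. Qed.

Let exNE k (x : R) : ex (- Posz k.+1) x = Complex (cos (k.+1%:R * x)) (- sin (k.+1%:R * x)).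
Proof. by rewrite -conj_ex. Qed.

Let powR_half_le (y : R) : 0 <= y -> (1 + y ^+ 2) `^ (q / 2) <= 2 * (1 + y `^ q).
Proof.
move=> y0; have half1 : 2 `^ (q / 2) <= 2 :> R.
  by rewrite -[leRHS](@powRr1 _ 2)//; apply: ler_powR; rewrite ?ler1n// ler_pdivrMr// mul1r.
have yq : y `^ q = (y ^+ 2) `^ (q / 2).
  rewrite -(powR_mulrn 2 y0) -powRrM; congr (_ `^ _).
  by rewrite mulrC divfK.
have qq0 : 0 <= q / 2 by rewrite divr_ge0// ltW.
have y20 := sqr_ge0 y; have [y1|y1] := leP (y ^+ 2) 1.
  apply: (@le_trans _ _ (2 `^ (q / 2))).
    by apply: ge0_ler_powR; rewrite ?nnegrE ?addr_ge0//; lra.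
  by apply: (le_trans half1); rewrite mulrDr mulr1 lerDl mulr_ge0 ?powR_ge0.
apply: (@le_trans _ _ ((2 * y ^+ 2) `^ (q / 2))).
  by apply: ge0_ler_powR; rewrite ?nnegrE ?addr_ge0 ?mulr_ge0//; lra.
rewrite powRM// -yq; apply: ler_pM; rewrite ?powR_ge0//.
by rewrite lerDr.
Qed.

(** The summand 1 in [conjugate_integral_le] breaks homogeneity, so the norm is first normalised.
    With [g] the difference of the two parts of [f], the sum [|f|^2 + |g|^2] is twice the sum of the
    squared moduli of the parts, and so dominates that of [posp]. *)
Let posp_bound1 N al be : nrm q (fun x => posp N al x + negp N be x) <= 1 ->
  nrm q (posp N al) <= K `^ q^-1.
Proof.
have pos5 (a b c d : R) : 0 <= 1 + a ^+ 2 + b ^+ 2 + 2 * c ^+ 2 + 2 * d ^+ 2.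
  have := sqr_ge0 a; have := sqr_ge0 b; have := sqr_ge0 c; have := sqr_ge0 d.
  by move: (a ^+ 2) (b ^+ 2) (c ^+ 2) (d ^+ 2) => *; lra.
set f := fun x => _; move=> f1.
have tf : trigpoly f by apply: trigpolyD; [exact: posp_trigpoly|exact: negp_trigpoly].
have Lf := trigpoly_LS (ltW q1) tf.
(* Cosine and sine coefficients of the real part ([A], [B]) and of the imaginary part ([A'], [B'])
   of [f]. The permutation in [conjugate_integral_le] turns them into those of the difference of the
   two parts. *)
pose A k := Re (al k) + Re (be k); pose B k := Im (be k) - Im (al k).
pose A' k := Im (al k) + Im (be k); pose B' k := Re (al k) - Re (be k).
have E0 (k : nat) : k.+1%:R * 0 = 0 :> R by rewrite mulr0.
have h1 x : harm N A B 0 x = Re (posp N al x) + Re (negp N be x).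
  rewrite /harm /posp /negp !cRe_sum -big_split; apply: eq_bigr => k _.
  by rewrite mulr0 expR0 mul1r !cReM exE exNE /= /A /B; ring.
have h2 x : harm N A' B' 0 x = Im (posp N al x) + Im (negp N be x).
  rewrite /harm /posp /negp !cIm_sum -big_split; apply: eq_bigr => k _.
  by rewrite mulr0 expR0 mul1r !cImM exE exNE /= /A' /B'; ring.
have h3 x : harm N B' (fun k => - A' k) 0 x = Re (posp N al x) - Re (negp N be x).
  rewrite /harm /posp /negp !cRe_sum -sumrN -big_split; apply: eq_bigr => k _.
  by rewrite mulr0 expR0 mul1r !cReM exE exNE /= /A' /B'; ring.
have h4 x : harm N (fun k => - B k) A 0 x = Im (posp N al x) - Im (negp N be x).
  rewrite /harm /posp /negp !cIm_sum -sumrN -big_split; apply: eq_bigr => k _.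
  by rewrite mulr0 expR0 mul1r !cImM exE exNE /= /A /B; ring.
have main := @conjugate_integral_le R N A B A' B' q q1 q2.
have ce (k : nat) (g : R -> R) : continuous g -> continuous (fun x => g x ^+ k).
  move=> cg x; apply: (@continuous_comp _ _ _ g (fun y => y ^+ k)); first exact: cg.
  exact: exprn_continuous.
have LP := trigpoly_LS (ltW q1) (posp_trigpoly N al).
have i0 X Y : continuous (harm N X Y 0).
  by apply: isd_continuous => t; eexists; exact: harm_dt.
have ic (g : R -> R) : continuous g -> (forall x, 0 <= g x) ->
    mu.-integrable D (EFin \o (fun x => (1 + g x) `^ (q / 2))).
  move=> cg g0; apply: integrable_Tdom_continuous => x.
  have cp : {for 1 + g x, continuous (fun y : R => y `^ (q / 2))}.
    apply: differentiable_continuous; apply/derivable1_diffP.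
    by apply: derivable_powR; rewrite in_itv/= ltr_pwDl.
  apply: (@continuous_comp _ _ _ (fun x => 1 + g x) (fun y => y `^ (q / 2))) => //.
  by apply: cvgD; [exact: cvg_cst|exact: cg].
have i1 : mu.-integrable D (EFin \o (fun x => (1 + (harm N A B 0 x ^+ 2 + harm N A' B' 0 x ^+ 2 +
    harm N B' (fun k => - A' k) 0 x ^+ 2 + harm N (fun k => - B k) A 0 x ^+ 2)) `^ (q / 2))).
  apply: (ic (fun x => (harm N A B 0 x ^+ 2 + harm N A' B' 0 x ^+ 2 +
    harm N B' (fun k => - A' k) 0 x ^+ 2 + harm N (fun k => - B k) A 0 x ^+ 2))).
    by move=> x; repeat apply: cvgD; exact: ce.
  by move=> x; rewrite !addr_ge0// sqr_ge0.
have i2 : mu.-integrable D (EFin \o (fun x => (1 + (harm N A B 0 x ^+ 2 + harm N A' B' 0 x ^+ 2)) `^ (q / 2))).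
  apply: (ic (fun x => (harm N A B 0 x ^+ 2 + harm N A' B' 0 x ^+ 2))).
    by move=> x; repeat apply: cvgD; exact: ce.
  by move=> x; rewrite !addr_ge0// sqr_ge0.
have ipq g : LS q g -> mu.-integrable D (EFin \o (fun x => cabs (g x) `^ q)).
  move=> [mg Lg]; apply/integrableP; split.
    by apply/measurable_EFinP; exact: measurable_cabs_powR.
  by under eq_integral do rewrite /= ger0_norm ?powR_ge0//.
have N1 : nrm q (posp N al) `^ q = \int[mu]_(x in D) cabs (posp N al x) `^ q.
  by rewrite /Rintegral (nrm_powR q0 LP).
have N2 : nrm q f `^ q = \int[mu]_(x in D) cabs (f x) `^ q.
  by rewrite /Rintegral (nrm_powR q0 Lf).
have le1 : nrm q (posp N al) `^ q <= \int[mu]_(x in D) (1 + (harm N A B 0 x ^+ 2 +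
    harm N A' B' 0 x ^+ 2 + harm N B' (fun k => - A' k) 0 x ^+ 2 +
    harm N (fun k => - B k) A 0 x ^+ 2)) `^ (q / 2).
  rewrite N1; apply: (le_Rintegral mD (ipq _ LP) i1) => x _.
  have -> : cabs (posp N al x) `^ q = (cabs (posp N al x) ^+ 2) `^ (q / 2).
    rewrite -(powR_mulrn 2 (cabs_ge0 _)) -powRrM; congr (_ `^ _).
    by rewrite mulrC divfK.
  apply: ge0_ler_powR; rewrite ?nnegrE ?sqr_ge0 ?divr_ge0 ?(ltW q0)//.
    by rewrite !addr_ge0// sqr_ge0.
  rewrite cabs2 h1 h2 h3 h4 -subr_ge0.
  set a := Re (posp N al x); set b := Im (posp N al x).
  set c := Re (negp N be x); set d := Im (negp N be x).
  rewrite [leRHS](_ : _ = 1 + a ^+ 2 + b ^+ 2 + 2 * c ^+ 2 + 2 * d ^+ 2); last by ring.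
  exact: pos5.
have le2 : \int[mu]_(x in D) (1 + (harm N A B 0 x ^+ 2 + harm N A' B' 0 x ^+ 2)) `^ (q / 2) <=
    2 * (2 * pi + nrm q f `^ q).
  have iub : mu.-integrable D (EFin \o (fun x => 2 * (1 + cabs (f x) `^ q))).
    have := integrableZl mD 2 (integrableD mD (integrable_cst_Tdom (1 : R)) (ipq _ Lf)).
    by [].
  have -> : 2 * (2 * pi + nrm q f `^ q) = \int[mu]_(x in D) (2 * (1 + cabs (f x) `^ q)).
    have i3 : mu.-integrable D (EFin \o (fun x => 1 + cabs (f x) `^ q)).
      exact: (integrableD mD (integrable_cst_Tdom (1 : R)) (ipq _ Lf)).
    rewrite (RintegralZl _ mD i3) (RintegralD mD (integrable_cst_Tdom (1 : R)) (ipq _ Lf)) -N2.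
    by rewrite (Rintegral_cst mu mD) [X in fine X]mu_Tdom /= mul1r.
  apply: (le_Rintegral mD i2 iub) => x _.
  have -> : harm N A B 0 x ^+ 2 + harm N A' B' 0 x ^+ 2 = cabs (f x) ^+ 2.
    by rewrite h1 h2 cabs2 /f cReD cImD.
  exact: powR_half_le (cabs_ge0 _).
have f1q : nrm q f `^ q <= 1.
  rewrite [leRHS](_ : 1 = 1 `^ q); last by rewrite powR1.
  apply: ge0_ler_powR; rewrite ?nnegrE ?nrm_ge0 ?(ltW q0)//.
have PK : nrm q (posp N al) `^ q <= K.
  apply: (le_trans le1); apply: (le_trans main).
  apply: (@le_trans _ _ (2 / (q - 1) * (2 * (2 * pi + nrm q f `^ q)))).
    by rewrite ler_wpM2l// divr_ge0// subr_ge0 ltW.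
  rewrite /K [leRHS](_ : _ = 2 / (q - 1) * (2 * (2 * pi + 1))); last by ring.
  rewrite ler_wpM2l//; first by rewrite divr_ge0// subr_ge0 ltW.
  by rewrite ler_wpM2l// lerD2l.
have {1}-> : nrm q (posp N al) = (nrm q (posp N al) `^ q) `^ q^-1.
  by rewrite -powRrM mulfV ?gt_eqF// powRr1// nrm_ge0.
by apply: ge0_ler_powR; rewrite ?nnegrE ?invr_ge0 ?powR_ge0 ?(ltW q0).
Qed.

Let posp_bound N al be :
  nrm q (posp N al) <= K `^ q^-1 * nrm q (fun x => posp N al x + negp N be x).
Proof.
set f := fun x => _.
have tf : trigpoly f by apply: trigpolyD; [exact: posp_trigpoly|exact: negp_trigpoly].
have Lf := trigpoly_LS (ltW q1) tf.
have LP := trigpoly_LS (ltW q1) (posp_trigpoly N al).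
have c0 : 0 <= K `^ q^-1 by exact: powR_ge0.
apply/ler_addgt0Pr => e e0.
(* The added term keeps [r] positive when [f] has norm 0, and contributes at most [e] after
   multiplication by the constant. *)
pose r := nrm q f + e / (K `^ q^-1 + 1).
have r0 : 0 < r by rewrite ltr_wpDl ?nrm_ge0// divr_gt0// ltr_wpDl.
pose z : C := (r^-1)%:C%C.
have cz : cabs z = r^-1 by rewrite cabs_real ger0_norm// invr_ge0 ltW.
have Ep x : posp N (fun k => z * al k) x = z * posp N al x.
  by rewrite /posp mulr_sumr; apply: eq_bigr => k _; rewrite mulrA.
have En x : negp N (fun k => z * be k) x = z * negp N be x.
  by rewrite /negp mulr_sumr; apply: eq_bigr => k _; rewrite mulrA.
have [_ nf] := LSZ mD z q0 Lf; have [_ nP] := LSZ mD z q0 LP.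
have := @posp_bound1 N (fun k => z * al k) (fun k => z * be k) _.
have -> : nrm q (posp N (fun k => z * al k)) = nrm q (fun x => z * posp N al x).
  by apply: eq_nrm => x _; rewrite Ep.
have -> : nrm q (fun x => posp N (fun k => z * al k) x + negp N (fun k => z * be k) x) =
    nrm q (fun x => z * f x).
  by apply: eq_nrm => x _; rewrite Ep En mulrDr.
rewrite nf nP cz => H.
have : r^-1 * nrm q (posp N al) <= K `^ q^-1.
  by apply: H; rewrite mulrC ler_pdivrMr// mul1r /r lerDl divr_ge0 ?(ltW e0)// addr_ge0.
rewrite mulrC ler_pdivrMr// => h; apply: (le_trans h).
rewrite /r mulrDr lerD2l mulrCA ger_pMr// ler_pdivrMr ?mul1r ?lerDl//.
by rewrite ltr_wpDl.
Qed.

Lemma riesz_trig_le2 : exists2 c : R, 0 <= c &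
  forall l, nrm q (tproj l) <= c * nrm q (tsum l).
Proof.
pose c1 := K `^ q^-1; have c10 : 0 <= c1 by exact: powR_ge0.
pose n1 := nrm q (fun=> 1); have n10 : 0 <= n1 by exact: nrm_ge0.
(* [c1 * (1 + Kav q * n1)] accounts for the positive frequencies of the function without its mean,
   and [Kav q * n1] for the mean. *)
exists (c1 + (c1 + 1) * (Kav q * n1)).
  by rewrite addr_ge0// mulr_ge0 ?addr_ge0// mulr_ge0// Kav_ge0.
move=> l; have [c [al [be [N H]]]] := tsum_split l.
have {}H x := H N (leqnn N) x.
have tt := tsum_trigpoly l; have Lt := trigpoly_LS (ltW q1) tt.
have ct : cint (tsum l) by exact: trigpoly_cint.
have tp := posp_trigpoly N al; have tn := negp_trigpoly N be.
have Lp := trigpoly_LS (ltW q1) tp.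
have tc := @trigpoly_cst R c; have Lc := trigpoly_LS (ltW q1) tc.
have fcc n : fc (fun=> c) n = c * (0 == n)%:R.
  rewrite (eq_fc (g := fun x => c * ex 0 x)); last by move=> x _; rewrite ex0 mulr1.
  by rewrite fcZ ?fc_of_ex//; apply: trigpoly_cint; exact: trigpoly_ex.
have fE n : fc (tsum l) n = c * (0 == n)%:R + fc (posp N al) n + fc (negp N be) n.
  have -> : tsum l = (fun x => (c + posp N al x) + negp N be x) by exact/funext.
  rewrite fcD ?fcD ?fcc//; try exact: trigpoly_cint.
  by apply: trigpoly_cint; exact: trigpolyD.
have cE : c = fc (tsum l) 0 by rewrite fE fc_posp// fc_negp// eqxx mulr1 !addr0.
have ccp : cabs c <= Kav q * nrm q (tsum l) by rewrite cE; exact: (fc_nrm 0 q1 Lt).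
have [Lcp ncp] := LSD mD (ltW q1) Lc Lp.
have E : nrm q (tproj l) = nrm q (fun x => c + posp N al x).
  have Lj := trigpoly_LS (ltW q1) (tsum_trigpoly [seq u <- l | 0 <= u.2]).
  apply: (LS_ae mD q0 Lcp Lj.1 _).2; apply: (fc_inj q1 Lj Lcp) => n.
  rewrite fc_tproj fcD ?fcc; try exact: trigpoly_cint.
  case: ifP => n0; first by rewrite fE fc_negp// addr0.
  rewrite fc_posp; last by rewrite leNgt; apply/negP => /ltW; rewrite n0.
  by case: eqP => [n0'|]; rewrite ?mulr0 ?addr0//; move: n0; rewrite -n0'.
have ncst : nrm q (fun=> c) <= cabs c * n1.
  have [_] := LSZ mD c q0 (LS_cst 1 q0).
  by rewrite (eq_nrm mu q (g := fun=> c)) => [->//|x _]; rewrite mulr1.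
rewrite E; apply: (le_trans ncp).
have h1 : nrm q (posp N al) <= c1 * (nrm q (tsum l) + nrm q (fun=> c)).
  apply: (le_trans (posp_bound N al be)); apply: ler_wpM2l => //.
  have [_] := LSB mD (ltW q1) Lt Lc; apply: le_trans; rewrite le_eqVlt; apply/orP; left.
  by apply/eqP; apply: eq_nrm => x _; rewrite H; ring.
have h2 : nrm q (fun=> c) <= Kav q * n1 * nrm q (tsum l).
  by apply: (le_trans ncst); rewrite mulrAC ler_wpM2r.
set T := nrm q (tsum l); rewrite [leRHS](_ : _ = Kav q * n1 * T +
  c1 * (T + Kav q * n1 * T)); last by rewrite /T; ring.
apply: lerD => //; apply: (le_trans h1); apply: ler_wpM2l => //.
by rewrite lerD2l.
Qed.

End exponent_le2.

Lemma pairing_tsum f l : cint f ->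
  av (fun x => f x * conjc (tsum l x)) = \sum_(u <- l) conjc u.1 * fc f u.2.
Proof.
move=> cf; rewrite (eq_av (g := fun x => \sum_(u <- l) conjc u.1 * (f x * ex (- u.2) x))).
  rewrite av_sum; last by move=> u; apply: cintZ; exact: cint_mul_ex.
  apply: eq_bigr => u _; rewrite avZ ?fc_ex//; exact: cint_mul_ex.
move=> x _; rewrite /tsum conjc_sum mulr_sumr; apply: eq_bigr => u _.
by rewrite conjcM conj_ex; ring.
Qed.

Lemma pairing_tproj l r : av (fun x => tproj l x * conjc (tsum r x)) =
  av (fun x => tsum l x * conjc (tproj r x)).
Proof.
rewrite !pairing_tsum; try by apply: trigpoly_cint; exact: tsum_trigpoly.
rewrite big_filter [RHS]big_mkcond; apply: eq_bigr => u _.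
by rewrite fc_tproj; case: ifP => // _; rewrite mulr0.
Qed.

Lemma trigpoly_conj f : trigpoly f -> trigpoly (fun x => conjc (f x)).
Proof.
elim/trigpoly_ind => [|c n g _ IH].
  by under eq_fun do rewrite conjc0; exact: trigpoly_cst.
under eq_fun do rewrite conjcD conjcM conj_ex.
by apply: trigpolyD => //; apply: trigpolyZ; exact: trigpoly_ex.
Qed.

Lemma nrm_conj s f : nrm s (fun x => conjc (f x)) = nrm s f.
Proof.
by rewrite !nrmE; under eq_integral do rewrite cabs_conj.
Qed.

Lemma conjexK s : 1 < s -> conjex (conjex s) = s.
Proof. by move=> s1; rewrite /conjex invrK opprB addrC subrK invrK. Qed.

(** By [pairing_tproj] the projection is self-adjoint, so the bound for [conjex s <= 2] passes to
    [s > 2]; [2 * pi] and [pi^-1] come from [nrm_le_test] and [hoelder_av]. *)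
Lemma riesz_trig s : 1 < s -> exists2 c : R, 0 <= c &
  forall l, nrm s (tproj l) <= c * nrm s (tsum l).
Proof.
move=> s1; have [s2|s2] := leP s 2; first exact: riesz_trig_le2.
have [s0 c1 sc] := conjexP s1; have c0 := lt_trans ltr01 c1.
have c2 : conjex s <= 2.
  rewrite /conjex -[leRHS]invrK lef_pV2 ?posrE ?subr_gt0 ?invf_lt1//.
  have : s^-1 <= 2^-1 by rewrite lef_pV2 ?posrE// ltW.
  by lra.
have [c cge0 H] := riesz_trig_le2 c1 c2.
exists (2 * pi * (pi^-1 * c)).
  by rewrite !mulr_ge0 ?pi_ge0// invr_ge0 pi_ge0.
move=> l; have Ll := trigpoly_LS (ltW s1) (tsum_trigpoly l).
have Lp := trigpoly_LS (ltW s1) (tsum_trigpoly [seq u <- l | 0 <= u.2]).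
rewrite -mulrA; apply: (nrm_le_test s1 Lp).
  by rewrite mulr_ge0 ?nrm_ge0// mulr_ge0// invr_ge0 pi_ge0.
move=> g tg; have [r gr] := trigpoly_tsum (trigpoly_conj tg).
have -> : av (fun x => tsum [seq u <- l | 0 <= u.2] x * g x) =
    av (fun x => tsum l x * conjc (tproj r x)).
  rewrite -pairing_tproj; apply: eq_av => x _; congr (_ * _).
  by have /(congr1 (fun h => h x)) <- := gr; rewrite conjcK.
have Lr := trigpoly_LS (ltW c1) (trigpoly_conj (tsum_trigpoly [seq u <- r | 0 <= u.2])).
apply: (le_trans (hoelder_av s0 c0 sc Ll Lr)).
rewrite nrm_conj -(nrm_conj _ g) gr.
rewrite -!mulrA ler_wpM2l ?invr_ge0 ?pi_ge0// [X in _ <= X]mulrCA ler_wpM2l ?nrm_ge0//.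
exact: H.
Qed.

Lemma tsumD l r x : tsum (l ++ r) x = tsum l x + tsum r x.
Proof. by rewrite /tsum big_cat. Qed.

Definition topp l : seq (C * int) := [seq (- u.1, u.2) | u <- l].

Lemma tsumN l x : tsum (topp l) x = - tsum l x.
Proof.
by rewrite /tsum big_map -sumrN; apply: eq_bigr => u _; rewrite mulNr.
Qed.

Lemma tprojB l r x : tproj (l ++ topp r) x = tproj l x - tproj r x.
Proof.
rewrite /tproj filter_cat tsumD; congr (_ + _).
by rewrite -tsumN /topp filter_map.
Qed.

(** Extension by density: polynomials at distance [2^-k] from [f] have projections that form a
    Cauchy sequence, and Fourier coefficients are continuous in the norm. *)
Lemma riesz_projection s : 1 < s -> exists2 c : R, 0 <= c &
  forall f, LS s f -> exists h, [/\ LS s h,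
    forall n, fc h n = if 0 <= n then fc f n else 0 & nrm s h <= c * nrm s f].
Proof.
move=> s1; have [c c0 H] := riesz_trig s1; exists c => // f Lf.
have [s0 _ _] := conjexP s1; have s1' := ltW s1.
have half k : 0 < 2^-1 ^+ k :> R by rewrite exprn_gt0.
have ex_l k : {l | nrm s (fun x => f x - tsum l x) <= 2^-1 ^+ k}.
  apply: cid; have [u tu fu] := trigpoly_dense s1' (half k) Lf.
  by have [l ul] := trigpoly_tsum tu; exists l; rewrite -ul.
pose l k := projT1 (ex_l k).
have lP k : nrm s (fun x => f x - tsum (l k) x) <= 2^-1 ^+ k := projT2 (ex_l k).
have Lt r : LS s (tsum r) by apply: trigpoly_LS => //; exact: tsum_trigpoly.
have small (e : R) : 0 < e -> exists k, 2^-1 ^+ k <= e.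
  move=> e0; have c00 : (2^-1 : R) ^+ k @[k --> \oo] --> 0.
    by apply: cvg_expr; rewrite ger0_norm// invf_lt1// ltr1n.
  have /cvgr0Pnorm_le/(_ _ e0)[k _ /(_ k (leqnn k))] := c00.
  by rewrite ger0_norm; [exists k|exact: ltW].
have mono (k m : nat) : (k <= m)%N -> 2^-1 ^+ m <= 2^-1 ^+ k :> R.
  by move=> km; apply: ler_wiXn2l => //; rewrite invf_le1// ler1n.
have diff (k m : nat) : nrm s (fun x => tproj (l m) x - tproj (l k) x) <=
    c * (2^-1 ^+ m + 2^-1 ^+ k).
  have := H (l m ++ topp (l k)).
  rewrite (eq_nrm mu s (g := fun x => tproj (l m) x - tproj (l k) x)); last first.
    by move=> x _; rewrite tprojB.
  move=> h; apply: (le_trans h); apply: ler_wpM2l => //.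
  rewrite (eq_nrm mu s (g := fun x => tsum (l m) x - tsum (l k) x)); last first.
    by move=> x _; rewrite tsumD tsumN.
  apply: (nrm_triangle mD s1' (Lt _) Lf (Lt _)); last exact: lP.
  by rewrite (nrmBC mu D _ _ s0).
have [h [Lh hP]] : exists h, LS s h /\ forall e, 0 < e -> exists N, forall m : nat,
    (N <= m)%N -> nrm s (fun x => h x - tproj (l m) x) <= e.
  apply: (LS_complete mD s1' (w := fun k => tproj (l k))) => [k|e e0]; first exact: Lt.
  have [|k hk] := small (e / (2 * c + 1)).
    by rewrite divr_gt0// ltr_wpDl// mulr_ge0.
  exists k => m km; apply: (le_trans (diff k m)).
  apply: (@le_trans _ _ (2 * c * (e / (2 * c + 1)))).
    rewrite [leRHS](_ : _ = c * (e / (2 * c + 1) + e / (2 * c + 1))).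
      apply: ler_wpM2l => //; apply: lerD => //.
      exact: le_trans (mono _ _ km) hk.
    by ring.
  rewrite mulrCA ger_pMr// ler_pdivrMr ?mul1r ?lerDl//.
  by rewrite ltr_wpDl// mulr_ge0.
have limit (m : nat) : exists k, (m <= k)%N /\ nrm s (fun x => h x - tproj (l k) x) <= 2^-1 ^+ m.
  have [N hN] := hP _ (half m).
  by exists (maxn m N); rewrite leq_maxl; split => //; apply: hN; exact: leq_maxr.
exists h; split; first exact: Lh.
- move=> n; apply/eqP; rewrite -subr_eq0; apply/eqP/cabs_eq0/le_anti.
  rewrite cabs_ge0 andbT; apply/ler_addgt0Pr => e e0; rewrite add0r.
  have [|k0 hk0] := small (e / (2 * Kav s + 1)).
    by rewrite divr_gt0// ltr_wpDl// mulr_ge0// Kav_ge0.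
  have [k [k0k hk]] := limit k0.
  have c1 := LS_cint s1 Lh; have c2 r := LS_cint s1 (Lt r); have c3 := LS_cint s1 Lf.
  have e1 : cabs (fc h n - fc (tproj (l k)) n) <= Kav s * (e / (2 * Kav s + 1)).
    rewrite -fcB; [|exact: c1|exact: c2]; have [Lb _] := LSB mD s1' Lh (Lt [seq u <- l k | 0 <= u.2]).
    apply: (le_trans (fc_nrm n s1 Lb)); apply: ler_wpM2l; first exact: Kav_ge0.
    exact: le_trans hk hk0.
  have e2 : cabs (fc f n - fc (tsum (l k)) n) <= Kav s * (e / (2 * Kav s + 1)).
    rewrite -fcB; [|exact: c3|exact: c2]; have [Lb _] := LSB mD s1' Lf (Lt (l k)).
    apply: (le_trans (fc_nrm n s1 Lb)); apply: ler_wpM2l; first exact: Kav_ge0.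
    exact: le_trans (lP k) (le_trans (mono _ _ k0k) hk0).
  have e3 : cabs (fc (tproj (l k)) n - (if 0 <= n then fc f n else 0)) <=
      Kav s * (e / (2 * Kav s + 1)).
    rewrite fc_tproj; case: ifP => _; first by rewrite cabsBC.
    by rewrite subrr cabs0 (le_trans (cabs_ge0 _) e1).
  have -> : fc h n - (if 0 <= n then fc f n else 0) = (fc h n - fc (tproj (l k)) n) +
     (fc (tproj (l k)) n - (if 0 <= n then fc f n else 0)) by rewrite addrA subrK.
  apply: (le_trans (cabsD _ _)); apply: (le_trans (lerD e1 e3)).
  have K1 : 0 < 2 * Kav s + 1 by rewrite ltr_wpDl// mulr_ge0// Kav_ge0.
  rewrite [leLHS](_ : _ = e * ((2 * Kav s) / (2 * Kav s + 1))); last by ring.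
  rewrite ger_pMr// ler_pdivrMr ?mul1r ?lerDl//.
- apply/ler_addgt0Pr => e e0.
  have [|k0 hk0] := small (e / (c + 1)); first by rewrite divr_gt0// ltr_wpDl.
  have [k [k0k hk]] := limit k0.
  have n1 : nrm s (tsum (l k)) <= nrm s f + e / (c + 1).
    have [_] := LSB mD s1' Lf (LSB mD s1' Lf (Lt (l k))).1.
    rewrite (eq_nrm mu s (g := tsum (l k))); last by move=> x _; rewrite opprB addrC subrK.
    move=> h1; apply: (le_trans h1); rewrite lerD2l.
    exact: le_trans (lP k) (le_trans (mono _ _ k0k) hk0).
  have [_] := LSD mD s1' (LSB mD s1' Lh (Lt [seq u <- l k | 0 <= u.2])).1 (Lt [seq u <- l k | 0 <= u.2]).
  rewrite (eq_nrm mu s (g := h)); last by move=> x _; rewrite subrK.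
  move=> h1; apply: (le_trans h1).
  apply: (@le_trans _ _ (e / (c + 1) + c * (nrm s f + e / (c + 1)))).
    apply: lerD; first exact: le_trans hk hk0.
    by apply: (le_trans (H (l k))); exact: ler_wpM2l.
  have : (c + 1) * (e / (c + 1)) = e by rewrite mulrC divfK// gt_eqF// ltr_wpDl.
  by set y := e / (c + 1) => <-; rewrite !mulrDr mulrDl mul1r; lra.
Qed.

End Riesz_projection.

(** * Sequence spaces and the Hausdorff-Young inequality *)

Section Sequence_spaces.
Variable R : realType.
Local Notation C := R[i].
Local Notation cnt := (@counting nat R).
Local Notation LS := (LS cnt setT).
Local Notation nrm := (nrm cnt setT).
Implicit Types (s p q : R) (x y : nat -> C).

Lemma cmeas_nat x : @cmeas _ nat R setT x.
Proof. by split. Qed.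

Lemma integral_cnt s x : (\int[cnt]_k ((cabs (x k)) `^ s)%:E)%E =
  (\sum_(k <oo) ((cabs (x k)) `^ s)%:E)%E.
Proof. by rewrite ge0_integral_count// => k; rewrite lee_fin powR_ge0. Qed.

(** Sequences become functions on a space with counting measure, to which the theory of [LS]
    applies. *)
Lemma lpP s x : lp s x <-> LS s x.
Proof.
rewrite /lp -nneseries_esumT; last by move=> k; rewrite lee_fin powR_ge0.
rewrite -integral_cnt; split=> [h|[]//].
by split; [exact: cmeas_nat|exact: h].
Qed.

Lemma lnrm_le_sums s x (c : R) : 0 < s -> 0 <= c ->
  (forall N, \sum_(k < N) cabs (x k) `^ s <= c `^ s) -> LS s x /\ nrm s x <= c.
Proof.
move=> s0 c0 H; apply: (nrm_le s0 c0 (cmeas_nat x)).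
rewrite integral_cnt; apply: lime_le.
  by apply: is_cvg_nneseries => k _ _; rewrite lee_fin powR_ge0.
by near=> N; rewrite /= big_mkord sumEFin lee_fin; exact: H.
Unshelve. all: by end_near. Qed.

Lemma lsum_le_nrm s x N : 0 < s -> LS s x ->
  \sum_(k < N) cabs (x k) `^ s <= nrm s x `^ s.
Proof.
move=> s0 Lx; rewrite -lee_fin -(nrm_powR s0 Lx) integral_cnt -sumEFin.
rewrite -(big_mkord xpredT (fun k => (cabs (x k) `^ s)%:E)).
by apply: nneseries_lim_ge => k _ _; rewrite lee_fin powR_ge0.
Qed.

Lemma cabs_le_lnrm s x n : 0 < s -> LS s x -> cabs (x n) <= nrm s x.
Proof.
move=> s0 Lx; rewrite leNgt; apply/negP => lt.
have : nrm s x `^ s < cabs (x n) `^ s.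
  by apply: gt0_ltr_powR; rewrite ?nnegrE ?nrm_ge0 ?cabs_ge0.
apply/negP; rewrite -leNgt; apply: le_trans (lsum_le_nrm n.+1 s0 Lx).
by rewrite big_ord_recr /= lerDr sumr_ge0// => k _; exact: powR_ge0.
Qed.

Lemma lnrm_eq0 s x : 0 < s -> LS s x -> nrm s x = 0 <-> forall n, x n = 0.
Proof.
move=> s0 Lx; split=> [h n|h].
  by apply/cabs_eq0/le_anti; rewrite cabs_ge0 andbT -h cabs_le_lnrm.
rewrite -(LS0 cnt setT s0).2; congr (nrm _ _); exact/funext.
Qed.

Definition cutoff N x : nat -> C := fun n => if (n < N)%N then x n else 0.

Lemma LS_cutoff s N x : 0 < s -> LS s (cutoff N x).
Proof.
move=> s0; pose M := \sum_(k < N) cabs (x k) `^ s.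
have M0 : 0 <= M by apply: sumr_ge0 => k _; exact: powR_ge0.
apply: (@lnrm_le_sums s (cutoff N x) (M `^ s^-1) s0 (powR_ge0 _ _) _).1 => m.
rewrite -powRrM mulVf ?gt_eqF// powRr1//.
rewrite -(big_mkord xpredT (fun k => cabs (cutoff N x k) `^ s)).
rewrite /M -(big_mkord xpredT (fun k => cabs (x k) `^ s)).
have c0 k : (N <= k)%N -> cabs (cutoff N x k) `^ s = 0.
  by move=> Nk; rewrite /cutoff ltnNge Nk /= cabs0 powR0// gt_eqF.
have [mN|Nm] := leqP m N.
  rewrite [leRHS](big_cat_nat (leq0n m) mN)//= -[leLHS]addr0 lerD//.
    rewrite !big_nat; apply: ler_sum => k /andP[_ km].
    by rewrite /cutoff (leq_trans km mN).
  by apply: sumr_ge0 => k _; exact: powR_ge0.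
rewrite (big_cat_nat (leq0n N) (ltnW Nm))//= [X in _ + X]big_nat [X in _ + X]big1 ?addr0; last first.
  by move=> k /andP[/c0].
by rewrite !big_nat; apply: ler_sum => k /andP[_ km]; rewrite /cutoff km.
Qed.

Lemma cutoff_cvg s x (e : R) : 0 < s -> 0 < e -> LS s x ->
  exists N, nrm s (fun n => x n - cutoff N x n) <= e.
Proof.
move=> s0 e0 Lx.
have [||k [_ h]] := @dominated_nrm _ nat R cnt setT measurableT s
  (fun N n => x n - cutoff N x n) x e s0 e0 (fun N => cmeas_nat _) Lx; last by exists k.
- move=> N n _; rewrite /cutoff; case: ifP => _; first by rewrite subrr cabs0 cabs_ge0.
  by rewrite subr0.
- apply: aeW => n _; apply: (@cvg_near_cst _ _ _ _ _ _).
  by exists n.+1 => // N /= nN; rewrite /cutoff nN subrr cabs0.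
Qed.

Lemma lsum_hoelder p q x y N : 0 < p -> 0 < q -> p^-1 + q^-1 = 1 -> LS p x -> LS q y ->
  \sum_(k < N) cabs (x k * y k) <= nrm p x * nrm q y.
Proof.
move=> p0 q0 pq Lx Ly; have := hoelder_cabs measurableT p0 q0 pq Lx Ly.
rewrite ge0_integral_count; last by move=> k; rewrite lee_fin cabs_ge0.
rewrite -lee_fin; apply: le_trans.
rewrite -sumEFin -(big_mkord xpredT (fun k => (cabs (x k * y k))%:E)).
by apply: nneseries_lim_ge => k _ _; rewrite lee_fin cabs_ge0.
Qed.

End Sequence_spaces.

(** * Bessel's inequality *)

Section Bessel.
Variable R : realType.
Local Notation C := R[i].
Local Notation mu := (@lebesgue_measure R).
Local Notation D := (@Tdom R).
Local Notation LS := (LS mu D).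
Local Notation nrm := (nrm mu D).
Local Notation cmeas := (@cmeas _ (measurableTypeR R) R D).
Local Notation mD := (@measurable_Tdom R).
Implicit Types (f g : R -> C) (s p q : R).

Definition psum (N : nat) (c : nat -> C) (x : R) : C := \sum_(k < N) c k * ex (Posz k) x.

Lemma psumE N c : psum N c = tsum [seq (c (val k), Posz (val k)) | k <- enum 'I_N].
Proof. by apply/funext => x; rewrite /tsum big_map big_enum. Qed.

Lemma pairing_psum f N c : cint f ->
  av (fun x => f x * conjc (psum N c x)) = \sum_(k < N) conjc (c k) * fc f (Posz k).
Proof. by move=> cf; rewrite psumE (pairing_tsum _ cf) big_map big_enum. Qed.

Lemma psum_trigpoly N c : trigpoly (psum N c).
Proof. by rewrite psumE; exact: tsum_trigpoly. Qed.

Lemma fc_psum N c n : fc (psum N c) n = \sum_(k < N) c k * (Posz k == n)%:R.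
Proof. by rewrite psumE fc_tsum big_map big_enum. Qed.

Lemma fc_psum_nat N c (n : nat) : fc (psum N c) (Posz n) = cutoff N c n.
Proof.
rewrite fc_psum /cutoff; case: ifP => nN.
  rewrite (bigD1 (Ordinal nN))//= eqxx mulr1 big1 ?addr0// => k.
  by rewrite -val_eqE /= eqz_nat => /negbTE ->; rewrite mulr0.
apply: big1 => k _; rewrite eqz_nat; case: eqP => [kn|]; rewrite ?mulr0//.
by move: nN; rewrite -kn ltn_ord.
Qed.

Lemma fc_psum_neg N c (n : int) : n < 0 -> fc (psum N c) n = 0.
Proof.
move=> n0; rewrite fc_psum; apply: big1 => k _; case: eqP => [kn|]; rewrite ?mulr0//.
by move: n0; rewrite -kn.
Qed.

(** With [b] the sum on the left, pairing [g] with [S] and [S] with itself gives [b] both times; so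
    [nrm 2 S ^+ 2 = 2 * pi * b], and Cauchy-Schwarz concludes. The constant is 4 times the sharp
    one, by the loss in [av_cabs]. *)
Lemma bessel g N : LS 2 g ->
  \sum_(k < N) cabs (fc g (Posz k)) ^+ 2 <= 2 / pi * nrm 2 g ^+ 2.
Proof.
move=> Lg; have s12 : 1 < 2 :> R by rewrite ltr1n.
have cg := LS_cint s12 Lg.
pose c k := fc g (Posz k); pose S := psum N c.
have tS : trigpoly S by exact: psum_trigpoly.
have LSS := trigpoly_LS (ltW s12) tS; have cS := LS_cint s12 LSS.
set b := \sum_(k < N) _; have b0 : 0 <= b by apply: sumr_ge0 => k _; exact: sqr_ge0.
have pi0 := pi_gt0 R.
have E1 : av (fun x => g x * conjc (S x)) = b%:C%C.
  rewrite pairing_psum// rmorph_sum; apply: eq_bigr => k _.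
  by rewrite mulrC mul_conj.
have E2 : av (fun x => S x * conjc (S x)) = b%:C%C.
  rewrite pairing_psum// rmorph_sum; apply: eq_bigr => k _.
  by rewrite fc_psum_nat /cutoff ltn_ord mulrC mul_conj.
have E3 : nrm 2 S ^+ 2 = 2 * pi * b.
  have : av (fun x => (cabs (S x) ^+ 2)%:C%C) = b%:C%C.
    by rewrite -E2; apply: eq_av => x _; rewrite mul_conj.
  rewrite av_real => /(congr1 (fun z : C => Re z)) /= <-.
  rewrite mulrA divff ?mul1r; last by rewrite mulf_neq0// gt_eqF.
  have -> : nrm 2 S ^+ 2 = nrm 2 S `^ 2 by rewrite powR_mulrn// nrm_ge0.
  have := nrm_powR (ltr0n R 2) LSS; rewrite /Rintegral => /(congr1 fine) /= <-.
  congr fine; apply: eq_integral => x _; by rewrite powR_mulrn// cabs_ge0.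
have LSc : LS 2 (fun x => conjc (S x)) by apply: trigpoly_LS; [exact: ltW|exact: trigpoly_conj].
have := hoelder_av (ltr0n R 2) (ltr0n R 2) _ Lg LSc.
rewrite E1 cabs_real ger0_norm// nrm_conj => /(_ _)H.
have {}H : b <= pi^-1 * (nrm 2 g * nrm 2 S) by apply: H; lra.
have H2 : b ^+ 2 <= (pi^-1 * nrm 2 g) ^+ 2 * (2 * pi * b).
  rewrite -E3 -exprMn ler_sqr ?nnegrE ?mulr_ge0 ?nrm_ge0 ?invr_ge0 ?pi_ge0//.
  by rewrite -mulrA.
move: b0; rewrite le_eqVlt => /predU1P[<-|b0].
  by rewrite mulr_ge0 ?sqr_ge0// divr_ge0// ltW.
rewrite -(ler_pM2r b0) -expr2; apply: (le_trans H2); rewrite le_eqVlt; apply/orP; left.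
have pn : pi != 0 :> R by rewrite gt_eqF.
by apply/eqP; move: (pi : R) (nrm 2 g) pn => P X pn; field.
Qed.

End Bessel.

(** * The Hausdorff-Young inequality for exponents below 2 *)

Section Hausdorff_Young.
Variable R : realType.
Local Notation C := R[i].
Local Notation mu := (@lebesgue_measure R).
Local Notation D := (@Tdom R).
Local Notation LS := (LS mu D).
Local Notation nrm := (nrm mu D).
Local Notation cmeas := (@cmeas _ (measurableTypeR R) R D).
Local Notation mD := (@measurable_Tdom R).
Implicit Types (f g : R -> C).

Lemma ler_sum_geo (rho : R) (P : nat -> bool) (j I : nat) : 0 <= rho -> rho <= 1 ->
  (forall i, P i -> (j <= i)%N) ->
  (1 - rho) * \sum_(i < I) (if P i then rho ^+ i else 0) <= rho ^+ j.
Proof.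
move=> r0 r1 Pj; suff : (1 - rho) * \sum_(i < I) (if P i then rho ^+ i else 0) <=
    rho ^+ j - rho ^+ maxn j I.
  by move=> h; apply: (le_trans h); rewrite gerBl exprn_ge0.
elim: I => [|I IH]; first by rewrite big_ord0 mulr0 maxn0 subrr.
rewrite big_ord_recr /= mulrDr; case: ifP => PI.
  have jI := Pj _ PI; move: IH; rewrite (maxn_idPr jI) (maxn_idPr (leqW jI)) => IH.
  apply: (le_trans (lerD IH (lexx _))); rewrite exprS.
  by set u := rho ^+ I; rewrite le_eqVlt; apply/orP; left; apply/eqP; ring.
rewrite mulr0 addr0; apply: (le_trans IH); rewrite lerD2l lerN2; apply: ler_wiXn2l => //.
by rewrite geq_max leq_maxl /= (leq_trans _ (leq_maxr j I.+1)).
Qed.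

Lemma dyadic_level (a : R) : 0 < a -> a <= 1 ->
  exists i : nat, 2^-1 ^+ i.+1 < a <= 2^-1 ^+ i.
Proof.
move=> a0 a1; have ex : exists i : nat, 2^-1 ^+ i.+1 < a.
  have c00 : (2^-1 : R) ^+ k @[k --> \oo] --> 0.
    by apply: cvg_expr; rewrite ger0_norm// invf_lt1// ltr1n.
  have /cvgr0Pnorm_lt/(_ _ a0)[k _ /(_ k.+1 (leqnSn k))] := c00.
  by rewrite ger0_norm; [exists k|exact/ltW/exprn_gt0].
exists (ex_minn ex); case: ex_minnP => -[|m] -> hm /=; first by rewrite expr0.
by rewrite leNgt; apply/negP => /hm; rewrite ltnn.
Qed.

Variable q : R.
Hypotheses (q1 : 1 < q) (q2 : q < 2).
Let p := conjex q.
Let b (t : R) : R := 2 `^ t.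

Let q0 : 0 < q. Proof. exact: lt_trans q1. Qed.
Let qB : q - 1 != 0. Proof. by rewrite gt_eqF// subr_gt0. Qed.
Let pE : p = q / (q - 1).
Proof.
have qn : q != 0 by rewrite gt_eqF.
rewrite /p /conjex; have -> : 1 - q^-1 = (q - 1) / q by rewrite mulrBl mul1r divff.
by rewrite invf_div.
Qed.
Let p0 : 0 < p. Proof. by rewrite pE divr_gt0// subr_gt0. Qed.
Let p2 : 2 < p.
Proof. by rewrite pE ltr_pdivlMr ?subr_gt0//; move: q2; lra. Qed.

Let bD t u : b (t + u) = b t * b u.
Proof. by rewrite /b powRD// pnatr_eq0 /= implybT. Qed.
Let b_gt0 t : 0 < b t. Proof. exact: powR_gt0. Qed.
Let bM t u : b (t * u) = b t `^ u. Proof. exact: powRrM. Qed.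
Let b_nat t (n : nat) : b (t * n%:R) = b t ^+ n.
Proof. by rewrite bM powR_mulrn// ltW. Qed.
Let bN1 (n : nat) : b (- n%:R) = 2^-1 ^+ n.
Proof. by rewrite -mulN1r b_nat /b powRN powRr1. Qed.

(* The [n]-th coefficient of size about [2^-i] is read off [trunc (lev i) f]: the level is chosen
   such that the discarded part of [f] contributes at most [2^-(i+2)] to any coefficient.  Summing
   Bessel's inequality over [i] then produces a geometric series. *)
Let lev (i : nat) : R := b ((i%:R + 2) / (q - 1)).
Let lev_gt0 i : 0 < lev i. Proof. exact: b_gt0. Qed.
Let lev1 i : lev i `^ (1 - q) = 2^-1 ^+ i.+2.
Proof.
rewrite /lev -bM -bN1; congr b; rewrite -[i.+2]addn2 natrD.
by field.
Qed.
Let rho := b (2 - p).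
Let rho_gt0 : 0 < rho. Proof. exact: b_gt0. Qed.
Let rho_lt1 : rho < 1.
Proof.
rewrite /rho -[2 - p]opprB /b powRN invf_lt1 ?powR_gt0//.
rewrite [ltLHS](_ : 1 = 1 `^ (p - 2)); last by rewrite powR1.
by apply: gt0_ltr_powR; rewrite ?nnegrE ?subr_gt0 ?ltr1n.
Qed.
Let lev2 i : rho ^+ i * lev i `^ (2 - q) = b (2 * (p - 2)).
Proof.
rewrite /rho -b_nat /lev -bM -bD; congr b; rewrite pE; by field.
Qed.

Let Cg : R := b (2 * (p - 2)) / (1 - rho).
Let Cg0 : 0 <= Cg. Proof. by rewrite /Cg divr_ge0 ?subr_ge0 ?(ltW rho_lt1)// ltW. Qed.

(** The geometric sum is controlled by the first index [j] with [t <= lev j]. There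
    [t ^ (2 - q) <= lev j ^ (2 - q)], and by [lev2] the product of the right side with [rho ^+ j]
    does not depend on [j]. *)
Let level_sum (t : R) I : 0 <= t ->
  \sum_(i < I) rho ^+ i * (if t <= lev i then t ^+ 2 else 0) <= Cg * t `^ q.
Proof.
rewrite le_eqVlt => /predU1P[<-|t0].
  rewrite powR0 ?mulr0 ?gt_eqF// big1// => i _.
  by case: ifP => _; rewrite ?expr0n mulr0.
have [[i [iI ti]]|nex] := pselect (exists i : nat, (i < I)%N /\ t <= lev i); last first.
  rewrite big1; first by apply: mulr_ge0 => //; exact: powR_ge0.
  move=> i _; case: ifP => ti; rewrite ?mulr0//.
  by exfalso; apply: nex; exists i.
have ex : exists i, t <= lev i by exists i.
have [j tj jmin] := ex_minnP ex.
have := @ler_sum_geo rho (fun i => t <= lev i) j I (ltW rho_gt0) (ltW rho_lt1) jmin.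
have r1 : 0 < 1 - rho by rewrite subr_gt0.
rewrite mulrC -ler_pdivlMr// => H.
have -> : \sum_(i < I) rho ^+ i * (if t <= lev i then t ^+ 2 else 0) =
    t ^+ 2 * \sum_(i < I) (if t <= lev i then rho ^+ i else 0).
  by rewrite mulr_sumr; apply: eq_bigr => k _; case: ifP => _; rewrite ?mulr0// mulrC.
apply: (@le_trans _ _ (t ^+ 2 * (rho ^+ j / (1 - rho)))).
  by rewrite ler_wpM2l// sqr_ge0.
rewrite mulrA /Cg [leRHS]mulrAC ler_wpM2r ?invr_ge0 ?(ltW r1)//.
have -> : t ^+ 2 = t `^ (2 - q) * t `^ q.
  rewrite -powRD; last by rewrite subrK pnatr_eq0.
  by rewrite subrK powR_mulrn// ltW.
rewrite mulrAC ler_wpM2r ?powR_ge0// -(lev2 j) mulrC ler_wpM2l ?exprn_ge0// ?(ltW rho_gt0)//.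
by apply: ge0_ler_powR; rewrite ?nnegrE ?subr_ge0 ?(ltW q2) ?(ltW t0) ?(ltW (lev_gt0 _)).
Qed.

Let LS_trunc i f : LS q f -> LS 2 (trunc (lev i) f).
Proof.
move=> Lf; apply: (LS_bounded (M := lev i)) => //; first exact: (cmeas_trunc mD (lev i) Lf.1).
by move=> x _; rewrite /trunc; case: ifP => // _; rewrite cabs0 ltW.
Qed.

Let trunc_sum f I : LS q f ->
  \sum_(i < I) rho ^+ i * nrm 2 (trunc (lev i) f) ^+ 2 <= Cg * nrm q f `^ q.
Proof.
move=> Lf.
have m2 i : measurable_fun D (fun x => (cabs (trunc (lev i) f x) `^ 2)%:E).
  by apply/measurable_EFinP; apply: measurable_cabs_powR; exact: (LS_trunc i Lf).1.
have mq : measurable_fun D (fun x => (cabs (f x) `^ q)%:E).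
  by apply/measurable_EFinP; apply: measurable_cabs_powR; exact: Lf.1.
have E (i : nat) : (rho ^+ i * nrm 2 (trunc (lev i) f) ^+ 2)%:E =
    (\int[mu]_(x in D) ((rho ^+ i)%:E * (cabs (trunc (lev i) f x) `^ 2)%:E))%E.
  rewrite (ge0_integralZl_EFin _ mD); first last.
  - by rewrite exprn_ge0// ltW.
  - exact: m2.
  - by move=> x _; rewrite lee_fin powR_ge0.
  rewrite (nrm_powR (ltr0n R 2) (LS_trunc i Lf)) EFinM.
  by rewrite powR_mulrn// nrm_ge0.
rewrite -lee_fin -sumEFin; under eq_bigr do rewrite E.
rewrite -(ge0_integral_sum mu mD); first last.
- by move=> i x _; rewrite -EFinM lee_fin mulr_ge0 ?powR_ge0// exprn_ge0// ltW.
- by move=> i; apply: emeasurable_funM; [exact: measurable_cst|exact: m2].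
rewrite EFinM -(nrm_powR q0 Lf) -(ge0_integralZl_EFin _ mD)//; last first.
  by move=> x _; rewrite lee_fin powR_ge0.
apply: ge0_le_integral => //.
- exact: mD.
- move=> x _; apply: sume_ge0 => i _.
  by rewrite -EFinM lee_fin mulr_ge0 ?powR_ge0// exprn_ge0// ltW.
- by apply: emeasurable_sum => i; apply: emeasurable_funM; [exact: measurable_cst|exact: m2].
- by apply: emeasurable_funM; [exact: measurable_cst|exact: mq].
move=> x _; under eq_bigr do rewrite -EFinM.
rewrite sumEFin -EFinM lee_fin; apply: le_trans (level_sum I (cabs_ge0 (f x))).
apply: ler_sum => i _; rewrite ler_wpM2l ?exprn_ge0// ?(ltW rho_gt0)//.
rewrite /trunc; case: ifP => _; first by rewrite powR_mulrn// cabs_ge0.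
by rewrite cabs0 powR0.
Qed.

(** Where [f] exceeds the level, [|f| <= lev i ^ (1 - q) * |f| ^ q], and [lev1] evaluates the first
    factor. *)
Let rest_fc i f n : LS q f -> nrm q f <= 1 ->
  cabs (fc f n - fc (trunc (lev i) f) n) <= 2^-1 ^+ i.+2.
Proof.
move=> Lf f1; have cf := LS_cint q1 Lf.
have ct : cint (trunc (lev i) f) by apply: LS_cint (LS_trunc i Lf); rewrite ltr1n.
have ip : mu.-integrable D (EFin \o (fun x => cabs (f x) `^ q)).
  apply/integrableP; split.
    by apply/measurable_EFinP; apply: measurable_cabs_powR; exact: Lf.1.
  by under eq_integral do rewrite /= ger0_norm ?powR_ge0//; exact: Lf.2.
rewrite -fcB// fcE; set r := fun x => f x - trunc (lev i) f x.
have cr : cint r by rewrite /r; have := cintD cf (cintN ct).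
have crx : cint (fun x => r x * cexpi (- (n%:~R * x))).
  have := cint_mul_ex (- n) cr.
  rewrite /ex; under eq_fun do rewrite mulrNz mulNr.
  by [].
apply: (le_trans (av_cabs crx)).
have i1 : mu.-integrable D (EFin \o (fun x => 2^-1 ^+ i.+2 * cabs (f x) `^ q)).
  exact: (integrableZl mD (2^-1 ^+ i.+2) ip).
apply: (@le_trans _ _ (pi^-1 * (2^-1 ^+ i.+2 * nrm q f `^ q))); last first.
  rewrite mulrCA ger_pMr ?exprn_gt0//; apply: mulr_ile1; rewrite ?powR_ge0 ?invr_ge0 ?pi_ge0//.
    by rewrite invf_le1 ?pi_gt0// (le_trans _ (pi_ge2 R))// ler1n.
  rewrite [leRHS](_ : 1 = 1 `^ q); last by rewrite powR1.
  by apply: ge0_ler_powR; rewrite ?nnegrE ?nrm_ge0 ?(ltW q0).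
rewrite ler_wpM2l ?invr_ge0 ?pi_ge0//.
have -> : 2^-1 ^+ i.+2 * nrm q f `^ q = \int[mu]_(x in D) (2^-1 ^+ i.+2 * cabs (f x) `^ q).
  by rewrite (RintegralZl _ mD ip) /Rintegral (nrm_powR q0 Lf).
apply: (le_Rintegral mD (cint_cabs crx) i1) => x _.
rewrite cabsM cabs_cexpi mulr1 /r /trunc; case: ifP => h.
  by rewrite subrr cabs0 mulr_ge0 ?powR_ge0// exprn_ge0// invr_ge0.
rewrite subr0 -lev1; have {}h : lev i < cabs (f x) by rewrite ltNge h.
have fx0 := lt_trans (lev_gt0 i) h.
have {1}-> : cabs (f x) = cabs (f x) `^ (1 - q) * cabs (f x) `^ q.
  by rewrite -powRD ?subrK ?powRr1 ?oner_eq0// ltW.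
rewrite ler_wpM2r ?powR_ge0// -[1 - q]opprB !powRN lef_pV2 ?posrE ?powR_gt0//.
by apply: ge0_ler_powR; rewrite ?nnegrE ?subr_ge0 ?(ltW q1) ?(ltW h) ?(ltW fx0) ?(ltW (lev_gt0 _)).
Qed.

(** Each coefficient is charged to the dyadic level of its own size, at which the truncated function
    already has a comparable coefficient. Summing over all levels only adds nonnegative terms, and
    Bessel's inequality applies level by level. *)
Let HY_unit f N : LS q f -> nrm q f <= 1 -> (forall n, cabs (fc f n) <= 1) ->
  \sum_(k < N) cabs (fc f (Posz k)) `^ p <= 16 * (2 / pi) * Cg.
Proof.
move=> Lf f1 fc1; have pi0 := pi_gt0 R.
pose a k := cabs (fc f (Posz k)); pose t i k := cabs (fc (trunc (lev i) f) (Posz k)).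
have term0 i k : 0 <= 16 * rho ^+ i * t i k ^+ 2.
  by apply: mulr_ge0; [rewrite mulr_ge0// exprn_ge0// ltW|exact: sqr_ge0].
have lvl k : exists i, a k `^ p <= 16 * rho ^+ i * t i k ^+ 2.
  have := cabs_ge0 (fc f (Posz k)); rewrite -/(a k) le_eqVlt => /predU1P[<-|a0].
    by exists 0%N; rewrite powR0 ?gt_eqF.
  have [i /andP[h1 h2]] := dyadic_level a0 (fc1 _); exists i.
  (* The coefficient exceeds [2^-(i+1)], and the discarded part takes at most half of that. *)
  have h3 : 2^-1 ^+ i.+2 <= t i k.
    have r1 := rest_fc i (Posz k) Lf f1.
    have := cabsD (fc f (Posz k) - fc (trunc (lev i) f) (Posz k)) (fc (trunc (lev i) f) (Posz k)).
    rewrite subrK -/(a k) -/(t i k) => r2.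
    have e : (2^-1 : R) ^+ i.+1 = 2^-1 ^+ i.+2 + 2^-1 ^+ i.+2.
      by rewrite (exprS _ i.+1); set u := 2^-1 ^+ i.+1; lra.
    by move: h1 r1 r2; rewrite e; lra.
  apply: (@le_trans _ _ (b (- i%:R * p))).
    have i0 : 0 <= 2^-1 ^+ i :> R by rewrite exprn_ge0// invr_ge0.
    by rewrite bM bN1; apply: ge0_ler_powR; rewrite ?nnegrE ?i0 ?(ltW a0) ?(ltW p0).
  (* [2^(-i p) = 2^4 * (2^(2 - p))^i * (2^-(i+2))^2]: the 16 undoes the shift by 2 in the last
     exponent. *)
  apply: (@le_trans _ _ (16 * rho ^+ i * (2^-1 ^+ i.+2) ^+ 2)); last first.
    apply: ler_wpM2l; first by rewrite mulr_ge0// exprn_ge0// ltW.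
    by rewrite ler_sqr ?nnegrE ?exprn_ge0 ?invr_ge0 ?cabs_ge0.
  rewrite -bN1 -[b _ ^+ 2]b_nat /rho -b_nat.
  have -> : 16 = b 4 :> R by rewrite /b powR_mulrn// -natrX.
  rewrite -!bD le_eqVlt; apply/orP; left; apply/eqP; congr b.
  by rewrite -[i.+2]addn2 natrD; ring.
pose ii k := projT1 (cid (lvl k)).
have iiP k : a k `^ p <= 16 * rho ^+ (ii k) * t (ii k) k ^+ 2 := projT2 (cid (lvl k)).
pose I := (\max_(k < N) ii k).+1.
have iI (k : 'I_N) : (ii k < I)%N by rewrite ltnS; exact: (leq_bigmax k).
apply: (@le_trans _ _ (\sum_(k < N) \sum_(i < I) 16 * rho ^+ i * t i k ^+ 2)).
  apply: ler_sum => k _; apply: (le_trans (iiP k)).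
  by rewrite (bigD1 (Ordinal (iI k)))//= lerDl sumr_ge0.
rewrite exchange_big /=.
apply: (@le_trans _ _ (\sum_(i < I) 16 * (2 / pi) * (rho ^+ i * nrm 2 (trunc (lev i) f) ^+ 2))).
  apply: ler_sum => i _; rewrite -mulr_sumr.
  have -> : 16 * (2 / pi) * (rho ^+ i * nrm 2 (trunc (lev i) f) ^+ 2) =
      16 * rho ^+ i * (2 / pi * nrm 2 (trunc (lev i) f) ^+ 2) by ring.
  apply: ler_wpM2l; first by rewrite mulr_ge0// exprn_ge0// ltW.
  exact: bessel (LS_trunc i Lf).
rewrite -mulr_sumr ler_wpM2l ?mulr_ge0// ?invr_ge0 ?(ltW pi0)//.
apply: (le_trans (trunc_sum I Lf)); rewrite ger_pMr; last first.
  by rewrite divr_gt0// subr_gt0.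
rewrite [leRHS](_ : 1 = 1 `^ q); last by rewrite powR1.
by apply: ge0_ler_powR; rewrite ?nnegrE ?nrm_ge0 ?(ltW q0).
Qed.

Lemma hausdorff_young_lt2 : exists2 c : R, 0 <= c & forall f N, LS q f ->
  \sum_(k < N) cabs (fc f (Posz k)) `^ p <= c * nrm q f `^ p.
Proof.
pose c1 := 16 * (2 / pi) * Cg; have K0 := Kav_ge0 q.
have c10 : 0 <= c1 by apply: mulr_ge0 => //; rewrite mulr_ge0// divr_ge0// pi_ge0.
exists (c1 * (Kav q + 1) `^ p); first by rewrite mulr_ge0 ?powR_ge0.
move=> f N Lf; have := nrm_ge0 mu D q f; rewrite le_eqVlt => /predU1P[f0|f0].
  rewrite big1.
    by apply: mulr_ge0; [apply: mulr_ge0 => //|]; exact: powR_ge0.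
  move=> k _.
  have := fc_nrm (Posz k) q1 Lf; rewrite -f0 mulr0 => h.
  have -> : cabs (fc f (Posz k)) = 0 by apply/le_anti; rewrite h cabs_ge0.
  by rewrite powR0// gt_eqF.
(* Scaling to norm [eta] makes both the norm and, by [fc_nrm], all coefficients at most 1. *)
pose eta := (Kav q + 1)^-1; have eta0 : 0 < eta by rewrite invr_gt0 ltr_wpDl.
pose z : C := (eta / nrm q f)%:C%C.
have cz : cabs z = eta / nrm q f by rewrite cabs_real ger0_norm// divr_ge0// ltW.
pose g : R -> C := fun x => z * f x.
have [Lg ng] : LS q g /\ nrm q g = cabs z * nrm q f := LSZ mD z q0 Lf.
have ng' : nrm q g = eta by rewrite ng cz divfK// gt_eqF.
have fcg n : fc g n = z * fc f n by rewrite /g fcZ//; exact: LS_cint q1 Lf.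
have g1 : nrm q g <= 1 by rewrite ng' invf_le1 ?lerDr// ltr_wpDl.
have fg1 n : cabs (fc g n) <= 1.
  apply: (le_trans (fc_nrm n q1 Lg)); rewrite ng' ler_pdivrMr ?mul1r ?lerDl//.
  by rewrite ltr_wpDl.
have sumE : \sum_(k < N) cabs (fc g (Posz k)) `^ p =
    (eta / nrm q f) `^ p * \sum_(k < N) cabs (fc f (Posz k)) `^ p.
  rewrite mulr_sumr; apply: eq_bigr => k _; rewrite fcg cabsM cz powRM ?cabs_ge0//.
  by rewrite divr_ge0// ltW.
have H : \sum_(k < N) cabs (fc g (Posz k)) `^ p <= c1 := @HY_unit g N Lg g1 fg1.
have := eq_ind _ (fun s => s <= c1) H _ sumE.
have e0 : 0 < eta / nrm q f by rewrite divr_gt0.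
rewrite -ler_pdivlMl ?powR_gt0// => h; apply: (le_trans h).
have K1 : 0 <= Kav q + 1 by rewrite addr_ge0.
rewrite -powRN -mulN1r powRrM powR_inv1 ?(ltW e0)// invf_div /eta invrK mulrC.
by rewrite [_ * (Kav q + 1)]mulrC powRM ?(ltW f0)// mulrA.
Qed.

End Hausdorff_Young.

(** * Open mapping theorem and Fredholm index on dense subspaces *)

Section Open_mapping.
Variable R : realType.
Local Notation C := R[i].

(** A complete seminormed subspace of an ambient module. [S] is a set, as [H^q] and [l^p] are
    predicates on functions, and [N] may vanish on nonzero vectors. Completeness has the one-index
    Cauchy condition of [LS_complete]. *)
Record banach (V : lmodType C) (S : set V) (N : V -> R) : Prop := Banach {
  ban0 : S 0;
  banL : forall c f g, S f -> S g -> S (f + c *: g);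
  banN_ge0 : forall f, 0 <= N f;
  banND : forall f g, S f -> S g -> N (f + g) <= N f + N g;
  banNZ : forall c f, S f -> N (c *: f) = cabs c * N f;
  ban_complete : forall w : nat -> V, (forall n, S (w n)) ->
    (forall e : R, 0 < e -> exists n, forall m, (n <= m)%N -> N (w m - w n) <= e) ->
    exists h, S h /\ forall e : R, 0 < e -> exists n, forall m, (n <= m)%N -> N (h - w m) <= e }.

Section Banach_theory.
Variables (V : lmodType C) (S : set V) (N : V -> R).
Hypothesis B : banach S N.
Implicit Types f g h : V.

Lemma banD f g : S f -> S g -> S (f + g).
Proof. by move=> Sf Sg; rewrite -[g]scale1r; exact: (banL B). Qed.

Lemma banZ c f : S f -> S (c *: f).
Proof. by move=> Sf; rewrite -[_ *: _]add0r; apply: (banL B) => //; exact: (ban0 B). Qed.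

Lemma banB f g : S f -> S g -> S (f - g).
Proof. by move=> Sf Sg; apply: banD => //; rewrite -scaleN1r; exact: banZ. Qed.

Lemma ban_sum n (g : 'I_n -> V) (c : 'I_n -> C) : (forall i, S (g i)) ->
  S (\sum_(i < n) c i *: g i).
Proof.
move=> Sg; apply: (big_ind S) => [|f h|i _]; first exact: (ban0 B).
  exact: banD.
exact: banZ.
Qed.

Lemma banN0 : N 0 = 0.
Proof. by have := banNZ B 0 (ban0 B); rewrite scale0r cabs0 mul0r. Qed.

Lemma banNN f : S f -> N (- f) = N f.
Proof. by move=> Sf; rewrite -scaleN1r (banNZ B)// cabsN cabs1 mul1r. Qed.

Lemma banNBC f g : S f -> S g -> N (f - g) = N (g - f).
Proof. by move=> Sf Sg; rewrite -opprB banNN//; exact: banB. Qed.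

Lemma banN_tri g f h : S f -> S g -> S h -> N (f - h) <= N (f - g) + N (g - h).
Proof.
move=> Sf Sg Sh; have -> : f - h = (f - g) + (g - h) by rewrite addrA subrK.
by apply: (banND B); exact: banB.
Qed.

Lemma banN_sum n (g : 'I_n -> V) (c : 'I_n -> C) : (forall i, S (g i)) ->
  N (\sum_(i < n) c i *: g i) <= \sum_(i < n) cabs (c i) * N (g i).
Proof.
move=> Sg; elim: n g c Sg => [|n IH] g c Sg; first by rewrite !big_ord0 banN0.
rewrite !big_ord_recr/=; apply: (le_trans (banND B _ _)); [exact: ban_sum|exact: banZ|].
by apply: lerD; [exact: IH|rewrite (banNZ B)].
Qed.

End Banach_theory.

Section Baire.
Variables (V W : lmodType C) (S : set V) (N : V -> R) (SW : set W) (NW : W -> R).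
Hypotheses (BV : banach S N) (BW : banach SW NW).
Variables (T : W -> V) (K : R).
Hypotheses (ST : forall w, SW w -> S (T w)).
Hypothesis linT : forall c u v, SW u -> SW v -> N (T (u + c *: v) - (T u + c *: T v)) = 0.
Hypothesis K0 : 0 <= K.
Hypothesis bndT : forall w, SW w -> N (T w) <= K * NW w.
Hypothesis surT : forall h, S h -> exists2 w, SW w & N (h - T w) = 0.

(** Baire's argument. If no image of a ball of [W] were dense in a ball of [V], there would be
    nested balls successively avoiding the images of the balls of radius 0, 1, 2, and so on; but
    their common point has a preimage, whose norm is below some integer. *)
Let baire : exists (k : R) (h0 : V) (r : R), [/\ S h0, 0 < r &
  forall h, S h -> N (h - h0) <= r -> forall d, 0 < d ->
    exists w, [/\ SW w, NW w <= k & N (h - T w) <= d]].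
Proof.
apply: contrapT => nex.
have {}nex (k : nat) (h : V) (r : R) : S h -> 0 < r -> exists u : V * R,
    [/\ S u.1, N (u.1 - h) <= r, 0 < u.2 &
    forall w, SW w -> NW w <= k%:R -> u.2 < N (u.1 - T w)].
  move=> Sh r0; apply: contrapT => nu; apply: nex; exists k%:R, h, r; split=> // h' Sh' hr d d0.
  apply: contrapT => nw; apply: nu; exists (h', d); split=> // w Sw wk.
  by rewrite ltNge; apply/negP => le; apply: nw; exists w.
have stp (k : nat) (x : V * R) : exists y : V * R, S x.1 -> 0 < x.2 ->
    [/\ S y.1, N (y.1 - x.1) <= x.2 / 2, 0 < y.2, y.2 <= x.2 / 2 &
    forall w, SW w -> NW w <= k%:R -> y.2 < N (y.1 - T w)].
  have [[Sx x0]|nx] := pselect (S x.1 /\ 0 < x.2); last by exists x => Sx x0; case: nx.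
  have x20 : 0 < x.2 / 2 by rewrite divr_gt0.
  have [[u d] /= [Su ux d0 H]] := nex k _ _ Sx x20.
  (* The radius stays within the gap [d], so that the limit point, which lies in this ball, is not
     the image of a [w] of norm at most [k]; halving makes the centres converge. *)
  exists (u, Num.min d (x.2 / 2)) => _ _ /=; split => //.
  - by rewrite lt_min d0.
  - by rewrite ge_min lexx orbT.
  - by move=> w Sw wk; apply: le_lt_trans (H w Sw wk); rewrite ge_min lexx.
pose nx k x := projT1 (cid (stp k x)).
have nxP k x : S x.1 -> 0 < x.2 -> [/\ S (nx k x).1, N ((nx k x).1 - x.1) <= x.2 / 2,
    0 < (nx k x).2, (nx k x).2 <= x.2 / 2 &
    forall w, SW w -> NW w <= k%:R -> (nx k x).2 < N ((nx k x).1 - T w)].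
  exact: projT2 (cid (stp k x)).
pose x := fix x k : V * R := if k is j.+1 then nx j (x j) else (0, 1).
have xS k : S (x k).1 /\ 0 < (x k).2.
  elim: k => [|k [Sx x0]] /=; first by split => //; exact: (ban0 BV).
  by have [] := nxP k _ Sx x0.
have xr k : (x k).2 <= 2^-1 ^+ k.
  elim: k => [|k IH] /=; first by rewrite expr0.
  have [Sx x0] := xS k; have [_ _ _ h _] := nxP k _ Sx x0.
  by apply: (le_trans h); rewrite exprS mulrC ler_wpM2l// invr_ge0.
have xd m k : N ((x (k + m)%N).1 - (x k).1) <= (x k).2.
  elim: m k => [|m IH] k.
    by rewrite addn0 subrr (banN0 BV) ltW//; have [] := xS k.
  have [Sx x0] := xS k; have [Sy h1 y0 h2 _] := nxP k _ Sx x0.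
  rewrite addnS -addSn; have := IH k.+1; have [Sz _] := xS (k.+1 + m)%N.
  move=> h3; apply: (le_trans (banN_tri BV Sz Sy Sx)).
  apply: (le_trans (lerD h3 h1)); move: h2 => /=; lra.
have small (e : R) : 0 < e -> exists k, 2^-1 ^+ k <= e.
  move=> e0; have c00 : (2^-1 : R) ^+ k @[k --> \oo] --> 0.
    by apply: cvg_expr; rewrite ger0_norm// invf_lt1// ltr1n.
  have /cvgr0Pnorm_le/(_ _ e0)[k _ /(_ k (leqnn k))] := c00.
  by rewrite ger0_norm; [exists k|exact/ltW/exprn_gt0].
have [h [Sh hP]] : exists h, S h /\ forall e : R, 0 < e -> exists n, forall m, (n <= m)%N -> N (h - (x m).1) <= e.
  apply: (ban_complete BV (w := fun k => (x k).1)) => [k|e /small[k ke]]; first by have [] := xS k.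
  exists k => m km; rewrite -(subnKC km); apply: (le_trans (xd _ _)).
  exact: le_trans (xr k) ke.
have hx k : N (h - (x k).1) <= (x k).2.
  apply/ler_addgt0Pr => e /hP[n hn]; have [Sx _] := xS k.
  have [Sy _] := xS (k + n)%N.
  apply: (le_trans (banN_tri BV Sh Sy Sx)); rewrite addrC; apply: lerD; first exact: xd.
  by apply: hn; rewrite leq_addl.
have [w Sw hw] := surT Sh.
have [k wk] : exists k : nat, NW w <= k%:R.
  by exists (Num.bound (NW w)); apply/ltW/archi_boundP; exact: (banN_ge0 BW).
have [Sx x0] := xS k; have [Sy _ y0 _ /(_ w Sw wk)] := nxP k _ Sx x0.
apply/negP; rewrite -leNgt.
apply: (le_trans (banN_tri BV Sy Sh (ST Sw))); rewrite hw addr0 (banNBC BV)//.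
exact: (hx k.+1).
Qed.

Let NTB u v : SW u -> SW v -> N (T (u - v) - (T u - T v)) = 0.
Proof. by move=> Su Sv; have := linT (-1) Su Sv; rewrite !scaleN1r. Qed.

Let NTZ c u : SW u -> N (T (c *: u) - c *: T u) = 0.
Proof.
move=> Su; have S0 := ban0 BW; have SZ := banZ BW c Su.
have T0 : N (T 0) = 0.
  apply/le_anti; rewrite (banN_ge0 BV) andbT (le_trans (bndT S0))//.
  by rewrite (banN0 BW) mulr0.
have := linT c S0 Su; rewrite add0r => h; apply/le_anti; rewrite (banN_ge0 BV) andbT.
have SD := banD BV (ST S0) (banZ BV c (ST Su)).
apply: (le_trans (banN_tri BV (ST SZ) SD (banZ BV c (ST Su)))).
by rewrite h add0r addrK T0.
Qed.

(** With [t h] of norm [r], the points [h0 + t h] and [h0] are both images up to [r / 4] of vectors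
    of norm at most [k]. Their difference, scaled back by [N h / r], leaves an error of half of
    [N h] and gives the constant [2 * k / r]. *)
Let approx : exists2 M : R, 0 <= M & forall h, S h ->
  exists w, [/\ SW w, NW w <= M * N h & N (h - T w) <= 2^-1 * N h].
Proof.
have [k [h0 [r [Sh0 r0 H]]]] := baire.
have kp : 0 <= k.
  have [||w [_ wk _]] := H h0 Sh0 _ 1 => //; first by rewrite subrr (banN0 BV) ltW.
  exact: le_trans (banN_ge0 BW _) wk.
exists (2 * k / r); first by rewrite divr_ge0 ?mulr_ge0// ltW.
move=> h Sh; have := banN_ge0 BV h; rewrite le_eqVlt => /predU1P[/esym Nh|Nh].
  exists 0; split; first exact: (ban0 BW).
    by rewrite Nh mulr0 (banN0 BW).
  rewrite Nh mulr0; have S0 := ban0 BW.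
  have := banN_tri BV Sh (ban0 BV) (ST S0); rewrite subr0 Nh add0r sub0r (banNN BV (ST S0)).
  by move=> le; apply: (le_trans le); apply: (le_trans (bndT S0)); rewrite (banN0 BW) mulr0.
pose t : C := (r / N h)%:C%C; pose t1 : C := (N h / r)%:C%C.
have tt : t1 * t = 1.
  by rewrite -rmorphM /= mulrA divfK ?gt_eqF// divff ?gt_eqF.
have ct : cabs t = r / N h by rewrite cabs_real ger0_norm// divr_ge0// ltW.
have ct1 : cabs t1 = N h / r by rewrite cabs_real ger0_norm// divr_ge0// ltW.
have Sth := banZ BV t Sh.
have Sh1 := banD BV Sh0 Sth.
have d0 : 0 < r / 4 by rewrite divr_gt0.
have [|w1 [Sw1 w1k e1]] := H _ Sh1 _ _ d0.
  by rewrite addrC addKr (banNZ BV)// ct divfK// gt_eqF.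
have [|w2 [Sw2 w2k e2]] := H _ Sh0 _ _ d0; first by rewrite subrr (banN0 BV) ltW.
have Sw := banB BW Sw1 Sw2.
exists (t1 *: (w1 - w2)); split.
- exact: (banZ BW).
- rewrite (banNZ BW)// ct1 mulrC -[leRHS]mulrA [r^-1 * _]mulrC ler_wpM2r//.
    by rewrite divr_ge0// ltW.
  apply: (@le_trans _ _ (NW w1 + NW w2)); last by rewrite mulr_natl mulr2n lerD.
  by rewrite -(banNN BW Sw2); apply: (banND BW) => //; rewrite -sub0r; apply: (banB BW) => //; exact: (ban0 BW).
have S1 := banZ BW t1 Sw; have S2 := banB BV (ST Sw1) (ST Sw2).
apply: (le_trans (banN_tri BV Sh (banZ BV t1 (ST Sw)) (ST S1))).
rewrite [N (_ - T _)](banNBC BV (banZ BV t1 (ST Sw)) (ST S1)) NTZ// addr0.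
have -> : h - t1 *: T (w1 - w2) = t1 *: (t *: h - T (w1 - w2)).
  by rewrite scalerBr scalerA tt scale1r.
rewrite (banNZ BV); last by apply: (banB BV) => //; exact: ST.
rewrite ct1 [leRHS](_ : _ = N h / r * (r / 4 + r / 4)); last first.
  by rewrite -mulrDl -mulr2n -mulr_natl; field; rewrite gt_eqF.
apply: ler_wpM2l; first by rewrite divr_ge0// ltW.
apply: (le_trans (banN_tri BV Sth S2 (ST Sw))).
rewrite [N (_ - T (_ - _))](banNBC BV S2 (ST Sw)) NTB// addr0.
have -> : t *: h - (T w1 - T w2) = (h0 + t *: h - T w1) - (h0 - T w2).
  by rewrite [h0 + _]addrC [_ + h0 - _]addrAC addrKA opprK opprB addrA addrAC.
have Sa := banB BV Sh1 (ST Sw1); have Sb := banB BV Sh0 (ST Sw2).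
apply: (@le_trans _ _ (N (h0 + t *: h - T w1) + N (- (h0 - T w2)))).
  by apply: (banND BV) => //; rewrite -sub0r; apply: (banB BV) => //; exact: (ban0 BV).
by rewrite (banNN BV Sb) lerD.
Qed.

(** Each correction halves the remainder, and the corrections sum to a vector of norm at most
    [2 * M * N h]. *)
Lemma open_mapping : exists2 M : R, 0 <= M & forall h, S h ->
  exists w, [/\ SW w, NW w <= M * N h & N (h - T w) = 0].
Proof.
have [M M0 H] := approx; exists (2 * M); first by rewrite mulr_ge0.
move=> h Sh.
have cho (g : V) : exists w, S g -> [/\ SW w, NW w <= M * N g & N (g - T w) <= 2^-1 * N g].
  by have [/H[w wP]|nS] := pselect (S g); [exists w|exists 0].
pose c g := projT1 (cid (cho g)).
have cP g : S g -> [/\ SW (c g), NW (c g) <= M * N g & N (g - T (c g)) <= 2^-1 * N g].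
  exact: projT2 (cid (cho g)).
pose w := fix w k : W := if k is j.+1 then w j + c (h - T (w j)) else 0.
have Sw k : SW (w k).
  elim: k => [|k IH] /=; first exact: (ban0 BW).
  by apply: (banD BW) => //; have [] := cP _ (banB BV Sh (ST IH)).
have Nw k : N (h - T (w k)) <= 2^-1 ^+ k * N h.
  elim: k => [|k IH].
    rewrite expr0 mul1r /=; have S0 := ban0 BW.
    apply: (le_trans (banN_tri BV Sh (ban0 BV) (ST S0))).
    rewrite subr0 sub0r (banNN BV (ST S0)) gerDl (le_trans (bndT S0))//.
    by rewrite (banN0 BW) mulr0.
  have Sr := banB BV Sh (ST (Sw k)); have [Sc _ e] := cP _ Sr.
  have S2 := banD BV (ST (Sw k)) (ST Sc).
  apply: (le_trans (banN_tri BV Sh S2 (ST (Sw k.+1)))).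
  rewrite (banNBC BV S2 (ST (Sw k.+1))) /=.
  have := linT 1 (Sw k) Sc; rewrite !scale1r => ->; rewrite addr0 opprD addrA; apply: (le_trans e).
  by rewrite exprS -mulrA ler_wpM2l// invr_ge0.
have dw k : NW (w k.+1 - w k) <= M * N h * 2^-1 ^+ k.
  have [_ e _] := cP _ (banB BV Sh (ST (Sw k))).
  by rewrite /= addrC addKr; apply: (le_trans e); rewrite -mulrA ler_wpM2l// mulrC.
have dwm m k : NW (w (k + m)%N - w k) <= M * N h * (2 * 2^-1 ^+ k - 2 * 2^-1 ^+ (k + m)).
  elim: m => [|m IH].
    by rewrite addn0 subrr (banN0 BW) subrr mulr0.
  rewrite addnS; apply: (le_trans (banN_tri BW (Sw _) (Sw (k + m)%N) (Sw _))).
  apply: (le_trans (lerD (dw _) IH)); rewrite -mulrDr ler_wpM2l ?mulr_ge0 ?(banN_ge0 BV)//.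
  by rewrite exprS; set a := 2^-1 ^+ (k + m); lra.
have dwk k m : (k <= m)%N -> NW (w m - w k) <= 2 * M * N h * 2^-1 ^+ k.
  move=> km; rewrite -(subnKC km); apply: (le_trans (dwm _ _)).
  rewrite [leRHS](_ : _ = M * N h * (2 * 2^-1 ^+ k)); last by ring.
  rewrite ler_wpM2l ?mulr_ge0 ?(banN_ge0 BV)//.
  by rewrite gerBl mulr_ge0// exprn_ge0// invr_ge0.
have Kn : 0 <= 2 * M * N h by rewrite !mulr_ge0// (banN_ge0 BV).
have small (A e : R) : 0 <= A -> 0 < e -> exists k, A * 2^-1 ^+ k <= e.
  move=> A0 e0; have c00 : A * (2^-1 : R) ^+ k @[k --> \oo] --> 0.
    rewrite -[0](mulr0 A); apply: cvgM; first exact: cvg_cst.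
    by apply: cvg_expr; rewrite ger0_norm// invf_lt1// ltr1n.
  have /cvgr0Pnorm_le/(_ _ e0)[k _ /(_ k (leqnn k))] := c00.
  by rewrite ger0_norm; [exists k|rewrite mulr_ge0// exprn_ge0// invr_ge0].
have [v [Sv vP]] : exists v, SW v /\ forall e : R, 0 < e -> exists n, forall m, (n <= m)%N -> NW (v - w m) <= e.
  apply: (ban_complete BW (w := w)) => // e /(small _ _ Kn)[k ke].
  by exists k => m km; exact: le_trans (dwk _ _ km) ke.
exists v; split => //.
  apply/ler_addgt0Pr => e /vP[n hn]; have S0 := ban0 BW.
  have := banN_tri BW Sv (Sw n) S0; rewrite subr0 => le; apply: (le_trans le).
  rewrite addrC; apply: lerD; last exact: hn.
  by have := dwk 0 n (leq0n n); rewrite expr0 mulr1.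
apply/le_anti; rewrite (banN_ge0 BV) andbT; apply/ler_addgt0Pr => e e0; rewrite add0r.
have e2 : 0 < e / 2 by rewrite divr_gt0.
have [k hk] := small _ _ (banN_ge0 BV h) e2.
have eK : 0 < e / 2 / (K + 1) by rewrite divr_gt0// ltr_wpDl.
have [n hn] := vP _ eK; pose m := maxn k n.
apply: (le_trans (banN_tri BV Sh (ST (Sw m)) (ST Sv))).
rewrite [leRHS](splitr e); apply: lerD.
  apply: (le_trans (Nw m)); rewrite mulrC; apply: le_trans hk.
  rewrite ler_wpM2l ?(banN_ge0 BV)//; apply: ler_wiXn2l; rewrite ?invr_ge0// ?invf_le1 ?ler1n//.
  exact: leq_maxl.
have Svm := banB BW Sv (Sw m); have SS := banB BV (ST Sv) (ST (Sw m)).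
rewrite (banNBC BV (ST (Sw m)) (ST Sv)).
have := banN_tri BV SS (ST Svm) (ban0 BV); rewrite !subr0 => le; apply: (le_trans le).
rewrite (banNBC BV SS (ST Svm)) NTB// add0r; apply: (le_trans (bndT Svm)).
apply: (@le_trans _ _ (K * (e / 2 / (K + 1)))).
  by rewrite ler_wpM2l// hn// leq_maxr.
rewrite mulrCA ger_pMr// ler_pdivrMr ?mul1r ?lerDl//.
by rewrite ltr_wpDl.
Qed.

End Baire.

End Open_mapping.

(** * Kernel and cokernel on a dense invariant subspace *)

Section Fredholm_dense.
Variable R : realType.
Local Notation C := R[i].

Lemma cauchy_R (u : nat -> R) :
  (forall e : R, 0 < e -> exists n, forall m, (n <= m)%N -> `|u m - u n| <= e) ->
  exists l, forall e : R, 0 < e -> exists n, forall m, (n <= m)%N -> `|l - u m| <= e.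
Proof.
move=> H; have cu : cvgn u.
  apply: R_complete; apply: cauchy_exP => e e0.
  have e2 : 0 < e / 2 by rewrite divr_gt0.
  have [n hn] := H _ e2; exists (u n); exists n => // m /= nm.
  rewrite /ball /= distrC; apply: (le_lt_trans (hn _ nm)).
  by rewrite ltr_pdivrMr// mulr_natr mulr2n ltrDl.
exists (limn u) => e e0.
by have /cvgrPdist_le/(_ _ e0)[n _ hn] := cu; exists n => m nm; exact: hn.
Qed.

Lemma cauchy_C (u : nat -> C) :
  (forall e : R, 0 < e -> exists n, forall m, (n <= m)%N -> cabs (u m - u n) <= e) ->
  exists l, forall e : R, 0 < e -> exists n, forall m, (n <= m)%N -> cabs (l - u m) <= e.
Proof.
move=> H.
have [a ha] : exists a, forall e : R, 0 < e -> exists n, forall m, (n <= m)%N -> `|a - Re (u m)| <= e.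
  apply: cauchy_R => e /H[n hn]; exists n => m /hn; apply: le_trans.
  by rewrite -cReN -cReD Re_le_cabs.
have [b hb] : exists b, forall e : R, 0 < e -> exists n, forall m, (n <= m)%N -> `|b - Im (u m)| <= e.
  apply: cauchy_R => e /H[n hn]; exists n => m /hn; apply: le_trans.
  by rewrite -cImN -cImD Im_le_cabs.
exists (Complex a b) => e e0; have e2 : 0 < e / 2 by rewrite divr_gt0.
have [n hn] := ha _ e2; have [k hk] := hb _ e2; exists (maxn n k) => m.
rewrite geq_max => /andP[/hn h1 /hk h2].
apply: (le_trans (cabs_le_ReIm _)); rewrite cReD cReN cImD cImN /= [leRHS](splitr e).
exact: lerD.
Qed.

Variable X : Type.
Local Notation V := (X -> C^o).
Implicit Types (f g h : V).

Lemma lincombE n (c : 'I_n -> C) (g : 'I_n -> X -> C) :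
  lincomb c g = \sum_(i < n) c i *: (g i : V).
Proof. by rewrite fct_sumE. Qed.

Variables (S : set V) (N : V -> R) (Z : set (X -> C)) (B : (X -> C) -> X -> C) (K : R).
Hypothesis BS : banach S N.
Hypothesis ZN : forall f, S f -> Z f <-> N f = 0.
Hypothesis SB : forall f, S f -> S (B f).
Hypothesis linB : forall c f g, S f -> S g -> N (B (f + c *: g) - (B f + c *: (B g : V))) = 0.
Hypothesis K0 : 0 <= K.
Hypothesis bndB : forall f, S f -> N (B f) <= K * N f.

Variable D : set V.
Hypothesis DS : D `<=` S.
Hypothesis D0 : D 0.
Hypothesis DL : forall c f g, D f -> D g -> D (f + c *: g).

Lemma dense_sum n (g : 'I_n -> V) (c : 'I_n -> C) : (forall i, D (g i)) ->
  D (\sum_(i < n) c i *: g i).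
Proof.
elim: n g c => [|n IH] g c Dg; first by rewrite big_ord0.
by rewrite big_ord_recr; apply: DL => //; exact: IH.
Qed.

Let eq0 f : S f -> N f <= 0 -> Z f.
Proof. by move=> Sf h; apply/ZN => //; apply/le_anti; rewrite h (banN_ge0 BS). Qed.

Let sum0 n (c : 'I_n -> C) (g : 'I_n -> V) : (forall i, S (g i)) ->
  (forall i, N (g i) = 0) -> N (\sum_(i < n) c i *: g i) = 0.
Proof.
move=> Sg Ng; apply/le_anti; rewrite (banN_ge0 BS) andbT.
by apply: (le_trans (banN_sum BS _ _)) => //; rewrite big1// => i _; rewrite Ng mulr0.
Qed.

(** The matrix that expresses a kernel basis on [D] in one on [S] has independent rows. If it is
    square it is invertible, and every kernel vector is then, up to a null one, a combination of
    vectors of [D]. *)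
Lemma kerdim_dense d1 d2 : kerdim D Z B d1 -> kerdim S Z B d2 ->
  (d1 <= d2)%N /\ (d1 = d2 -> forall f, S f -> Z (B f) ->
    exists g, D g /\ Z (f - g)).
Proof.
move=> [g1 [g1D g1free _]] [g2 [g2S _ g2span]].
have ex i : exists c, Z (fun x => g1 i x - lincomb c g2 x).
  by have [h1 h2] := g1D i; apply: g2span => //; exact: DS.
pose m i := projT1 (cid (ex i)).
have mP i : Z (fun x => g1 i x - lincomb (m i) g2 x) := projT2 (cid (ex i)).
have Sg1 i : S (g1 i) by apply: DS; have [] := g1D i.
have Sg2 i : S (g2 i) by have [] := g2S i.
pose M : 'M[C]_(d1, d2) := \matrix_(i, j) m i j.
have SL1 (c : 'I_d1 -> C) : S (lincomb c g1) by rewrite lincombE; exact: (ban_sum BS).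
have SL2 (c : 'I_d2 -> C) : S (lincomb c g2) by rewrite lincombE; exact: (ban_sum BS).
have key (c : 'rV[C]_d1) : N (lincomb (c 0) g1 - lincomb ((c *m M) 0) g2 : V) = 0.
  have -> : lincomb (c 0) g1 - lincomb ((c *m M) 0) g2 =
      \sum_(i < d1) c 0 i *: ((g1 i : V) - lincomb (m i) g2).
    under [RHS]eq_bigr do rewrite scalerBr.
    rewrite sumrB -lincombE; congr (_ - _); rewrite lincombE.
    under [RHS]eq_bigr do rewrite lincombE scaler_sumr.
    rewrite exchange_big; apply: eq_bigr => j _; rewrite mxE scaler_suml.
    by apply: eq_bigr => i _; rewrite mxE scalerA.
  apply: sum0 => i; first exact: (banB BS).
  apply/ZN; first exact: (banB BS).
  exact: mP.
have Mfree : row_free M.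
  apply: inj_row_free => c cM; apply/rowP => i; rewrite [RHS]mxE.
  apply: (g1free (c 0)); apply/ZN => //; have := key c; rewrite cM.
  have -> : lincomb ((0 : 'rV[C]_d2) 0) g2 = 0 :> V.
    by rewrite lincombE big1// => j _; rewrite mxE scale0r.
  by rewrite subr0.
split; first by rewrite -(eqP Mfree) rank_leq_col.
move=> d12; subst d2 => f Sf Zf; have [e eP] := g2span f Sf Zf.
have Mu : M \in unitmx by rewrite -row_free_unit.
pose c := \row_i e i *m invmx M; exists (lincomb (c 0) g1); split.
  by rewrite lincombE; apply: dense_sum => i; have [] := g1D i.
have S1 : S (f - lincomb (c 0) g1) by exact: (banB BS).
have S2 : S (f - lincomb e g2) by exact: (banB BS).
apply: eq0 => //; apply: (le_trans (banN_tri BS Sf (SL2 e) (SL1 (c 0)))).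
have -> : N (f - lincomb e g2) = 0 by apply/ZN.
rewrite add0r (banNBC BS)//; have := key c; rewrite mulmxKV//.
have -> : lincomb ((\row_i e i) 0) g2 = lincomb e g2.
  by apply/funext => x; apply: eq_bigr => i _; rewrite mxE.
by move=> ->.
Qed.

Hypothesis DB : forall f, D f -> D (B f).
Hypothesis dense : forall h (e : R), S h -> 0 < e -> exists d, D d /\ N (h - d) <= e.

Section Augmented.
Variables (n : nat) (g : 'I_n -> V).
Hypothesis Sg : forall i, S (g i).
Local Notation W := ('rV[C]_n * V)%type.

(* [augT] is onto exactly when [g] spans a complement of the range of [B]; the open mapping theorem
   then bounds the coordinates along [g]. *)
Definition augS : set W := [set w | S w.2].
Definition augN (w : W) : R := \sum_(i < n) cabs (w.1 0 i) + N w.2.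
Definition augT (w : W) : V := \sum_(i < n) w.1 0 i *: g i + (B w.2 : V).

Lemma aug_banach : banach augS augN.
Proof.
split.
- exact: (ban0 BS).
- by move=> c f h; exact: (banL BS).
- by move=> f; rewrite addr_ge0 ?(banN_ge0 BS)// sumr_ge0// => i _; exact: cabs_ge0.
- move=> f h Sf Sh; rewrite /augN addrACA lerD ?(banND BS)// -big_split ler_sum// => i _.
  by rewrite mxE cabsD.
- move=> c f Sf; rewrite /augN mulrDr (banNZ BS)//; congr (_ + _).
  by rewrite mulr_sumr; apply: eq_bigr => i _; rewrite mxE cabsM.
move=> w Sw H.
have coord i : exists l, forall e : R, 0 < e -> exists k, forall m, (k <= m)%N -> cabs (l - (w m).1 0 i) <= e.
  apply: cauchy_C => e /H[k hk]; exists k => m /hk; apply: le_trans.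
  rewrite /augN (bigD1 i)//= !mxE -addrA lerDl addr_ge0 ?(banN_ge0 BS)//.
  by rewrite sumr_ge0// => j _; exact: cabs_ge0.
pose l i := projT1 (cid (coord i)).
have lP i (e : R) : 0 < e -> exists k, forall m, (k <= m)%N -> cabs (l i - (w m).1 0 i) <= e.
  exact: (projT2 (cid (coord i)) e).
have [h [Sh hP]] : exists h, S h /\ forall e : R, 0 < e -> exists k, forall m, (k <= m)%N -> N (h - (w m).2) <= e.
  apply: (ban_complete BS (w := fun k => (w k).2)) => // e /H[k hk]; exists k => m /hk; apply: le_trans.
  by rewrite /augN lerDr sumr_ge0// => j _; exact: cabs_ge0.
exists (\row_i l i, h); split => // e e0.
(* Equal shares for the [n] coordinates and the component in [S]. *)
have e1 : 0 < e / n.+1%:R by rewrite divr_gt0.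
have [k hk] := hP _ e1.
have ki i : exists k, forall m, (k <= m)%N -> cabs (l i - (w m).1 0 i) <= e / n.+1%:R by exact: lP.
pose kk i := projT1 (cid (ki i)).
have kkP i m : (kk i <= m)%N -> cabs (l i - (w m).1 0 i) <= e / n.+1%:R.
  exact: (projT2 (cid (ki i))).
exists (maxn k (\max_(i < n) kk i)) => m; rewrite geq_max => /andP[km /bigmax_leqP im].
rewrite /augN; apply: (@le_trans _ _ (\sum_(i < n) e / n.+1%:R + e / n.+1%:R)).
  by apply: lerD; [apply: ler_sum => i _; rewrite !mxE kkP// im|exact: hk].
by rewrite sumr_const card_ord -mulrSr -(mulr_natr (_ / _)) divfK.
Qed.

Lemma aug_open : (forall h, S h -> exists c f, S f /\ Z (fun x => h x - lincomb c g x - B f x)) ->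
  exists2 M : R, 0 <= M & forall h, S h -> exists (c : 'I_n -> C) f,
    [/\ S f, \sum_(i < n) cabs (c i) <= M * N h & Z (fun x => h x - lincomb c g x - B f x)].
Proof.
move=> sur.
pose K1 := K + \sum_(i < n) N (g i).
have Ks : 0 <= \sum_(i < n) N (g i) by apply: sumr_ge0 => i _; exact: (banN_ge0 BS).
have K10 : 0 <= K1 by rewrite addr_ge0.
have ST (w : W) : augS w -> S (augT w).
  by move=> Sw; apply: (banD BS); [exact: (ban_sum BS)|exact: SB].
have lT c (u v : W) : augS u -> augS v -> N (augT (u + c *: v) - (augT u + c *: augT v)) = 0.
  move=> Su Sv; rewrite -(linB c Su Sv); congr N; rewrite /augT.
  have -> : \sum_(i < n) (u + c *: v).1 0 i *: g i =
      \sum_(i < n) u.1 0 i *: g i + c *: \sum_(i < n) v.1 0 i *: g i.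
    rewrite scaler_sumr -big_split; apply: eq_bigr => i _.
    by rewrite /= !mxE scalerDl scalerA.
  rewrite scalerDr [X in _ - X]addrACA opprD addrACA subrr add0r.
  by [].
have bT (w : W) : augS w -> N (augT w) <= K1 * augN w.
  move=> Sw; apply: (le_trans (banND BS (ban_sum BS _ Sg) (SB Sw))).
  rewrite /K1 mulrDl addrC; apply: lerD.
    apply: (le_trans (bndB Sw)); rewrite ler_wpM2l// /augN lerDr sumr_ge0// => i _.
    exact: cabs_ge0.
  apply: (le_trans (banN_sum BS _ Sg)); rewrite mulr_suml; apply: ler_sum => i _.
  rewrite mulrC ler_wpM2l ?(banN_ge0 BS)// /augN (bigD1 i)//= -addrA lerDl.
  by rewrite addr_ge0 ?(banN_ge0 BS)// sumr_ge0// => j _; exact: cabs_ge0.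
have split_eq (h : V) (w : W) : h - augT w = fun x => h x - lincomb (w.1 0) g x - B w.2 x.
  by rewrite /augT -lincombE opprD addrA.
have sT h : S h -> exists2 w : W, augS w & N (h - augT w) = 0.
  move=> Sh; have [c [f [Sf Zf]]] := sur h Sh; exists (\row_i c i, f) => //.
  apply/ZN; first by apply: (banB BS) => //; exact: ST.
  rewrite split_eq; have -> // : lincomb ((\row_i c i) 0) g = lincomb c g.
  by apply/funext => x; apply: eq_bigr => i _; rewrite mxE.
have [M M0 H] := open_mapping BS aug_banach ST lT K10 bT sT.
exists M => // h Sh; have [w [Sw Nw hw]] := H h Sh.
exists (w.1 0), w.2; split => //.
  by apply: le_trans Nw; rewrite /augN lerDl (banN_ge0 BS).
by rewrite -split_eq; apply/ZN => //; apply: (banB BS) => //; exact: ST.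
Qed.

End Augmented.

(** Vectors [d i] of [D] close to the basis [g2] differ from it, modulo the range, by combinations
    of [g2] with small coefficients [(cf i).1], by [aug_open]. The identity minus a matrix with row
    sums at most 1/2 is injective, so the [d i] stay independent modulo the range of [B] on [S], and
    the matrix [P] of their expansions in [g1] has independent rows. *)
Lemma cokerdim_dense d1 d2 : cokerdim D Z B d1 -> cokerdim S Z B d2 -> (d2 <= d1)%N.
Proof.
move=> [g1 [g1D _ g1span]] [g2 [g2S g2free g2span]].
have [M M0 HM] := aug_open g2S g2span.
(* Times the open mapping constant [M] this is at most 1/2. *)
have e0 : 0 < 2^-1 / (M + 1) by rewrite divr_gt0// ltr_wpDl.
have ex i : exists d, D d /\ N ((g2 i : V) - d) <= 2^-1 / (M + 1) by exact: dense.
pose d i : V := projT1 (cid (ex i)).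
have dP i : D (d i) /\ N ((g2 i : V) - d i) <= 2^-1 / (M + 1) := projT2 (cid (ex i)).
have Sd i : S (d i) by apply: DS; have [] := dP i.
have ex1 i : exists cf : ('I_d2 -> C) * V, [/\ S cf.2, \sum_(j < d2) cabs (cf.1 j) <= 2^-1 &
    Z (fun x => ((g2 i : V) - d i) x - lincomb cf.1 g2 x - B cf.2 x)].
  have [c [f [Sf cb Zf]]] := HM _ (banB BS (g2S i) (Sd i)); exists (c, f); split => //.
  have [_ hd] := dP i; apply: (le_trans cb); apply: (@le_trans _ _ (M * (2^-1 / (M + 1)))).
    exact: ler_wpM2l.
  rewrite mulrCA ger_pMr ?invr_gt0// ler_pdivrMr ?mul1r ?lerDl//.
  by rewrite ltr_wpDl.
pose cf i := projT1 (cid (ex1 i)).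
have cfP i : [/\ S (cf i).2, \sum_(j < d2) cabs ((cf i).1 j) <= 2^-1 &
    Z (fun x => ((g2 i : V) - d i) x - lincomb (cf i).1 g2 x - B (cf i).2 x)] := projT2 (cid (ex1 i)).
have ex2 i : exists cf : ('I_d1 -> C) * V, D cf.2 /\ Z (fun x => d i x - lincomb cf.1 g1 x - B cf.2 x).
  by have [c [f [Df Zf]]] := g1span (d i) (dP i).1; exists (c, f).
pose pf i := projT1 (cid (ex2 i)).
have pfP i : D (pf i).2 /\ Z (fun x => d i x - lincomb (pf i).1 g1 x - B (pf i).2 x) :=
  projT2 (cid (ex2 i)).
pose P : 'M[C]_(d2, d1) := \matrix_(i, j) (pf i).1 j.
have SBsum n (x : 'I_n -> C) (v : 'I_n -> V) : (forall i, S (v i)) ->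
    N (B (\sum_(i < n) x i *: v i) - \sum_(i < n) x i *: (B (v i) : V)) = 0.
  elim: n x v => [|n IH] x v Sv.
    rewrite !big_ord0 subr0; apply/le_anti; rewrite (banN_ge0 BS) andbT.
    by apply: (le_trans (bndB (ban0 BS))); rewrite (banN0 BS) mulr0.
  rewrite !big_ord_recr /=; set s := \sum_(i < n) _; set t := \sum_(i < n) _.
  have Ss : S s by exact: (ban_sum BS).
  have St : S t by apply: (ban_sum BS) => i; exact: SB.
  have Sl := Sv ord_max; have h1 := linB (x ord_max) Ss Sl.
  have SBs := SB Ss; have SBl := banZ BS (x ord_max) (SB Sl).
  apply/le_anti; rewrite (banN_ge0 BS) andbT.
  have := banN_tri BS (SB (banD BS Ss (banZ BS (x ord_max) Sl))) (banD BS SBs SBl) (banD BS St SBl).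
  move=> le; apply: (le_trans le); rewrite h1 add0r.
  have -> : (B s : V) + x ord_max *: (B (v ord_max) : V) - (t + x ord_max *: (B (v ord_max) : V)) = (B s : V) - t.
    by rewrite opprD addrACA subrr addr0.
  by rewrite IH// => i; exact: Sv.
suff Pfree : row_free P by rewrite -(eqP Pfree) rank_leq_col.
apply: inj_row_free => x xP.
(* If [x] annihilates [P], the combination of the [d i] with weights [x] lies in the range. Modulo
   the range its coordinates along [g2] are [y], and the combination of the [vv i] is a preimage of
   [lincomb y g2]. *)
pose y j := x 0 j - \sum_(i < d2) x 0 i * (cf i).1 j.
pose vv i : V := (pf i).2 + (cf i).2.
have Svv i : S (vv i) by apply: (banD BS); [apply: DS; have [] := pfP i|have [] := cfP i].
have ySf : forall j, y j = 0.
  apply: (g2free y (\sum_(i < d2) x 0 i *: vv i)); first exact: (ban_sum BS).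
  set U := \sum_(i < d2) _ *: _.
  have SU : S U by exact: (ban_sum BS).
  pose r1 i : V := (g2 i : V) - d i - lincomb (cf i).1 g2 - B (cf i).2.
  pose r2 i : V := d i - lincomb (pf i).1 g1 - B (pf i).2.
  have Sl2 (c : 'I_d2 -> C) : S (lincomb c g2) by rewrite lincombE; exact: (ban_sum BS).
  have Sg1 i : S (g1 i) by apply: DS; exact: g1D.
  have Sl1 (c : 'I_d1 -> C) : S (lincomb c g1) by rewrite lincombE; exact: (ban_sum BS).
  have Spf i : S (pf i).2 by apply: DS; have [] := pfP i.
  have Scf i : S (cf i).2 by have [] := cfP i.
  have Sr1 i : S (r1 i) by do 3 (apply: (banB BS) => //; try exact: SB).
  have Sr2 i : S (r2 i) by do 2 (apply: (banB BS) => //; try exact: SB).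
  have Nr1 i : N (r1 i) = 0 by apply/ZN => //; have [_ _] := cfP i.
  have Nr2 i : N (r2 i) = 0 by apply/ZN => //; have [_] := pfP i.
  pose vB i : V := (B (pf i).2 : V) + B (cf i).2.
  have NvB i : N ((B (vv i) : V) - vB i) = 0.
    by have := linB 1 (Spf i) (Scf i); rewrite !scale1r.
  have SvB i : S (vB i) by apply: (banD BS); exact: SB.
  have E : (lincomb y g2 : V) - \sum_(i < d2) x 0 i *: vB i =
     \sum_(i < d2) x 0 i *: (r1 i + r2 i).
    have E1 i : r1 i + r2 i = (g2 i : V) - lincomb (cf i).1 g2 - lincomb (pf i).1 g1 - vB i.
      rewrite /r1 /r2 /vB; apply/funext => t /=.
      rewrite !fctE.
      by ring.
    under [RHS]eq_bigr do rewrite E1 !scalerBr.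
    rewrite !sumrB; congr (_ - _).
    have -> : \sum_(i < d2) x 0 i *: (lincomb (pf i).1 g1 : V) = 0.
      under eq_bigr do rewrite lincombE scaler_sumr.
      rewrite exchange_big big1// => j _.
      have := congr1 (fun A : 'rV[C]_d1 => A 0 j) xP; rewrite !mxE => h.
      under eq_bigr do rewrite scalerA.
      rewrite -scaler_suml (_ : \sum_(i < d2) _ = 0) ?scale0r//.
      by rewrite -[RHS]h; apply: eq_bigr => i _; rewrite mxE.
    rewrite subr0 lincombE /y.
    under eq_bigr do rewrite scalerBl.
    rewrite sumrB; congr (_ - _).
    under [RHS]eq_bigr do rewrite lincombE scaler_sumr.
    rewrite exchange_big; apply: eq_bigr => j _; rewrite scaler_suml.
    by apply: eq_bigr => i _; rewrite scalerA.
  have SsB : S (\sum_(i < d2) x 0 i *: (B (vv i) : V)) by apply: (ban_sum BS) => i; exact: SB.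
  have SsvB : S (\sum_(i < d2) x 0 i *: vB i) by exact: (ban_sum BS).
  apply: eq0; first by apply: (banB BS) => //; exact: SB.
  apply: (le_trans (banN_tri BS (Sl2 y) SsvB (SB SU))); rewrite E sum0; last 2 first.
  - by move=> i; exact: (banD BS).
  - move=> i; apply/le_anti; rewrite (banN_ge0 BS) andbT.
    by apply: (le_trans (banND BS (Sr1 i) (Sr2 i))); rewrite Nr1 Nr2 addr0.
  rewrite add0r; apply: (le_trans (banN_tri BS SsvB SsB (SB SU))).
  rewrite [X in _ + X](banNBC BS SsB (SB SU)) SBsum// addr0 (banNBC BS SsvB SsB) -sumrB.
  under eq_bigr do rewrite -scalerBr.
  by rewrite sum0// => i; apply: (banB BS) => //; exact: SB.
have xE j : x 0 j = \sum_(i < d2) x 0 i * (cf i).1 j by apply/eqP; rewrite -subr_eq0 -/(y j) ySf.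
(* [y = 0] says that [x] is fixed by the matrix of the [(cf i).1], which at least halves the sum of
   the moduli. *)
have xs : \sum_(j < d2) cabs (x 0 j) <= 2^-1 * \sum_(j < d2) cabs (x 0 j).
  apply: (@le_trans _ _ (\sum_(j < d2) \sum_(i < d2) cabs (x 0 i) * cabs ((cf i).1 j))).
    apply: ler_sum => j _; rewrite {1}xE; apply: (le_trans (cabs_sum _ _ _)).
    by apply: ler_sum => i _; rewrite cabsM.
  rewrite exchange_big mulr_sumr; apply: ler_sum => i _.
  by rewrite -mulr_sumr mulrC ler_wpM2r ?cabs_ge0//; have [] := cfP i.
have xs0 : \sum_(j < d2) cabs (x 0 j) = 0.
  apply/le_anti; rewrite sumr_ge0 ?andbT; last by move=> i _; exact: cabs_ge0.
  by move: xs; set s := \sum_(j < d2) _; lra.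
apply/rowP => j; rewrite mxE; apply: cabs_eq0; apply/le_anti; rewrite cabs_ge0 andbT -xs0.
by rewrite (bigD1 j)//= lerDl sumr_ge0// => i _; exact: cabs_ge0.
Qed.

Lemma kernel_dense (k1 c1 k2 c2 : nat) : kerdim D Z B k1 -> cokerdim D Z B c1 ->
  kerdim S Z B k2 -> cokerdim S Z B c2 -> k1%:Z - c1%:Z = k2%:Z - c2%:Z ->
  forall f, S f -> Z (B f) -> exists g, D g /\ Z (f - g).
Proof.
move=> hk1 hc1 hk2 hc2 idx; have [le eq] := kerdim_dense hk1 hk2.
have le' := cokerdim_dense hc1 hc2; apply: eq; apply/eqP; rewrite eqn_leq le /=.
move: idx => /eqP; rewrite subr_eq addrAC eq_sym subr_eq -!PoszD eqz_nat => /eqP e.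
by rewrite -(leq_add2r c1) e leq_add2l.
Qed.

End Fredholm_dense.

(** * Transport of kernels along an injective map with dense image *)

Section Transport.
Variable R : realType.
Local Notation C := R[i].

Section Equivalence.
Variables (V : lmodType C) (S : set V) (N : V -> R).
Hypothesis BS : banach S N.
Implicit Types f g h : V.

Definition eqv f g := [/\ S f, S g & N (f - g) = 0].

Lemma eqv_refl f : S f -> eqv f f.
Proof. by move=> Sf; split=> //; rewrite subrr (banN0 BS). Qed.

Lemma eqv_sym f g : eqv f g -> eqv g f.
Proof. by move=> [Sf Sg e]; split=> //; rewrite (banNBC BS). Qed.

Lemma eqv_trans g f h : eqv f g -> eqv g h -> eqv f h.
Proof.
move=> [Sf Sg e1] [_ Sh e2]; split=> //; apply/le_anti; rewrite (banN_ge0 BS) andbT.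
by apply: (le_trans (banN_tri BS Sf Sg Sh)); rewrite e1 e2 addr0.
Qed.

Lemma eqvL c f f' g g' : eqv f f' -> eqv g g' -> eqv (f + c *: g) (f' + c *: g').
Proof.
move=> [Sf Sf' e1] [Sg Sg' e2]; split; [exact: (banL BS)|exact: (banL BS)|].
have -> : f + c *: g - (f' + c *: g') = (f - f') + c *: (g - g').
  by rewrite scalerBr opprD addrACA.
apply/le_anti; rewrite (banN_ge0 BS) andbT.
have S1 := banB BS Sf Sf'; have S2 := banB BS Sg Sg'.
by apply: (le_trans (banND BS S1 (banZ BS c S2))); rewrite (banNZ BS)// e1 e2 mulr0 addr0.
Qed.

Lemma eqvB f f' g g' : eqv f f' -> eqv g g' -> eqv (f - g) (f' - g').
Proof. by move=> e1 e2; have := eqvL (-1) e1 e2; rewrite !scaleN1r. Qed.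

Lemma eqv0 f : eqv f 0 <-> S f /\ N f = 0.
Proof.
split=> [[Sf _]|[Sf e]]; first by rewrite subr0.
by split => //; [exact: (ban0 BS)|rewrite subr0].
Qed.

End Equivalence.

Variables (X Y : Type).
Local Notation VE := (X -> C^o).
Local Notation VG := (Y -> C^o).
Variables (E : set VE) (ZE : set (X -> C)) (A : (X -> C) -> X -> C).
Variables (S : set VG) (N : VG -> R) (Z : set (Y -> C)) (B : (Y -> C) -> Y -> C) (K : R).
Variable phi : (X -> C) -> Y -> C.
Hypothesis E0 : E 0.
Hypothesis EL : forall c f g, E f -> E g -> E (f + c *: g).
Hypothesis EA : forall f, E f -> E (A f).
Hypothesis BS : banach S N.
Hypothesis ZN : forall f : VG, S f -> Z f <-> N f = 0.
Hypothesis SB : forall f, S f -> S (B f).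
Hypothesis linB : forall c (f g : VG), S f -> S g ->
  N (B (f + c *: g) - (B f + c *: (B g : VG))) = 0.
Hypothesis K0 : 0 <= K.
Hypothesis bndB : forall f, S f -> N (B f) <= K * N f.
Hypothesis phiS : forall f, E f -> S (phi f).
Hypothesis phiL : forall c (f g : VE), E f -> E g ->
  N (phi (f + c *: g) - ((phi f : VG) + c *: (phi g : VG))) = 0.
Hypothesis phiZ : forall f, E f -> ZE f <-> N (phi f) = 0.
Hypothesis phiAB : forall f, E f -> N ((phi (A f) : VG) - B (phi f)) = 0.
Hypothesis dense : forall h (e : R), S h -> 0 < e ->
  exists f, E f /\ N (h - (phi f : VG)) <= e.

Local Notation "f ~~ g" := (eqv S N (f : VG) (g : VG)) (at level 70).

(** The image of [phi], saturated under [~~]: since [phi] is linear only up to null vectors, its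
    bare image need not be a subspace. *)
Let D : set VG := [set g | exists2 f, E f & g ~~ phi f].

Let EB (f g : VE) : E f -> E g -> E (f - g).
Proof. by rewrite -scaleN1r; exact: EL. Qed.

Let Esum n (c : 'I_n -> C) (f : 'I_n -> VE) : (forall i, E (f i)) -> E (\sum_(i < n) c i *: f i).
Proof.
by move=> Ef; elim/big_ind: _ => // [f1 f2 h1 h2|i _];
  [rewrite -[f2]scale1r|rewrite -[_ *: _]add0r]; exact: EL.
Qed.

Let phi_lin c (f g : VE) : E f -> E g -> phi (f + c *: g) ~~ ((phi f : VG) + c *: (phi g : VG)).
Proof.
move=> Ef Eg; split; [exact/phiS/EL|exact/(banL BS)/phiS/Eg/phiS|exact: phiL].
Qed.

Let phi_B (f g : VE) : E f -> E g -> phi (f - g) ~~ ((phi f : VG) - (phi g : VG)).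
Proof. by move=> Ef Eg; have := phi_lin (-1) Ef Eg; rewrite !scaleN1r. Qed.

Let phi0 : phi (0 : VE) ~~ 0.
Proof.
have := phi_B E0 E0; rewrite !subrr; exact.
Qed.

Let phi_sum n (c : 'I_n -> C) (f : 'I_n -> VE) : (forall i, E (f i)) ->
  phi (\sum_(i < n) c i *: f i) ~~ \sum_(i < n) c i *: (phi (f i) : VG).
Proof.
elim: n c f => [|n IH] c f Ef; first by rewrite !big_ord0.
rewrite !big_ord_recr /=; apply: (eqv_trans BS (phi_lin _ _ _)) => //; first exact: Esum.
by apply: (eqvL BS); [exact: IH|apply: (eqv_refl BS); exact: phiS].
Qed.

Let B_eqv (f g : VG) : f ~~ g -> B f ~~ B g.
Proof.
move=> [Sf Sg fg]; have Sfg := banB BS Sf Sg.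
have h : B (f - g) ~~ ((B f : VG) - (B g : VG)).
  split; [exact: SB|by apply: (banB BS); exact: SB|].
  by have := linB (-1) Sf Sg; rewrite !scaleN1r.
have h0 : B (f - g) ~~ 0.
  apply/(eqv0 BS); split; first exact: SB.
  by apply/le_anti; rewrite (banN_ge0 BS) andbT (le_trans (bndB Sfg))// fg mulr0.
split; [exact: SB|exact: SB|].
by have /(eqv0 BS)[] := eqv_trans BS (eqv_sym BS h) h0.
Qed.

Let AB f : E f -> phi (A f) ~~ B (phi f).
Proof. by move=> Ef; split; [exact/phiS/EA|exact/SB/phiS|exact: phiAB]. Qed.

Let ZE0 f : E f -> ZE f <-> phi f ~~ 0.
Proof.
move=> Ef; split=> [/(phiZ Ef)h|/(eqv0 BS)[_ /(phiZ Ef)]//].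
by apply/(eqv0 BS); split => //; exact: phiS.
Qed.

Let Z0 (g : VG) : S g -> Z g <-> g ~~ 0.
Proof.
move=> Sg; split=> [/(ZN Sg)h|/(eqv0 BS)[_ /(ZN Sg)]//].
by apply/(eqv0 BS).
Qed.

Let kerD d : kerdim E ZE A d -> kerdim D Z B d.
Proof.
move=> [e [eE efree espan]]; have Ee i : E (e i) by have [] := eE i.
have Sp i : S (phi (e i)) by exact: phiS.
exists (fun i => phi (e i)); split.
- move=> i; split; first by exists (e i) => //; exact: (eqv_refl BS).
  apply/Z0; first exact: SB.
  by apply: (eqv_trans BS (eqv_sym BS (AB (Ee i)))); apply/ZE0; [exact: EA|have [] := eE i].
- move=> c Zc; apply: efree; rewrite lincombE; apply/ZE0; first exact: Esum.
  apply: (eqv_trans BS (phi_sum _ _)) => //; apply/Z0; first exact: (ban_sum BS).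
  by rewrite -lincombE.
move=> g [f Ef gf] Zg; have Sg : S g by case: gf.
have [|c Zc] := espan f Ef.
  apply/ZE0; first exact: EA.
  apply: (eqv_trans BS (AB Ef)); apply: (eqv_trans BS (B_eqv (eqv_sym BS gf))).
  by apply/Z0 => //; exact: SB.
exists c; have Es : E (\sum_(i < d) c i *: (e i : VE)) by exact: Esum.
have {}Zc : ZE (f - \sum_(i < d) c i *: (e i : VE)) by rewrite -lincombE.
suff : Z (g - \sum_(i < d) c i *: (phi (e i) : VG)) by rewrite -lincombE.
apply/Z0; first by apply: (banB BS) => //; exact: (ban_sum BS).
apply: (eqv_trans BS (eqvB BS gf (eqv_sym BS (phi_sum c Ee)))).
apply: (eqv_trans BS (eqv_sym BS (phi_B Ef Es))); apply/ZE0 => //; exact: EB.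
Qed.

Let cokerD d : cokerdim E ZE A d -> cokerdim D Z B d.
Proof.
move=> [e [Ee efree espan]].
have Sp i : S (phi (e i)) by exact: phiS.
exists (fun i => phi (e i)); split.
- by move=> i; exists (e i) => //; exact: (eqv_refl BS).
- move=> c g [f Ef gf] Zg; have Sg : S g by case: gf.
  have Es : E (\sum_(i < d) c i *: (e i : VE)) by exact: Esum.
  have {}Zg : Z (\sum_(i < d) c i *: (phi (e i) : VG) - (B g : VG)) by rewrite -lincombE.
  apply: (efree c f Ef).
  suff : ZE (\sum_(i < d) c i *: (e i : VE) - (A f : VE)) by rewrite -lincombE.
  apply/ZE0; first by apply: EB => //; exact: EA.
  apply: (eqv_trans BS (phi_B Es (EA Ef))).
  apply: (eqv_trans BS (eqvB BS (phi_sum c Ee) (AB Ef))).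
  apply: (eqv_trans BS (eqvB BS (eqv_refl BS _) (B_eqv (eqv_sym BS gf)))).
    exact: (ban_sum BS).
  by apply/Z0 => //; apply: (banB BS); [exact: (ban_sum BS)|exact: SB].
move=> h [f Ef hf]; have Sh : S h by case: hf.
have [c [f1 [Ef1 Zf]]] := espan f Ef; exists c, (phi f1).
have Es : E (\sum_(i < d) c i *: (e i : VE)) by exact: Esum.
have {}Zf : ZE (f - \sum_(i < d) c i *: (e i : VE) - (A f1 : VE)) by rewrite -lincombE.
split; first by exists f1 => //; apply: (eqv_refl BS); exact: phiS.
suff : Z (h - \sum_(i < d) c i *: (phi (e i) : VG) - (B (phi f1) : VG)) by rewrite -lincombE.
have SBf : S (B (phi f1)) by exact/SB/phiS.
apply/Z0; first by do 2 (apply: (banB BS) => //); exact: (ban_sum BS).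
apply: (eqv_trans BS (eqvB BS (eqvB BS hf (eqv_sym BS (phi_sum c Ee))) (eqv_sym BS (AB Ef1)))).
apply: (eqv_trans BS (eqvB BS (eqv_sym BS (phi_B Ef Es)) (eqv_refl BS (phiS (EA Ef1))))).
have Efs := EB Ef Es.
apply: (eqv_trans BS (eqv_sym BS (phi_B Efs (EA Ef1)))).
by apply/ZE0 => //; apply: EB => //; exact: EA.
Qed.

(** Stated for an abstract [phi] because it serves both cases: [phi] is the Fourier transform for
    [q <= 2] and its inverse for [p <= 2]. *)
Theorem kernel_transport k : fredholm_index E ZE A k -> fredholm_index S Z B k ->
  forall g : VG, S g -> Z (B g) -> exists f, [/\ E f, ZE (A f) & N (g - (phi f : VG)) = 0].
Proof.
move=> [_ [k1 [c1 [hk1 hc1 kE]]]] [_ [k2 [c2 [hk2 hc2 kG]]]] g Sg Zg.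
have DS : D `<=` S by move=> h [f _ []].
have D0 : D 0 by exists 0 => //; exact: (eqv_sym BS).
have DL c (h1 h2 : VG) : D h1 -> D h2 -> D (h1 + c *: h2).
  move=> [f1 Ef1 e1] [f2 Ef2 e2]; exists (f1 + c *: (f2 : VE)); first exact: EL.
  exact: (eqv_trans BS (eqvL BS c e1 e2) (eqv_sym BS (phi_lin _ Ef1 Ef2))).
have denseD (h : VG) (e : R) : S h -> 0 < e -> exists d, D d /\ N (h - d) <= e.
  move=> Sh e0; have [f [Ef fe]] := dense Sh e0; exists (phi f); split => //.
  by exists f => //; apply: (eqv_refl BS); exact: phiS.
have idx : k1%:Z - c1%:Z = k2%:Z - c2%:Z by rewrite -kE.
have [h [[f Ef hf] Zgh]] := kernel_dense BS ZN SB linB K0 bndB DS D0 DL denseD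
  (kerD hk1) (cokerD hc1) hk2 hc2 idx Sg Zg.
have Sh : S h by case: hf.
have gh : g ~~ h by split => //; apply/ZN => //; exact: (banB BS).
have gf := eqv_trans BS gh hf; exists f; split => //; last by case: gf.
apply/ZE0; first exact: EA.
apply: (eqv_trans BS (AB Ef)); apply: (eqv_trans BS (B_eqv (eqv_sym BS gf))).
by apply/Z0 => //; exact: SB.
Qed.

End Transport.

(** * The Fourier transform between H^q and l^p *)

Section Fourier_transform.
Variable R : realType.
Local Notation C := R[i].
Local Notation mu := (@lebesgue_measure R).
Local Notation D := (@Tdom R).
Local Notation lLS := (LS (@counting nat R) setT).
Local Notation lnrm := (nrm (@counting nat R) setT).
Local Notation LS := (LS mu D).
Local Notation nrm := (nrm mu D).
Local Notation cmeas := (@cmeas _ (measurableTypeR R) R D).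
Local Notation mD := (@measurable_Tdom R).
Implicit Types (f g : R -> C) (x y : nat -> C) (s p q : R).

Lemma hausdorff_young q : 1 < q -> q <= 2 -> exists2 c : R, 0 <= c & forall f, LS q f ->
  lLS (conjex q) (fourier_plus f) /\ lnrm (conjex q) (fourier_plus f) <= c * nrm q f.
Proof.
move=> q1 q2; have [q0 c1 qc] := conjexP q1; have c0 := lt_trans ltr01 c1.
suff [c cge H] : exists2 c : R, 0 <= c & forall f N, LS q f ->
    \sum_(k < N) cabs (fc f (Posz k)) `^ conjex q <= c * nrm q f `^ conjex q.
  exists (c `^ (conjex q)^-1); first exact: powR_ge0.
  move=> f Lf; apply: lnrm_le_sums => //; first by rewrite mulr_ge0 ?powR_ge0 ?nrm_ge0.
  move=> N; rewrite powRM ?powR_ge0 ?nrm_ge0// -powRrM mulVf ?gt_eqF// powRr1//.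
  exact: H.
move: q2; rewrite le_eqVlt => /predU1P[q2|q2]; last exact: hausdorff_young_lt2.
have qq : conjex q = 2 by rewrite /conjex q2 -[X in X - _]mul1r; field.
exists (2 / pi); first by rewrite divr_ge0// pi_ge0.
move=> f N; rewrite qq q2 => Lf; rewrite powR_mulrn ?nrm_ge0//.
apply: le_trans (bessel N Lf); rewrite le_eqVlt; apply/orP; left.
by apply/eqP; apply: eq_bigr => k _; rewrite powR_mulrn// cabs_ge0.
Qed.

Lemma lnrm_cutoff s N x : 0 < s -> lLS s x -> lnrm s (cutoff N x) <= lnrm s x.
Proof.
move=> s0 Lx; apply: (LS_le measurableT s0 (cmeas_nat _) Lx _).2 => k _.
by rewrite /cutoff; case: ifP => // _; rewrite cabs0 cabs_ge0.
Qed.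

(** The dual form of Hausdorff-Young: up to conjugation, pairing the polynomial with a test function
    [g] is pairing [x] with the coefficients of the conjugate of [g]. *)
Lemma psum_bound p : 1 < p -> p <= 2 -> exists2 c : R, 0 <= c & forall x N,
  nrm (conjex p) (psum N x) <= c * lnrm p (cutoff N x).
Proof.
move=> p1 p2; have [c cge H] := hausdorff_young p1 p2.
have [p0 q1 pq] := conjexP p1; have q0 := lt_trans ltr01 q1.
exists (2 * pi * c); first by rewrite mulr_ge0// mulr_ge0// pi_ge0.
move=> x N; rewrite -mulrA; have tS := psum_trigpoly N x.
have LSq := trigpoly_LS (ltW q1) tS; have Lx := LS_cutoff N x p0.
apply: (nrm_le_test q1 LSq); first by rewrite mulr_ge0// nrm_ge0.
move=> g tg; rewrite conjexK//.
have tcg := trigpoly_conj tg; have Lg := trigpoly_LS (ltW p1) tcg.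
have [LF nF] := H _ Lg.
have E : av (fun t : R => psum N x t * g t) =
    conjc (\sum_(k < N) conjc (x k) * fc (fun t : R => conjc (g t)) (Posz k)).
  rewrite -pairing_psum; last exact: trigpoly_cint.
  have ci : cint (fun t => psum N x t * g t) by apply: trigpoly_cint; exact: trigpolyM.
  rewrite -[LHS]conjcK -(av_conj ci); congr conjc; apply: eq_av => t _.
  by rewrite conjcM mulrC.
rewrite E cabs_conj; apply: (le_trans (cabs_sum _ _ _)).
have -> : \sum_(k < N) cabs (conjc (x k) * fc (fun t : R => conjc (g t)) (Posz k)) =
    \sum_(k < N) cabs (cutoff N x k * fourier_plus (fun t : R => conjc (g t)) k).
  by apply: eq_bigr => k _; rewrite !cabsM cabs_conj /cutoff ltn_ord.
apply: (le_trans (lsum_hoelder N p0 q0 pq Lx LF)).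
rewrite mulrAC mulrC ler_wpM2r ?nrm_ge0//; apply: (le_trans nF).
by rewrite ler_wpM2l// nrm_conj.
Qed.

Lemma psum_cutoff N M x t : (N <= M)%N -> psum M (cutoff N x) t = psum N x t.
Proof.
move=> NM; rewrite /psum -(big_mkord xpredT (fun k => cutoff N x k * ex (Posz k) t)).
rewrite -(big_mkord xpredT (fun k => x k * ex (Posz k) t)) (big_cat_nat (leq0n N) NM)/=.
rewrite [X in _ + X]big_nat [X in _ + X]big1 ?addr0; last first.
  by move=> k /andP[Nk _]; rewrite /cutoff ltnNge Nk mul0r.
by rewrite !big_nat; apply: eq_bigr => k /andP[_ kN]; rewrite /cutoff kN.
Qed.

(** The partial sums are Cauchy by [psum_bound] applied to tails of [x]. The last clause provides
    one [N] good for the function and the sequence at once, as [fc_TH_Hardy] requires. *)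
Lemma inverse_fourier p : 1 < p -> p <= 2 -> exists2 c : R, 0 <= c & forall x, lLS p x ->
  exists h, [/\ LS (conjex p) h, forall n : int, n < 0 -> fc h n = 0,
    fourier_plus h = x, nrm (conjex p) h <= c * lnrm p x &
    forall e : R, 0 < e -> exists N, nrm (conjex p) (fun t => h t - psum N x t) <= e /\
       lnrm p (fun k => x k - cutoff N x k) <= e].
Proof.
move=> p1 p2; have [c cge H] := psum_bound p1 p2.
have [p0 q1 pq] := conjexP p1; have q0 := lt_trans ltr01 q1; set q := conjex p in q1 pq q0 H *.
exists c => // x Lx.
have LP N y : LS q (psum N y) by apply: trigpoly_LS; [exact: ltW|exact: psum_trigpoly].
have tail n m : (n <= m)%N -> lnrm p (fun k => x k - cutoff m x k) <= lnrm p (fun k => x k - cutoff n x k).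
  move=> nm; have Ln := (LSB measurableT (ltW p1) Lx (LS_cutoff n x p0)).1.
  apply: (LS_le measurableT p0 (cmeas_nat _) Ln _).2 => k _.
  rewrite /cutoff; case: ltnP => km; first by rewrite subrr cabs0 cabs_ge0.
  by rewrite ltnNge (leq_trans nm km) /= subr0.
have diff n m : (n <= m)%N -> nrm q (fun t => psum m x t - psum n x t) <=
    c * lnrm p (fun k => x k - cutoff n x k).
  move=> nm; have -> : nrm q (fun t => psum m x t - psum n x t) =
      nrm q (psum m (fun k => x k - cutoff n x k)).
    apply: eq_nrm => t _; rewrite -(psum_cutoff x t nm) /psum -sumrB.
    by apply: eq_bigr => k _; rewrite mulrBl.
  apply: (le_trans (H (fun k => x k - cutoff n x k) m)); apply: (ler_wpM2l cge).
  exact: (lnrm_cutoff m p0 (LSB measurableT (ltW p1) Lx (LS_cutoff n x p0)).1).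
have c1 : 0 < c + 1 by rewrite ltr_wpDl.
have tail_small (e : R) : 0 < e -> exists N, forall m, (N <= m)%N ->
    lnrm p (fun k => x k - cutoff m x k) <= e.
  by move=> e0; have [N hN] := cutoff_cvg p0 e0 Lx; exists N => m Nm; exact: le_trans (tail _ _ Nm) hN.
have [h [Lh hP]] : exists h, LS q h /\ forall e : R, 0 < e -> exists N, forall m,
    (N <= m)%N -> nrm q (fun t => h t - psum m x t) <= e.
  apply: (LS_complete mD (ltW q1) (w := fun N => psum N x)) => // e e0.
  have [|N hN] := tail_small (e / (c + 1)); first by rewrite divr_gt0.
  exists N => m Nm; apply: (le_trans (diff _ _ Nm)).
  apply: (@le_trans _ _ (c * (e / (c + 1)))); first by rewrite ler_wpM2l// hN.
  by rewrite mulrCA ger_pMr// ler_pdivrMr ?mul1r ?lerDl.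
have fch n : forall e : R, 0 < e -> exists N, forall m, (N <= m)%N ->
    cabs (fc h n - fc (psum m x) n) <= e.
  move=> e e0; have K1 : 0 < Kav q + 1 by rewrite ltr_wpDl// Kav_ge0.
  have [|N hN] := hP (e / (Kav q + 1)); first by rewrite divr_gt0.
  exists N => m Nm; have [Lb _] := LSB mD (ltW q1) Lh (LP m x).
  rewrite -fcB; [|exact: LS_cint q1 Lh|exact: LS_cint q1 (LP m x)].
  apply: (le_trans (fc_nrm n q1 Lb)); apply: (@le_trans _ _ (Kav q * (e / (Kav q + 1)))).
    by rewrite ler_wpM2l ?Kav_ge0// hN.
  by rewrite mulrCA ger_pMr// ler_pdivrMr ?mul1r ?lerDl.
have eq_small (z w : C) : (forall e : R, 0 < e -> cabs (z - w) <= e) -> z = w.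
  move=> hz; apply/eqP; rewrite -subr_eq0; apply/eqP/cabs_eq0/le_anti.
  by rewrite cabs_ge0 andbT; apply/ler_addgt0Pr => e /hz; rewrite add0r.
exists h; split => //.
- move=> n n0; apply: eq_small => e /(fch n)[N /(_ N (leqnn N))].
  by rewrite fc_psum_neg.
- apply/funext => n; apply: eq_small => e /(fch (Posz n))[N /(_ (maxn N n.+1) (leq_maxl _ _))].
  by rewrite fc_psum_nat /cutoff (leq_maxr N n.+1).
- apply/ler_addgt0Pr => e e0; have [N /(_ N (leqnn N)) hN] := hP e e0.
  have [_] := LSD mD (ltW q1) (LSB mD (ltW q1) Lh (LP N x)).1 (LP N x).
  rewrite (eq_nrm mu q (g := h)); last by move=> t _; rewrite subrK.
  move=> le; apply: (le_trans le); rewrite addrC lerD//.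
  by apply: (le_trans (H _ _)); rewrite ler_wpM2l// lnrm_cutoff.
move=> e e0; have [N1 h1] := hP e e0; have [N2 h2] := tail_small e e0.
by exists (maxn N1 N2); split; [apply: h1; exact: leq_maxl|apply: h2; exact: leq_maxr].
Qed.

(** For a trigonometric polynomial [u] near [f], the projection of [f - u] is [f] minus the analytic
    part of [u], and it is small because the projection is bounded. *)
Lemma analytic_dense q f (e : R) : 1 < q -> 0 < e -> Hs q f ->
  exists N x, nrm q (fun t => f t - psum N x t) <= e.
Proof.
move=> q1 e0 [Lf f0]; have q1' := ltW q1; have q0 := lt_trans ltr01 q1.
have {}Lf : LS q f := Lf.
have [c c0 H] := riesz_projection q1.
have c1 : 0 < c + 1 by rewrite ltr_wpDl.
have ec : 0 < e / (c + 1) by rewrite divr_gt0.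
have [u tu fu] := trigpoly_dense q1' ec Lf.
have [l ul] := trigpoly_tsum tu.
have Lu := trigpoly_LS q1' tu.
have [Lfu _] := LSB mD q1' Lf Lu.
have [h [Lh fh nh]] := H _ Lfu.
(* [N] exceeds every frequency in [l], so the partial sum contains the whole analytic part of
   [u]. *)
pose x k := fc u (Posz k); pose N := (\sum_(v <- l) `|v.2|%N).+1.
have x0 k : (N <= k)%N -> x k = 0.
  move=> Nk; rewrite /x ul fc_tsum big_seq big1// => v vl; case: eqP => [vk|]; rewrite ?mulr0//.
  have : (`|v.2| <= \sum_(w <- l) `|w.2|)%N by rewrite (big_rem v)//= leq_addr.
  by rewrite vk /= leqNgt; rewrite Nk.
have LP : LS q (psum N x) by apply: trigpoly_LS => //; exact: psum_trigpoly.
have [Lfp _] := LSB mD q1' Lf LP.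
exists N, x; have -> : nrm q (fun t => f t - psum N x t) = nrm q h.
  apply: (LS_ae mD q0 Lh Lfp.1 _).2; apply: (fc_inj q1 Lfp Lh) => n.
  rewrite fh fcB; [|exact: LS_cint q1 Lf|exact: LS_cint q1 LP].
  rewrite fcB; [|exact: LS_cint q1 Lf|exact: LS_cint q1 Lu].
  case: n => n.
    rewrite fc_psum_nat /cutoff /=; case: ifP => // Nn.
    by rewrite -/(x n) x0// leqNgt Nn.
  by rewrite f0// fc_psum_neg// subrr.
apply: (le_trans nh); apply: (@le_trans _ _ (c * (e / (c + 1)))); first by rewrite ler_wpM2l.
by rewrite mulrCA ger_pMr// ler_pdivrMr ?mul1r ?lerDl.
Qed.

End Fourier_transform.

(** * Toeplitz plus Hankel operators on l^p *)

Section Multipliers.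
Variable R : realType.
Local Notation C := R[i].
Local Notation LS := (LS (@counting nat R) setT).
Local Notation nrm := (nrm (@counting nat R) setT).
Implicit Types (x y : nat -> C) (j n m N : nat).

Section Matrix_operator.
Variables (p K : R) (A : nat -> nat -> C).
Hypotheses (p1 : 1 < p) (K0 : 0 <= K).

(** Toeplitz and Hankel operators are treated together, as infinite matrices whose sections by
    finitely many columns are uniformly bounded ([bnd]); [Tp] and [Hp] unfold to instances of
    [matop]. *)
Definition matsum N x j : C := \sum_(k < N) A j k * x k.
Definition matop x j : C := climit (fun N => matsum N x j).

Hypothesis bnd : forall N x, LS p (matsum N x) /\ nrm p (matsum N x) <= K * nrm p (cutoff N x).

Let p0 : 0 < p. Proof. exact: lt_trans p1. Qed.

Lemma matsum_cutoff N M x j : (N <= M)%N -> matsum M (cutoff N x) j = matsum N x j.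
Proof.
move=> NM; rewrite /matsum -(big_mkord xpredT (fun k => A j k * cutoff N x k)).
rewrite -(big_mkord xpredT (fun k => A j k * x k)) (big_cat_nat (leq0n N) NM)/=.
rewrite [X in _ + X]big_nat [X in _ + X]big1 ?addr0; last first.
  by move=> k /andP[Nk _]; rewrite /cutoff ltnNge Nk mulr0.
by rewrite !big_nat; apply: eq_bigr => k /andP[_ kN]; rewrite /cutoff kN.
Qed.

Let limit x : LS p x -> exists y, [/\ LS p y, nrm p y <= K * nrm p x &
  forall j, ccvg (fun N => matsum N x j) (y j)].
Proof.
move=> Lx; have p1' := ltW p1.
have Lc N := (LSB measurableT p1' Lx (LS_cutoff N x p0)).1.
have diff n m : (n <= m)%N -> nrm p (fun j => matsum m x j - matsum n x j) <=
    K * nrm p (fun k => x k - cutoff n x k).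
  move=> nm; have -> : nrm p (fun j => matsum m x j - matsum n x j) =
      nrm p (matsum m (fun k => x k - cutoff n x k)).
    apply: eq_nrm => j _; rewrite -(matsum_cutoff x j nm) /matsum -sumrB.
    by apply: eq_bigr => k _; rewrite mulrBr.
  apply: (le_trans (bnd m (fun k => x k - cutoff n x k)).2); apply: (ler_wpM2l K0).
  exact: (lnrm_cutoff m p0 (Lc n)).
have K1 : 0 < K + 1 by rewrite ltr_wpDl.
have tail n m : (n <= m)%N -> nrm p (fun k => x k - cutoff m x k) <= nrm p (fun k => x k - cutoff n x k).
  move=> nm; apply: (LS_le measurableT p0 (cmeas_nat _) (Lc n) _).2 => k _.
  rewrite /cutoff; case: ltnP => km; first by rewrite subrr cabs0 cabs_ge0.
  by rewrite ltnNge (leq_trans nm km) /= subr0.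
have [y [Ly yP]] : exists y, LS p y /\ forall e : R, 0 < e -> exists N, forall m,
    (N <= m)%N -> nrm p (fun j => y j - matsum m x j) <= e.
  apply: (LS_complete measurableT p1' (w := fun N => matsum N x)) => [N|e e0].
    exact: (bnd N x).1.
  have e1 : 0 < e / (K + 1) by rewrite divr_gt0.
  have [N hN] := cutoff_cvg p0 e1 Lx; exists N => m Nm.
  apply: (le_trans (diff _ _ Nm)); apply: (@le_trans _ _ (K * (e / (K + 1)))).
    exact: ler_wpM2l.
  by rewrite mulrCA ger_pMr// ler_pdivrMr ?mul1r ?lerDl.
have Lym m := (LSB measurableT p1' Ly (bnd m x).1).1.
exists y; split => //.
  apply/ler_addgt0Pr => e e0; have [N /(_ N (leqnn N)) hN] := yP e e0.
  have [_] := LSD measurableT p1' (Lym N) (bnd N x).1.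
  rewrite (eq_nrm _ p (g := y)); last by move=> j _; rewrite subrK.
  move=> le; apply: (le_trans le); rewrite addrC lerD//.
  by apply: (le_trans (bnd N x).2); exact: (ler_wpM2l K0 (lnrm_cutoff N p0 Lx)).
move=> j; apply/ccvgP; apply/cvgr0Pnorm_le => e e0; have [N hN] := yP e e0.
exists N => // m /= Nm; rewrite ger0_norm ?cabs_ge0// cabsBC.
exact: le_trans (cabs_le_lnrm j p0 (Lym m)) (hN _ Nm).
Qed.

Lemma matopP x : LS p x -> [/\ LS p (matop x), nrm p (matop x) <= K * nrm p x &
  forall j, ccvg (fun N => matsum N x j) (matop x j)].
Proof.
move=> /limit[y [Ly ny yP]]; suff -> : matop x = y by [].
by apply/funext => j; exact: ccvg_climit.
Qed.

Lemma matop_lin c x y : LS p x -> LS p y ->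
  matop (fun k => x k + c * y k) = fun j => matop x j + c * matop y j.
Proof.
move=> /matopP[_ _ hx] /matopP[_ _ hy]; apply/funext => j; apply: ccvg_climit.
have := ccvgD (hx j) (ccvgZ c (hy j)); congr ccvg; apply/funext => N.
by rewrite /matsum mulr_sumr -big_split; apply: eq_bigr => k _; rewrite mulrDr mulrCA.
Qed.

Lemma matop_cutoff N x j : matop (cutoff N x) j = matsum N x j.
Proof.
have [_ _ /(_ j) h] := matopP (LS_cutoff N x p0).
apply: (ccvg_unique (ccvg_shift N h)).
have -> : (fun n => matsum (N + n) (cutoff N x) j) = fun=> matsum N x j.
  by apply/funext => n; rewrite matsum_cutoff// leq_addr.
exact: ccvg_cst.
Qed.

End Matrix_operator.

Lemma esum_nrm s x : 0 < s -> LS s x ->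
  (\esum_(k in [set: nat]) ((cabs (x k)) `^ s)%:E)%E = (nrm s x `^ s)%:E.
Proof.
move=> s0 Lx; rewrite -nneseries_esumT; last by move=> k; rewrite lee_fin powR_ge0.
by rewrite -integral_cnt (nrm_powR s0 Lx).
Qed.

Lemma esum_inj_le (e : nat -> int) (a : int -> \bar R) : injective e ->
  (forall k, 0 <= a k)%E ->
  (\esum_(n in [set: nat]) a (e n) <= \esum_(k in [set: int]) a k)%E.
Proof.
move=> inje a0; rewrite -(@reindex_esum _ _ _ setT (range e) e a).
  rewrite esum_mkcond; apply: le_esum => k _; case: ifP => _ //; exact: a0.
by split; [move=> n _; exists n|move=> n m _ _ /inje|].
Qed.

Lemma esum_inj (e : nat -> int) (a : int -> \bar R) : injective e ->
  (forall k, (~ exists n, e n = k) -> a k = 0%E) ->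
  (\esum_(k in [set: int]) a k = \esum_(n in [set: nat]) a (e n))%E.
Proof.
move=> inje a0; rewrite -(@reindex_esum _ _ _ setT (range e) e a).
  rewrite [RHS]esum_mkcond; apply: eq_esum => k _; case: ifPn => // /negP h.
  by apply: a0 => -[n nk]; apply: h; rewrite inE; exists n.
by split; [move=> n _; exists n|move=> n m _ _ /inje|].
Qed.

Lemma laurent_toeplitz (a : R -> C) N y j :
  LaurentN a N (fun k => if k is Posz n then cutoff N y n else 0) (Posz j) =
  matsum (fun j k => fc a (Posz j - Posz k)) N y j.
Proof.
pose x (k : int) : C := if k is Posz n then cutoff N y n else 0.
rewrite -[LHS]/(LaurentN a N x (Posz j)) /LaurentN.
rewrite -(big_mkord xpredT (fun i => fc a (Posz j - (i%:Z - N%:Z)) * x (i%:Z - N%:Z))).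
have NN : (N <= (N + N).+1)%N by rewrite -addnS leq_addr.
(* The first [N] of the [2 N + 1] indices are negative, where the sequence vanishes. *)
rewrite (big_cat_nat (leq0n N) NN)/= big_nat big1 ?add0r; last first.
  move=> i /andP[_ iN]; have -> : i%:Z - N%:Z = Negz (N - i.+1).
    by rewrite NegzE subnSK// -subzn ?(ltnW iN)// opprB.
  by rewrite mulr0.
(* The last index is [N], one past the support of the cutoff. *)
rewrite -{1}[N]add0n big_addn -addnS addKn big_nat_recr//=.
rewrite -[(N + N)%:Z]/((N + N)%:Z) PoszD addrK /x /= {2}/cutoff ltnn mulr0 addr0.
rewrite big_mkord /matsum; apply: eq_bigr => k _.
by rewrite PoszD addrK /cutoff ltn_ord.
Qed.

(* The Hankel matrix is the block of the Laurent matrix from the negative to the nonnegative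
   half-axis, hence the substitution [x_(-k-1) = y_k]. *)
Lemma laurent_hankel (a : R -> C) N y j :
  LaurentN a N (fun k => if k is Negz n then cutoff N y n else 0) (Posz j) =
  matsum (fun j k => fc a (Posz j + Posz k + 1)) N y j.
Proof.
pose x (k : int) : C := if k is Negz n then cutoff N y n else 0.
rewrite -[LHS]/(LaurentN a N x (Posz j)) /LaurentN.
rewrite -(big_mkord xpredT (fun i => fc a (Posz j - (i%:Z - N%:Z)) * x (i%:Z - N%:Z))).
have NN : (N <= (N + N).+1)%N by rewrite -addnS leq_addr.
rewrite (big_cat_nat (leq0n N) NN)/= [X in _ + X]big_nat [X in _ + X]big1 ?addr0; last first.
  by move=> i /andP[Ni _]; rewrite subzn// mulr0.
rewrite big_mkord (reindex_inj rev_ord_inj) /matsum /=; apply: eq_bigr => k _.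
have kN := ltn_ord k.
have -> : (N - k.+1)%:Z - N%:Z = Negz k.
  by rewrite NegzE -subzn// addrAC subrr add0r.
by rewrite /x /cutoff kN NegzE opprK -addn1 PoszD addrA.
Qed.

Section Bounded_multiplier.
Variables (p : R) (a : R -> C).
Hypotheses (p1 : 1 < p) (Ma : Mp p a).

Let p0 : 0 < p. Proof. exact: lt_trans p1. Qed.

(** [e] embeds the half-line into the integers, by [Posz] for Toeplitz and by [Negz] for Hankel
    operators. The output is restricted to nonnegative indices, which can only lower the norm. *)
Let laurent_bound : exists2 K : R, 0 <= K & forall (e : nat -> int) (x : int -> C) N y z,
  injective e -> (forall n, x (e n) = cutoff N y n) -> (forall k, (~ exists n, e n = k) -> x k = 0) ->
  (forall k : int, N%:Z < `|k| -> x k = 0) -> (forall j, LaurentN a N x (Posz j) = z j) ->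
  LS p z /\ nrm p z <= K * nrm p (cutoff N y).
Proof.
(* The constant in [Mp] carries no sign; the root of its power is a nonnegative substitute. *)
have [_ [K HK]] := Ma; exists ((K `^ p) `^ p^-1); first exact: powR_ge0.
move=> e x N y z inje xe x0 xN zE; have Lc := LS_cutoff N y p0.
apply: (nrm_le p0 _ (cmeas_nat z)); first by rewrite mulr_ge0 ?powR_ge0 ?nrm_ge0.
rewrite integral_cnt nneseries_esumT; last by move=> k; rewrite lee_fin powR_ge0.
have injP : injective Posz by move=> n m [].
have := esum_inj_le (a := fun k => (cabs (LaurentN a N x k) `^ p)%:E) injP
  (fun k => (powR_ge0 _ _ : (0%:E <= _%:E)%E)).
under eq_esum do rewrite zE.
move=> le; apply: (le_trans le); apply: (le_trans (HK N x xN)).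
rewrite (esum_inj inje); last first.
  by move=> k /x0 ->; rewrite cabs0 powR0// gt_eqF.
under eq_esum do rewrite xe.
rewrite (esum_nrm p0 Lc) -EFinM lee_fin powRM ?powR_ge0 ?nrm_ge0//.
by rewrite -powRrM mulVf ?gt_eqF// powRr1 ?powR_ge0.
Qed.

Lemma toeplitz_bound : exists2 K : R, 0 <= K & forall N y,
  LS p (matsum (fun j k => fc a (Posz j - Posz k)) N y) /\
  nrm p (matsum (fun j k => fc a (Posz j - Posz k)) N y) <= K * nrm p (cutoff N y).
Proof.
have [K K0 H] := laurent_bound; exists K => // N y.
apply: (H Posz (fun k => if k is Posz n then cutoff N y n else 0)) => //.
- by move=> n m [].
- by case=> [n nex|//]; exfalso; apply: nex; exists n.
- by case=> [n|//]; rewrite ger0_norm// ltz_nat /cutoff => Nn; rewrite ltnNge (ltnW Nn).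
- by move=> j; exact: laurent_toeplitz.
Qed.

Lemma hankel_bound : exists2 K : R, 0 <= K & forall N y,
  LS p (matsum (fun j k => fc a (Posz j + Posz k + 1)) N y) /\
  nrm p (matsum (fun j k => fc a (Posz j + Posz k + 1)) N y) <= K * nrm p (cutoff N y).
Proof.
have [K K0 H] := laurent_bound; exists K => // N y.
apply: (H Negz (fun k => if k is Negz n then cutoff N y n else 0)) => //.
- by move=> n m [].
- by case=> [//|n nex]; exfalso; apply: nex; exists n.
- case=> [//|n]; rewrite NegzE normrN ger0_norm// ltz_nat /cutoff => Nn.
  by rewrite ltnNge -ltnS Nn.
- by move=> j; exact: laurent_hankel.
Qed.

End Bounded_multiplier.

Lemma TH_lpP (p : R) (a b : R -> C) : 1 < p -> Mp p a -> Mp p b ->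
  [/\ exists2 K : R, 0 <= K & forall x, LS p x ->
        LS p (TH_lp a b x) /\ nrm p (TH_lp a b x) <= K * nrm p x,
      forall c x y, LS p x -> LS p y ->
        TH_lp a b (fun k => x k + c * y k) = fun j => TH_lp a b x j + c * TH_lp a b y j &
      forall N x j, TH_lp a b (cutoff N x) j =
        \sum_(k < N) (fc a (Posz j - Posz k) + fc b (Posz j + Posz k + 1)) * x k].
Proof.
move=> p1 Ma Mb; have [K1 K10 H1] := toeplitz_bound p1 Ma.
have [K2 K20 H2] := hankel_bound p1 Mb.
split.
- exists (K1 + K2); first by rewrite addr_ge0.
  move=> x Lx; have [L1 n1 _] := matopP p1 K10 H1 Lx; have [L2 n2 _] := matopP p1 K20 H2 Lx.
  have [L3 n3] := LSD measurableT (ltW p1) L1 L2; split; first exact: L3.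
  by apply: (le_trans n3); rewrite mulrDl lerD.
- move=> c x y Lx Ly; apply/funext => j.
  have h1 := congr1 (fun u => u j) (matop_lin p1 K10 H1 c Lx Ly).
  have h2 := congr1 (fun u => u j) (matop_lin p1 K20 H2 c Lx Ly).
  by apply: (etrans (congr2 +%R h1 h2)); rewrite /TH_lp mulrDr addrACA.
move=> N x j.
apply: (etrans (congr2 +%R (matop_cutoff p1 K10 H1 N x j) (matop_cutoff p1 K20 H2 N x j))).
by rewrite /matsum -big_split; apply: eq_bigr => k _; rewrite mulrDl.
Qed.

End Multipliers.

(** * Toeplitz plus Hankel operators on H^q *)

Section Hardy.
Variable R : realType.
Local Notation C := R[i].
Local Notation mu := (@lebesgue_measure R).
Local Notation D := (@Tdom R).
Local Notation lLS := (LS (@counting nat R) setT).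
Local Notation lnrm := (nrm (@counting nat R) setT).
Local Notation LS := (LS mu D).
Local Notation nrm := (nrm mu D).
Local Notation cmeas := (@cmeas _ (measurableTypeR R) R D).
Local Notation mD := (@measurable_Tdom R).
Implicit Types (f g : R -> C) (s p q : R).

Let refl (x : R) : measurableTypeR R := 2 * pi - x.

Let mrefl : measurable_fun setT (refl : measurableTypeR R -> measurableTypeR R).
Proof. by apply: measurable_funB; [exact: measurable_cst|exact: measurable_id]. Qed.

Let refl_preim : refl @^-1` D = D.
Proof.
apply/seteqP; split=> x; rewrite /Tdom /refl /= => /andP[h1 h2]; apply/andP; split; lra.
Qed.

(** By uniqueness of Lebesgue measure: the preimage of a half-open interval is a half-open interval
    of the same length. *)
Let refl_measure (A : set R) : measurable A ->
  pushforward mu (refl : _ -> measurableTypeR R) A = mu A.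
Proof.
move=> mA; apply/esym/lebesgue_measure_unique => //= _ [[a b]] _ <-.
have -> : pushforward mu (refl : _ -> measurableTypeR R) `]a, b] =
    mu `[2 * pi - b, 2 * pi - a[%classic.
  rewrite /pushforward; congr (mu _); apply/seteqP; split=> x /=.
    by rewrite /refl !in_itv/= => /andP[h1 h2]; apply/andP; split; lra.
  by rewrite /refl !in_itv/= => /andP[h1 h2]; apply/andP; split; lra.
rewrite !lebesgue_measure_itv/= !lte_fin ltrD2l ltrN2; case: ifP => // _.
by rewrite -!EFinB; congr EFin; ring.
Qed.

Let integral_refl (g : R -> \bar R) : measurable_fun D g -> (forall x, 0 <= g x)%E ->
  (\int[mu]_(x in D) g (2 * pi - x)%R = \int[mu]_(x in D) g x)%E.
Proof.
move=> mg g0; transitivity (\int[pushforward mu (refl : _ -> measurableTypeR R)]_(x in D) g x)%E.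
  rewrite (ge0_integral_pushforward mrefl _ mD mg (fun x _ => g0 x)).
  by rewrite refl_preim.
by apply: eq_measure_integral => A mA _; exact: refl_measure.
Qed.

Lemma LS_reflect s f : 0 < s -> LS s f ->
  LS s (fun x => f (2 * pi - x)) /\ nrm s (fun x => f (2 * pi - x)) = nrm s f.
Proof.
move=> s0 [[m1 m2] fi].
have sub : [set refl x | x in D] `<=` D by move=> _ [x Dx <-]; rewrite -refl_preim in Dx.
have mD' : measurable (D : set (measurableTypeR R)) by exact: mD.
have mr : measurable_fun (D : set (measurableTypeR R)) (refl : measurableTypeR R -> measurableTypeR R).
  exact: measurable_funTS.
have mc : cmeas (fun x => f (2 * pi - x)).
  split.
    exact: (measurable_comp mD' sub m1 mr).
  exact: (measurable_comp mD' sub m2 mr).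
have E : (\int[mu]_(x in D) ((cabs (f (2 * pi - x))) `^ s)%:E =
    \int[mu]_(x in D) ((cabs (f x)) `^ s)%:E)%E.
  apply: (integral_refl (g := fun x => ((cabs (f x)) `^ s)%:E)).
    by apply/measurable_EFinP; apply: measurable_cabs_powR.
  by move=> x; rewrite lee_fin powR_ge0.
split; last by rewrite !nrmE E.
by split; [exact: mc|rewrite E].
Qed.

Lemma nrm_subE s f g :
  nrm s (fun x => f x + (-1) * g x) = nrm s (fun x => f x - g x).
Proof. by apply: eq_nrm => x _; rewrite mulN1r. Qed.

Lemma nrm_le_sub s f g : 1 <= s -> LS s f -> LS s g ->
  nrm s g <= nrm s f + nrm s (fun x => f x - g x).
Proof.
move=> s1 Lf Lg; have [Lfg _] := LSB mD s1 Lf Lg; have [_] := LSB mD s1 Lf Lfg.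
by rewrite (eq_nrm mu s (g := g))// => x _; rewrite opprB addrC subrK.
Qed.

Lemma LS_Jflip s f : 0 < s -> LS s f -> LS s (Jflip f) /\ nrm s (Jflip f) = nrm s f.
Proof.
move=> s0 Lf; have [Lr nr] := LS_reflect s0 Lf; rewrite -nr.
have mJ : cmeas (Jflip f).
  apply: cmeasM; last exact: Lr.1.
  by apply: cmeas_cexpi => x; apply: cvgN; exact: cvg_id.
apply: (LS_eq_cabs s0 mJ Lr).
by move=> x _; rewrite /Jflip cabsM cabs_cexpi mul1r.
Qed.

Lemma Jflip_ex (k : nat) (x : R) : Jflip (ex (Posz k)) x = ex (Negz k) x.
Proof.
rewrite /Jflip ex_2pi NegzE intS opprD exD; congr (_ * _).
by rewrite /ex mulN1r.
Qed.

Lemma Jflip_psum N c (x : R) : Jflip (psum N c) x = \sum_(k < N) c k * ex (Negz k) x.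
Proof.
rewrite {1}/Jflip /psum mulr_sumr; apply: eq_bigr => k _.
by rewrite mulrCA -Jflip_ex.
Qed.

(** [riesz_projection] makes the set of candidates nonempty, so [xget] picks a member of it;
    uniqueness of Fourier coefficients carries the norm bound over. *)
Lemma Rproj_spec s : 1 < s -> exists2 c : R, 0 <= c & forall g, LS s g ->
  [/\ LS s (Rproj s g), forall n : int, fc (Rproj s g) n = if 0 <= n then fc g n else 0 &
      nrm s (Rproj s g) <= c * nrm s g].
Proof.
move=> s1; have s0 := lt_trans ltr01 s1; have [c c0 H] := riesz_projection s1.
exists c; first exact: c0.
move=> g Lg; have [h [Lh hg nh]] := H g Lg.
have [] : [set h | Ls s h /\ forall n : int, fc h n = if 0 <= n then fc g n else 0] (Rproj s g).
  by apply: xgetPex; exists h; split => //; exact: Lh.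
move=> LR fR; have {}LR : LS s (Rproj s g) := LR; split => //.
have [_ ->] := LS_ae mD s0 Lh LR.1 (fc_inj s1 LR Lh (fun n => etrans (fR n) (esym (hg n)))).
exact: nh.
Qed.

Section Operator.
Variables (q : R) (a b : R -> C).
Hypotheses (q1 : 1 < q) (La : Linf a) (Lb : Linf b).
Let q0 : 0 < q. Proof. exact: lt_trans q1. Qed.
Let q1' : 1 <= q. Proof. exact: ltW. Qed.
Local Notation T := (TH_Hardy q a b).

Let HsP f : Hs q f <-> LS q f /\ forall n : int, n < 0 -> fc f n = 0.
Proof. by []. Qed.

Let LSpsum N c : LS q (psum N c).
Proof. by apply: trigpoly_LS q1' _; exact: psum_trigpoly. Qed.

Let small_eq0 (z : C) : (forall e : R, 0 < e -> cabs z <= e) -> z = 0.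
Proof.
move=> h; apply/cabs_eq0/le_anti; rewrite cabs_ge0 andbT.
by apply/ler_addgt0Pr => e /h; rewrite add0r.
Qed.

Lemma Linf_cint (u : R -> C) : Linf u -> cint u.
Proof.
move=> /Linf_mul[M M0 H]; have [L _] := H q _ q0 (LS_cst 1 q0).
have e : (fun x => u x * 1) = u by apply/funext => x; rewrite mulr1.
by move: L; rewrite e; exact: LS_cint.
Qed.

Lemma fc_mul_ex (u : R -> C) (k n : int) : fc (fun x => u x * ex k x) n = fc u (n - k).
Proof.
rewrite !fc_ex; apply: eq_av => x _; rewrite -mulrA -exD; congr (_ * ex _ _).
by rewrite opprB addrC.
Qed.

(** On analytic polynomials [Jflip] sends frequency [k] to [- k - 1]; density and the boundedness of
    [Jflip] and of the coefficient do the rest. *)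
Lemma Jflip_Hs f (n : nat) : Hs q f -> fc (Jflip f) (Posz n) = 0.
Proof.
move=> Hf; have [Lf f0] := (HsP f).1 Hf; apply: small_eq0 => e e0.
have K1 : 0 < Kav q + 1 by rewrite ltr_wpDl// Kav_ge0.
have eK : 0 < e / (Kav q + 1) by rewrite divr_gt0.
have [N [c fc_]] := analytic_dense q1 eK Hf.
have Lfp := (LSB mD q1' Lf (LSpsum N c)).1.
have [LJ nJ] := LS_Jflip q0 Lfp.
have ce k : cint (@ex R k) by apply: trigpoly_cint; exact: trigpoly_ex.
have E : fc (Jflip f) (Posz n) = fc (Jflip (fun x => f x - psum N c x)) (Posz n).
  have cJ := LS_cint q1 (LS_Jflip q0 Lf).1.
  have cp : cint (fun x => \sum_(k < N) c k * ex (Negz k) x).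
    by apply: cint_sum => k; exact: cintZ.
  rewrite -[LHS]subr0.
  have -> : 0 = fc (fun x => \sum_(k < N) c k * ex (Negz k) x) (Posz n).
    rewrite fc_sum; last by move=> k; exact: cintZ.
    by rewrite big1// => k _; rewrite fcZ// fc_of_ex mulr0.
  rewrite -fcB//; apply: eq_fc => x _.
  by rewrite -Jflip_psum /Jflip mulrBr.
rewrite E; apply: (le_trans (fc_nrm _ q1 LJ)); rewrite nJ.
apply: (@le_trans _ _ (Kav q * (e / (Kav q + 1)))); first by rewrite ler_wpM2l// Kav_ge0.
by rewrite mulrCA ger_pMr// ler_pdivrMr ?mul1r ?lerDl.
Qed.

(** [Jflip f] has negative frequencies only, so [Qproj] fixes it almost everywhere and drops out of
    the coefficient formula. *)
Lemma TH_HardyP : exists2 K : R, 0 <= K & forall f, Hs q f ->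
  [/\ Hs q (T f), nrm q (T f) <= K * nrm q f &
      forall n : nat, fc (T f) (Posz n) =
        fc (fun x => a x * f x) (Posz n) + fc (fun x => b x * Jflip f x) (Posz n)].
Proof.
have [c c0 Rc] := Rproj_spec q1.
have [Ma Ma0 HMa] := Linf_mul La; have [Mb Mb0 HMb] := Linf_mul Lb.
exists (c * Ma + c * (Mb * (1 + c))); first by rewrite addr_ge0// mulr_ge0// mulr_ge0// addr_ge0.
move=> f Hf; have [Lf f0] := (HsP f).1 Hf.
have [LJ nJ] := LS_Jflip q0 Lf; have [LRJ fRJ nRJ] := Rc _ LJ.
have [LQ nQ] := LSB mD q1' LJ LRJ.
have [Laf naf] := HMa _ _ q0 Lf; have [LbQ nbQ] := HMb _ _ q0 LQ.
have [LR1 fR1 nR1] := Rc _ Laf; have [LR2 fR2 nR2] := Rc _ LbQ.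
have [LT nT] := LSD mD q1' LR1 LR2.
have fT n : fc (T f) n = fc (Rproj q (fun x => a x * f x)) n +
    fc (Rproj q (fun x => b x * (Jflip f x - Rproj q (Jflip f) x))) n.
  by apply: fcD; [exact: LS_cint q1 LR1|exact: LS_cint q1 LR2].
split.
- split; first exact: LT.
  by move=> n n0; rewrite fT fR1 fR2 leNgt n0 addr0.
- apply: (le_trans nT); rewrite mulrDl -!mulrA; apply: lerD.
    by apply: (le_trans nR1); exact: (ler_wpM2l c0 naf).
  apply: (le_trans nR2); apply: (ler_wpM2l c0); apply: (le_trans nbQ); apply: (ler_wpM2l Mb0).
  apply: (le_trans nQ); rewrite mulrDl mul1r nJ lerD2l -nJ; exact: nRJ.
move=> n; rewrite fT fR1 fR2; congr (_ + _).
have [LbJ _] := HMb _ _ q0 LJ.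
apply: fc_ae LbQ.1 LbJ.1 _.
have : {ae mu, forall x, D x -> Jflip f x - Rproj q (Jflip f) x = Jflip f x}.
  apply: (fc_inj q1 LQ LJ) => k.
  rewrite fcB; [|exact: LS_cint q1 LJ|exact: LS_cint q1 LRJ].
  by rewrite fRJ; case: k => k; rewrite ?Jflip_Hs// ?subr0//= subr0.
by apply: ae_imp => x h Dx; rewrite h.
Qed.

(** Linearity holds up to a null function, since [Rproj] picks representatives; it is verified on
    Fourier coefficients. *)
Lemma TH_Hardy_lin c f g : Hs q f -> Hs q g ->
  nrm q (fun x => T (fun y => f y + c * g y) x - (T f x + c * T g x)) = 0.
Proof.
move=> Hf Hg; have [Lf f0] := (HsP f).1 Hf; have [Lg g0] := (HsP g).1 Hg.
have [K K0 H] := TH_HardyP.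
have cf := LS_cint q1 Lf; have cg := LS_cint q1 Lg.
have [Lcg _] := LSZ mD c q0 Lg; have [Lfg _] := LSD mD q1' Lf Lcg.
have Hfg : Hs q (fun y => f y + c * g y).
  split; first exact: Lfg.
  by move=> n n0; rewrite fcD ?fcZ ?f0 ?g0 ?mulr0 ?addr0//; exact: cintZ.
have [HTfg _ eTfg] := H _ Hfg; have [HTf _ eTf] := H _ Hf; have [HTg _ eTg] := H _ Hg.
have [LTfg zTfg] := (HsP _).1 HTfg; have [LTf zTf] := (HsP _).1 HTf.
have [LTg zTg] := (HsP _).1 HTg.
have [LcTg _] := LSZ mD c q0 LTg; have [LTs _] := LSD mD q1' LTf LcTg.
have [Ld _] := LSB mD q1' LTfg LTs.
have cTf := LS_cint q1 LTf; have cTg := LS_cint q1 LTg.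
have [Ma Ma0 HMa] := Linf_mul La; have [Mb Mb0 HMb] := Linf_mul Lb.
have caf := LS_cint q1 (HMa _ _ q0 Lf).1; have cag := LS_cint q1 (HMa _ _ q0 Lg).1.
have cbf := LS_cint q1 (HMb _ _ q0 (LS_Jflip q0 Lf).1).1.
have cbg := LS_cint q1 (HMb _ _ q0 (LS_Jflip q0 Lg).1).1.
have [L0 n0] := LS0 mu D q0; rewrite -n0.
apply: (LS_ae mD q0 L0 Ld.1 _).2; apply: (fc_inj q1 Ld L0) => n.
rewrite fcB; [|exact: LS_cint q1 LTfg|exact: LS_cint q1 LTs].
have -> : fc (fun=> 0 : C) n = 0.
  have e : (fun=> 0 : C) = (fun x : R => 0 * T f x) by apply/funext => x; rewrite mul0r.
  by rewrite e fcZ// mul0r.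
rewrite fcD//; last exact: cintZ.
rewrite (fcZ c n cTg); case: n => n; last first.
  have n0' : Negz n < 0 by [].
  rewrite [X in X - _](zTfg _ n0') [X in _ - (X + _)](zTf _ n0').
  by rewrite [X in _ - (_ + _ * X)](zTg _ n0') mulr0 addr0 subrr.
rewrite [X in X - _]eTfg [X in _ - (X + _)]eTf [X in _ - (_ + _ * X)]eTg.
have -> : fc (fun x => a x * (f x + c * g x)) (Posz n) =
    fc (fun x => a x * f x) (Posz n) + c * fc (fun x => a x * g x) (Posz n).
  by rewrite -fcZ// -fcD//; [apply: eq_fc => x _; rewrite mulrDr mulrCA|exact: cintZ].
have -> : fc (fun x => b x * Jflip (fun y => f y + c * g y) x) (Posz n) =
    fc (fun x => b x * Jflip f x) (Posz n) + c * fc (fun x => b x * Jflip g x) (Posz n).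
  rewrite -fcZ// -fcD//; last exact: cintZ.
  by apply: eq_fc => x _; rewrite /Jflip; ring.
by ring.
Qed.

Lemma fc_mul_psum N c (n : nat) : fc (fun x => a x * psum N c x) (Posz n) +
    fc (fun x => b x * Jflip (psum N c) x) (Posz n) =
  \sum_(k < N) (fc a (Posz n - Posz k) + fc b (Posz n + Posz k + 1)) * c k.
Proof.
have ca := Linf_cint La; have cb := Linf_cint Lb.
have E (u : R -> C) (m : nat -> int) : cint u ->
    fc (fun x => u x * \sum_(k < N) c k * ex (m k) x) (Posz n) =
    \sum_(k < N) fc u (Posz n - m k) * c k.
  move=> cu; rewrite (eq_fc (g := fun x => \sum_(k < N) c k * (u x * ex (m k) x))); last first.
    by move=> x _; rewrite mulr_sumr; apply: eq_bigr => k _; rewrite mulrCA.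
  rewrite fc_sum; last by move=> k; apply: cintZ; exact: cint_mul_ex.
  by apply: eq_bigr => k _; rewrite fcZ ?fc_mul_ex 1?mulrC//; exact: cint_mul_ex.
rewrite (E a Posz ca) (eq_fc (g := fun x => b x * \sum_(k < N) c k * ex (Negz k) x)); last first.
  by move=> x _; rewrite Jflip_psum.
rewrite (E b Negz cb) -big_split; apply: eq_bigr => k _ /=.
by rewrite mulrDl NegzE opprK -addn1 PoszD addrA.
Qed.

(** The intertwining relation. For polynomials both sides are the same finite sum, by [fc_mul_psum].
    The hypothesis approximates [f] and [xi] at once by a polynomial and its coefficients, and both
    operators are bounded. *)
Lemma fc_TH_Hardy p f (xi : nat -> C) : 1 < p -> Mp p a -> Mp p b -> Hs q f -> lLS p xi ->
  (forall e : R, 0 < e -> exists N c, nrm q (fun x => f x - psum N c x) <= e /\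
     lnrm p (fun k => xi k - cutoff N c k) <= e) ->
  forall n : nat, fc (T f) (Posz n) = TH_lp a b xi n.
Proof.
move=> p1 Mpa Mpb Hf Lxi approx n; have [Lf f0] := (HsP f).1 Hf.
have p0 := lt_trans ltr01 p1.
have [K K0 H] := TH_HardyP; have [[K1 K10 H1] H2 H3] := TH_lpP p1 Mpa Mpb.
apply/eqP; rewrite -subr_eq0; apply/eqP/small_eq0 => e e0.
pose M := Kav q * K + K1; have M0 : 0 <= M by rewrite addr_ge0// mulr_ge0// Kav_ge0.
have M1 : 0 < M + 1 by rewrite ltr_wpDl.
have [|N [c [h1 h2]]] := approx (e / (M + 1)); first by rewrite divr_gt0.
have LP := LSpsum N c.
have HP : Hs q (psum N c) by split; [exact: LP|move=> m m0; exact: fc_psum_neg].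
have [LD _] := LSB mD q1' Lf LP.
have HD : Hs q (fun x => f x + (-1) * psum N c x).
  have E : (fun x => f x + (-1) * psum N c x) = (fun x => f x - psum N c x).
    by apply/funext => x; rewrite mulN1r.
  rewrite E; split; first exact: LD.
  move=> m m0; rewrite fcB ?f0 ?fc_psum_neg ?subrr//; [exact: LS_cint q1 Lf|exact: LS_cint q1 LP].
have [HTf _ _] := H _ Hf; have [HTP _ eP] := H _ HP; have [HTD nTD _] := H _ HD.
have [LTf _] := (HsP _).1 HTf; have [LTP _] := (HsP _).1 HTP; have [LTD _] := (HsP _).1 HTD.
have d1 : cabs (fc (T f) (Posz n) - fc (T (psum N c)) (Posz n)) <= Kav q * K * (e / (M + 1)).
  have [Ld nd] := LSB mD q1' LTf LTP.
  rewrite -fcB; [|exact: LS_cint q1 LTf|exact: LS_cint q1 LTP].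
  apply: (le_trans (fc_nrm _ q1 Ld)); rewrite -mulrA; apply: ler_wpM2l; first exact: Kav_ge0.
  have L1 := TH_Hardy_lin (-1) Hf HP.
  have [Lz _] := LSZ mD (-1) q0 LTP; have [Ls' _] := LSD mD q1' LTf Lz.
  rewrite -nrm_subE.
  apply: (le_trans (nrm_le_sub q1' LTD Ls')); rewrite L1 addr0; apply: (le_trans nTD).
  by apply: ler_wpM2l => //; rewrite nrm_subE.
have d2 : cabs (fc (T (psum N c)) (Posz n) - TH_lp a b xi n) <= K1 * (e / (M + 1)).
  have Lc := LS_cutoff N c p0.
  have -> : fc (T (psum N c)) (Posz n) = TH_lp a b (cutoff N c) n by rewrite eP fc_mul_psum H3.
  have [Ld nd] := LSB measurableT (ltW p1) Lxi Lc.
  have e1 : TH_lp a b (fun k => xi k - cutoff N c k) n = TH_lp a b xi n - TH_lp a b (cutoff N c) n.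
    have := congr1 (fun u => u n) (H2 (-1) _ _ Lxi Lc); rewrite mulN1r => <-.
    by congr (TH_lp a b _ n); apply/funext => k; rewrite mulN1r.
  rewrite cabsBC -e1; have [LB nB] := H1 _ Ld.
  apply: (le_trans (cabs_le_lnrm n p0 LB)); apply: (le_trans nB); exact: ler_wpM2l.
have -> : fc (T f) (Posz n) - TH_lp a b xi n = (fc (T f) (Posz n) - fc (T (psum N c)) (Posz n)) +
   (fc (T (psum N c)) (Posz n) - TH_lp a b xi n) by rewrite addrA subrK.
apply: (le_trans (cabsD _ _)); apply: (le_trans (lerD d1 d2)).
rewrite -mulrDl -/M mulrCA ger_pMr// ler_pdivrMr ?mul1r ?lerDl//.
Qed.

End Operator.

End Hardy.

(** * The kernels *)

Section Kernels.
Variable R : realType.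
Local Notation C := R[i].
Local Notation mu := (@lebesgue_measure R).
Local Notation D := (@Tdom R).
Local Notation lLS := (LS (@counting nat R) setT).
Local Notation lnrm := (nrm (@counting nat R) setT).
Local Notation LS := (LS mu D).
Local Notation nrm := (nrm mu D).
Local Notation mD := (@measurable_Tdom R).

Lemma lp_banach (p : R) : 1 < p -> banach (@lp R p : set (nat -> C^o)) (lnrm p).
Proof.
move=> p1; have p0 := lt_trans ltr01 p1; have p1' := ltW p1.
have E : @lp R p = [set x | lLS p x] by apply/funext => x; apply/propext; exact: lpP.
rewrite E; split.
- exact: (LS0 _ _ p0).1.
- move=> c f g Lf Lg.
  exact: (LSD measurableT p1' Lf (LSZ measurableT c p0 Lg).1).1.
- by move=> f; exact: nrm_ge0.
- by move=> f g Lf Lg; exact: (LSD measurableT p1' Lf Lg).2.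
- by move=> c f Lf; exact: (LSZ measurableT c p0 Lf).2.
- by move=> w Lw H; exact: (LS_complete measurableT p1' Lw H).
Qed.

Lemma Hs_lin (q : R) c (f g : R -> C) : 1 < q -> Hs q f -> Hs q g ->
  Hs q (fun x => f x + c * g x).
Proof.
move=> q1 [Lf f0] [Lg g0]; have q0 := lt_trans ltr01 q1.
have {}Lf : LS q f := Lf; have {}Lg : LS q g := Lg.
have [Lcg _] := LSZ mD c q0 Lg; have [L _] := LSD mD (ltW q1) Lf Lcg.
split; first exact: L.
move=> n n0; rewrite (fcD n (LS_cint q1 Lf) (LS_cint q1 Lcg)) (fcZ c n (LS_cint q1 Lg)).
by rewrite f0// g0// mulr0 addr0.
Qed.

Lemma Hs_closed (q : R) (h : R -> C) : 1 < q -> LS q h ->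
  (forall e : R, 0 < e -> exists2 f, Hs q f & nrm q (fun x => h x - f x) <= e) -> Hs q h.
Proof.
move=> q1 Lh H; split; first exact: Lh.
move=> n n0; apply/cabs_eq0/le_anti; rewrite cabs_ge0 andbT; apply/ler_addgt0Pr => e e0.
have K1 : 0 < Kav q + 1 by rewrite ltr_wpDl// Kav_ge0.
have [|f [Lf f0] hf] := H (e / (Kav q + 1)); first by rewrite divr_gt0.
have {}Lf : LS q f := Lf; have [Lb _] := LSB mD (ltW q1) Lh Lf.
have -> : fc h n = fc (fun x => h x - f x) n.
  by rewrite (fcB n (LS_cint q1 Lh) (LS_cint q1 Lf)) f0// subr0.
rewrite add0r; apply: (le_trans (fc_nrm n q1 Lb)).
apply: (@le_trans _ _ (Kav q * (e / (Kav q + 1)))); first by rewrite ler_wpM2l// Kav_ge0.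
by rewrite mulrCA ger_pMr// ler_pdivrMr ?mul1r ?lerDl.
Qed.

Lemma Hs_banach (q : R) : 1 < q -> banach (@Hs R q : set (R -> C^o)) (nrm q).
Proof.
move=> q1; have q0 := lt_trans ltr01 q1; have q1' := ltW q1.
have LH f : Hs q f -> LS q f by case.
split.
- have L0 := (LS0 mu D q0).1; split; first exact: L0.
  move=> n _.
  have e : (0 : R -> C^o) = (fun x : R => 0 * (0 : R -> C) x) by apply/funext => x; rewrite mul0r.
  by rewrite e (fcZ 0 n (LS_cint q1 L0)) mul0r.
- by move=> c f g Hf Hg; exact: Hs_lin.
- by move=> f; exact: nrm_ge0.
- by move=> f g Hf Hg; exact: (LSD mD q1' (LH _ Hf) (LH _ Hg)).2.
- by move=> c f Hf; exact: (LSZ mD c q0 (LH _ Hf)).2.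
move=> w Hw H; have [h [Lh hP]] := LS_complete mD q1' (fun n => LH _ (Hw n)) H.
exists h; split; last exact: hP.
apply: Hs_closed q1 Lh _ => e /hP[N hN]; exists (w N); first exact: Hw.
exact: hN.
Qed.

Lemma lp_zero (p : R) (x : nat -> C) : 1 < p -> lp p x -> seq_zero x <-> lnrm p x = 0.
Proof.
move=> p1 /lpP Lx; have p0 := lt_trans ltr01 p1.
by split=> [h|h]; apply/(lnrm_eq0 p0 Lx).
Qed.

Lemma Hs_zero (q : R) (f : R -> C) : 1 < q -> Hs q f -> ae_zero f <-> nrm q f = 0.
Proof.
move=> q1 [Lf _]; have {}Lf : LS q f := Lf; have q0 := lt_trans ltr01 q1.
by have h := nrm_eq0 mD q0 Lf; split=> /h.
Qed.

Lemma Hs_fc_eq0 (q : R) (f : R -> C) : 1 < q -> Hs q f -> seq_zero (fourier_plus f) -> ae_zero f.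
Proof.
move=> q1 [Lf f0] h; have {}Lf : LS q f := Lf; have q0 := lt_trans ltr01 q1.
have L0 := (LS0 mu D q0).1; apply: (fc_inj q1 Lf L0) => n.
have -> : fc (fun=> 0 : C) n = 0.
  have e : (fun=> 0 : C) = (fun x : R => 0 * f x) by apply/funext => x; rewrite mul0r.
  by rewrite e (fcZ 0 n (LS_cint q1 Lf)) mul0r.
case: n => n; first exact: h.
exact: f0.
Qed.

Lemma Hs_ae_fc (q : R) (f : R -> C) n : 1 < q -> Hs q f -> ae_zero f -> fc f n = 0.
Proof.
move=> q1 Hf /(Hs_zero q1 Hf) f0; have [Lf _] := Hf.
apply/cabs_eq0/le_anti; rewrite cabs_ge0 andbT.
by apply: (le_trans (fc_nrm n q1 Lf)); rewrite f0 mulr0.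
Qed.

Lemma Hs_sub (q : R) (f g : R -> C) : 1 < q -> Hs q f -> Hs q g -> Hs q (fun x => f x - g x).
Proof.
move=> q1 Hf Hg; have := Hs_lin (-1) q1 Hf Hg; congr Hs.
by apply/funext => x; rewrite mulN1r.
Qed.

Lemma Hs_eq_fc (q : R) (f g : R -> C) : 1 < q -> Hs q f -> Hs q g ->
  fourier_plus f = fourier_plus g -> nrm q (fun x => f x - g x) = 0.
Proof.
move=> q1 Hf Hg fg; have Hfg := Hs_sub q1 Hf Hg; apply/(Hs_zero q1 Hfg).
apply: (Hs_fc_eq0 q1 Hfg) => n; have [Lf _] := Hf; have [Lg _] := Hg.
rewrite /fourier_plus (fcB n (LS_cint q1 Lf) (LS_cint q1 Lg)).
by have /(congr1 (fun u => u n)) := fg; rewrite /fourier_plus => ->; rewrite subrr.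
Qed.

Section Main.
Variables (p q : R) (a b : R -> C).
Hypotheses (p1 : 1 < p) (pq : p^-1 + q^-1 = 1).
Hypotheses (Ma : Mp p a) (Mb : Mp p b).
Variable k : int.
Hypothesis Fl : fredholm_index (lp p) (@seq_zero R) (TH_lp a b) k.
Hypothesis Fh : fredholm_index (Hs q) (@ae_zero R) (TH_Hardy q a b) k.

Let p0 : 0 < p. Proof. exact: lt_trans p1. Qed.
Let qE : conjex p = q.
Proof. by rewrite /conjex -pq addrC addKr invrK. Qed.
Let q1 : 1 < q. Proof. by rewrite -qE; have [] := conjexP p1. Qed.
Let q0 : 0 < q. Proof. exact: lt_trans q1. Qed.
Let pE : conjex q = p. Proof. by rewrite -qE conjexK. Qed.
Let La : Linf a. Proof. by case: Ma. Qed.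
Let Lb : Linf b. Proof. by case: Mb. Qed.

Let LSpsum N c : LS q (psum N c).
Proof. by apply: trigpoly_LS (ltW q1) _; exact: psum_trigpoly. Qed.

Let TH_lp_lin c (x y : nat -> C) : lp p x -> lp p y ->
  lnrm p (fun j => TH_lp a b (fun i => x i + c * y i) j - (TH_lp a b x j + c * TH_lp a b y j)) = 0.
Proof.
move=> /lpP Lx /lpP Ly; have [_ H _] := TH_lpP p1 Ma Mb; rewrite (H c x y Lx Ly).
rewrite -(LS0 (@counting nat R) setT p0).2; apply: eq_nrm => j _; exact: subrr.
Qed.

(** The first claim is the intertwining relation [inter]; the second has no estimate behind it and
    comes from [kernel_transport]. *)
Let HY_case : q <= 2 ->
  (forall h, Hs q h -> ae_zero (TH_Hardy q a b h) ->
     lp p (fourier_plus h) /\ seq_zero (TH_lp a b (fourier_plus h))) /\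
  (forall xi, lp p xi -> seq_zero (TH_lp a b xi) ->
     exists h, [/\ Hs q h, ae_zero (TH_Hardy q a b h) & fourier_plus h = xi]).
Proof.
move=> q2; have [c c0] := hausdorff_young q1 q2; rewrite pE => HY.
have [K K0 HT] := TH_HardyP q1 La Lb; have [[K1 K10 HB] _ _] := TH_lpP p1 Ma Mb.
have HYs f : Hs q f -> lLS p (fourier_plus f) /\ lnrm p (fourier_plus f) <= c * nrm q f.
  by move=> [Lf _]; exact: HY.
have c1 : 0 < c + 1 by rewrite ltr_wpDl.
have Hps N x : Hs q (psum N x).
  by split; [exact: LSpsum|move=> n n0; exact: fc_psum_neg].
have cutE N x : fourier_plus (psum N x) = cutoff N x.
  by apply/funext => n; exact: fc_psum_nat.
have FB f g : Hs q f -> Hs q g -> fourier_plus (fun x => f x - g x) =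
    fun n => fourier_plus f n - fourier_plus g n.
  move=> [Lf _] [Lg _]; apply/funext => n.
  exact: (fcB n (LS_cint q1 Lf) (LS_cint q1 Lg)).
have inter f : Hs q f -> fourier_plus (TH_Hardy q a b f) = TH_lp a b (fourier_plus f).
  move=> Hf; have [LF _] := HYs f Hf; apply/funext => n.
  apply: (fc_TH_Hardy q1 La Lb p1 Ma Mb Hf LF) => e e0.
  have e1 : 0 < e / (c + 1) by rewrite divr_gt0.
  have [N [x nx]] := analytic_dense q1 e1 Hf; exists N, x; split.
    by apply: (le_trans nx); rewrite ler_pdivrMr// ler_peMr ?lerDr// ltW.
  rewrite -cutE -(FB _ _ Hf (Hps N x)); have Hd := Hs_sub q1 Hf (Hps N x).
  apply: (le_trans (HYs _ Hd).2); apply: (@le_trans _ _ (c * (e / (c + 1)))).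
    exact: (ler_wpM2l c0).
  by rewrite mulrCA ger_pMr// ler_pdivrMr ?mul1r ?lerDl.
split=> [h Hh Zh|xi Lxi Zxi].
  have [LF _] := HYs h Hh; split; first exact/lpP.
  rewrite -(inter _ Hh) => n; have [HTh _ _] := HT _ Hh.
  exact: (Hs_ae_fc n q1 HTh Zh).
have [h [Hh Zh xh]] : exists f, [/\ Hs q f, ae_zero (TH_Hardy q a b f) &
    lnrm p (fun n => xi n - fourier_plus f n) = 0].
  apply: (@kernel_transport R R nat (@Hs R q) (@ae_zero R) (TH_Hardy q a b)
    (@lp R p) (lnrm p) (@seq_zero R) (TH_lp a b) K1 (@fourier_plus R) _ _ _ (lp_banach p1)
    _ _ _ K10 _ _ _ _ _ _ k Fh Fl xi Lxi Zxi).
  - exact: (ban0 (Hs_banach q1)).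
  - by move=> d f g; exact: (banL (Hs_banach q1)).
  - by move=> f /HT[].
  - by move=> f; exact: lp_zero.
  - by move=> f /lpP/HB[Lf _]; exact/lpP.
  - by move=> d f g; exact: TH_lp_lin.
  - by move=> f /lpP/HB[].
  - by move=> f /HYs[Lf _]; exact/lpP.
  - move=> d f g Hf Hg; have [Lf _] := Hf; have [Lg _] := Hg.
    have [Lcg _] := LSZ mD d q0 Lg.
    have E : fourier_plus (fun x => f x + d * g x) = fun n => fourier_plus f n + d * fourier_plus g n.
      apply/funext => n; rewrite /fourier_plus.
      by rewrite (fcD n (LS_cint q1 Lf) (LS_cint q1 Lcg)) (fcZ d n (LS_cint q1 Lg)).
    rewrite -(LS0 (@counting nat R) setT p0).2; apply: eq_nrm => n _.
    by have /(congr1 (fun u => u n)) e := E; apply/eqP; rewrite subr_eq0; apply/eqP.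
  - move=> f Hf; have [LF nF] := HYs f Hf; have LF' := (lpP p _).2 LF; split=> [fz|Nz].
      by apply/(lp_zero p1 LF') => n; exact: (Hs_ae_fc n q1 Hf fz).
    by apply: (Hs_fc_eq0 q1 Hf); apply/(lp_zero p1 LF').
  - move=> f Hf; rewrite -(LS0 (@counting nat R) setT p0).2; apply: eq_nrm => n _.
    by have /(congr1 (fun u => u n)) e := inter f Hf; apply/eqP; rewrite subr_eq0; apply/eqP.
  - move=> x e /lpP Lx e0; have [N hN] := cutoff_cvg p0 e0 Lx.
    exists (psum N x); split; first exact: Hps.
    by rewrite cutE; exact: hN.
exists h; split => //; apply/funext => n.
have [LF _] := HYs h Hh; have Lxi' := (lpP p _).1 Lxi.
have [Ld _] := LSB measurableT (ltW p1) Lxi' LF.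
by have /(lnrm_eq0 p0 Ld)/(_ n)/eqP := xh; rewrite subr_eq0 => /eqP ->.
Qed.

(** The roles are exchanged: the second claim follows from [inter], and the first comes from
    [kernel_transport]. *)
Let inverse_case : p <= 2 ->
  (forall h, Hs q h -> ae_zero (TH_Hardy q a b h) ->
     lp p (fourier_plus h) /\ seq_zero (TH_lp a b (fourier_plus h))) /\
  (forall xi, lp p xi -> seq_zero (TH_lp a b xi) ->
     exists h, [/\ Hs q h, ae_zero (TH_Hardy q a b h) & fourier_plus h = xi]).
Proof.
move=> p2; have [c c0] := inverse_fourier p1 p2; rewrite qE => IF.
have [K K0 HT] := TH_HardyP q1 La Lb; have [[K1 K10 HB] _ _] := TH_lpP p1 Ma Mb.
(* An inverse transform is chosen for each sequence in [l^p]; outside [l^p] the choice is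
   arbitrary. *)
have cho (x : nat -> C) : exists h : R -> C, lp p x ->
    [/\ Hs q h, fourier_plus h = x & forall e : R, 0 < e -> exists N,
      nrm q (fun t => h t - psum N x t) <= e /\ lnrm p (fun k => x k - cutoff N x k) <= e].
  have [/lpP Lx|nL] := pselect (lp p x); last by exists (fun=> 0).
  have [h [Lh h0 hx _ happ]] := IF x Lx; exists h => _; split => //.
pose phi x := projT1 (cid (cho x)).
have phiP x : lp p x -> [/\ Hs q (phi x), fourier_plus (phi x) = x & forall e : R, 0 < e -> exists N,
    nrm q (fun t => phi x t - psum N x t) <= e /\ lnrm p (fun k => x k - cutoff N x k) <= e].
  exact: (projT2 (cid (cho x))).
have inter x : lp p x -> fourier_plus (TH_Hardy q a b (phi x)) = TH_lp a b x.
  move=> Lx; have [Hphi _ app] := phiP x Lx; apply/funext => n.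
  apply: (fc_TH_Hardy q1 La Lb p1 Ma Mb Hphi ((lpP p x).1 Lx)) => e /app[N hN].
  by exists N, x.
have THlp x : lp p x -> lp p (TH_lp a b x) by move=> /lpP/HB[Lx _]; exact/lpP.
split=> [h Hh Zh|xi Lxi Zxi].
  have [x [Lx Zx hx]] : exists x, [/\ lp p x, seq_zero (TH_lp a b x) &
      nrm q (fun t => h t - phi x t) = 0].
    apply: (@kernel_transport R nat R (@lp R p) (@seq_zero R) (TH_lp a b)
      (@Hs R q) (nrm q) (@ae_zero R) (TH_Hardy q a b) K phi _ _ _ (Hs_banach q1)
      _ _ _ K0 _ _ _ _ _ _ k Fl Fh h Hh Zh).
    - exact: (ban0 (lp_banach p1)).
    - by move=> d f g; exact: (banL (lp_banach p1)).
    - exact: THlp.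
    - by move=> f; exact: Hs_zero.
    - by move=> f /HT[].
    - by move=> d f g Hf Hg; exact: (TH_Hardy_lin q1 La Lb d Hf Hg).
    - by move=> f /HT[].
    - by move=> f /phiP[].
    - move=> d f g Lf Lg; have [Hf ef _] := phiP f Lf; have [Hg eg _] := phiP g Lg.
      have Lfg : lp p (fun i => f i + d * g i) by exact: (banL (lp_banach p1)).
      have [Hfg efg _] := phiP _ Lfg.
      apply: (Hs_eq_fc q1 Hfg (Hs_lin d q1 Hf Hg)); rewrite efg; apply/funext => n.
      have [L1 _] := Hf; have [L2 _] := Hg; have [Lcg _] := LSZ mD d q0 L2.
      rewrite /fourier_plus (fcD n (LS_cint q1 L1) (LS_cint q1 Lcg)) (fcZ d n (LS_cint q1 L2)).
      have /(congr1 (fun u => u n)) := ef; rewrite /fourier_plus => ->.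
      by have /(congr1 (fun u => u n)) := eg; rewrite /fourier_plus => ->.
    - move=> f Lf; have [Hf ef _] := phiP f Lf; split=> [fz|/(Hs_zero q1 Hf) Nz].
        by apply/(Hs_zero q1 Hf); apply: (Hs_fc_eq0 q1 Hf); rewrite ef.
      by rewrite -ef => n; exact: (Hs_ae_fc n q1 Hf Nz).
    - move=> f Lf; have [Hf ef _] := phiP f Lf; have [HTf _ _] := HT _ Hf.
      have [HBf eBf _] := phiP _ (THlp _ Lf).
      by apply: (Hs_eq_fc q1 HBf HTf); rewrite eBf inter.
    move=> f e Hf e0; have e2 : 0 < e by [].
    have [N [x nx]] := analytic_dense q1 e2 Hf.
    have Lx : lp p (cutoff N x) by apply/lpP; exact: LS_cutoff.
    have [Hx ex _] := phiP _ Lx; exists (cutoff N x); split => //.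
    have Hps : Hs q (psum N x) by split; [exact: LSpsum|move=> n n0; exact: fc_psum_neg].
    have z : nrm q (fun t => psum N x t - phi (cutoff N x) t) = 0.
      apply: (Hs_eq_fc q1 Hps Hx); rewrite ex; apply/funext => n; exact: fc_psum_nat.
    have [Lf _] := Hf; have [L1 _] := Hps; have [L2 _] := Hx.
    have := nrm_triangle mD (ltW q1) Lf L1 L2 nx (lexx _); rewrite z addr0; exact.
  have [Hphi ephi _] := phiP x Lx; have Hd := Hs_sub q1 Hh Hphi.
  have eh : fourier_plus h = x.
    rewrite -ephi; apply/funext => n; have := Hs_ae_fc n q1 Hd ((Hs_zero q1 Hd).2 hx).
    have [L1 _] := Hh; have [L2 _] := Hphi.
    by rewrite (fcB n (LS_cint q1 L1) (LS_cint q1 L2)) => /eqP; rewrite subr_eq0 => /eqP.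
  by rewrite eh.
have [Hphi ephi _] := phiP xi Lxi; have [HTphi _ _] := HT _ Hphi.
exists (phi xi); split => //; apply: (Hs_fc_eq0 q1 HTphi).
by rewrite inter.
Qed.

Lemma kernels_isomorphic :
  (forall h, Hs q h -> ae_zero (TH_Hardy q a b h) ->
     lp p (fourier_plus h) /\ seq_zero (TH_lp a b (fourier_plus h))) /\
  (forall xi, lp p xi -> seq_zero (TH_lp a b xi) ->
     exists h, [/\ Hs q h, ae_zero (TH_Hardy q a b h) & fourier_plus h = xi]).
Proof.
have [p2|p2] := leP p 2; first exact: inverse_case.
apply: HY_case; rewrite -qE /conjex -[leRHS]invrK lef_pV2 ?posrE ?subr_gt0 ?invf_lt1//.
by have : p^-1 <= 2^-1 by [rewrite lef_pV2 ?posrE// ltW]; move: (p^-1) => x; lra.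
Qed.

End Main.

End Kernels.

Theorem theorem6p3 (R : realType) (p q : R) (a b : R -> R[i]) :
  1 < p -> p^-1 + q^-1 = 1 ->
  class_Lpq p q a b ->
  [/\ (* F maps ker(T_q(a)+H_q(b)) into ker(T_p(a)+H_p(b)) *)
      (forall h, Hs q h -> ae_zero (TH_Hardy q a b h) ->
         lp p (fourier_plus h) /\ seq_zero (TH_lp a b (fourier_plus h))),
      (* injectively (modulo a.e. equality) *)
      (forall h, Hs q h -> ae_zero (TH_Hardy q a b h) ->
         seq_zero (fourier_plus h) -> ae_zero h) &
      (* and onto *)
      (forall xi, lp p xi -> seq_zero (TH_lp a b xi) ->
         exists h, [/\ Hs q h, ae_zero (TH_Hardy q a b h) &
                       fourier_plus h = xi])].
Proof.
move=> p1 pq [Ma Mb _ _ [k [Fl Fh]]].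
have [h1 h2] := kernels_isomorphic p1 pq Ma Mb Fl Fh.
split => // h Hh _; apply: Hs_fc_eq0 Hh.
have -> : q = conjex p by rewrite /conjex -pq addrC addKr invrK.
by have [] := conjexP p1.
Qed.
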